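(* Let $v$ be an admissible function and let $\eta,\psi\in\mathcal S(\mathbb{R})\setminus\{0\}$. If $f\in\mathrm{H\ddot{o}r}^2_v(\mathbb{R};\eta)$, then $f\in\mathrm{H\ddot{o}r}^2_v(\mathbb{R};\psi)$ and \[\|f\|_{\mathrm{H\ddot{o}r}^2_v(\mathbb{R};\psi)}\lesssim\|f\|_{\mathrm{H\ddot{o}r}^2_v(\mathbb{R};\eta)},\] with a constant independent of $f$.
   Context: A measurable $v:\mathbb{R}\to(0,\infty)$ is admissible if $v\ge1$ and $\sup_{s,t\in\mathbb{R}}\frac{v(s+t)}{v(s)+v(t)}<\infty$. $\mathcal S(\mathbb{R})$ is the Schwartz space. $\mathrm{W}^2_v(\mathbb{R})=\{f\in L^2(\mathbb{R}): v f^\vee\in L^2(\mathbb{R})\}$ with norm $\|vf^\vee\|_2$, where $f^\vee$ is the inverse Fourier transform. For $0\ne\psi\in C^\infty(\mathbb{R})$ and $\tau_t\psi=\psi(\cdot-t)$, $\mathrm{H\ddot{o}r}^2_v(\mathbb{R};\psi)$ is the space of $f\in L^2_{\mathrm{loc}}(\mathbb{R})$ with $\tau_t\psi\cdot f\in\mathrm{W}^2_v(\mathbb{R})$ for all $t\in\mathbb{R}$ and $\|f\|_{\mathrm{H\ddot{o}r}^2_v(\mathbb{R};\psi)}:=\sup_{t\in\mathbb{R}}\|\tau_t\psi\cdot f\|_{\mathrm{W}^2_v(\mathbb{R})}<\infty$. *)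

(* Defs.v *)
From HB Require Import structures.
From mathcomp Require Import all_boot all_order all_algebra.
From mathcomp Require Import all_classical all_reals all_analysis.
From mathcomp Require Import complex.
Set Implicit Arguments. Unset Strict Implicit. Unset Printing Implicit Defensive.
Import Order.TTheory GRing.Theory Num.Theory.
Import numFieldNormedType.Exports.
Local Open Scope classical_set_scope.
Local Open Scope ring_scope.
Local Open Scope complex_scope.

Definition admissible {R : realType} (v : R -> R) : Prop :=
  measurable_fun setT v /\ (forall x, 1 <= v x) /\
  exists C : R, forall s t, v (s + t) <= C * (v s + v t).

Definition smoothR {R : realType} (g : R -> R) : Prop :=
  forall (n : nat) (x : R), derivable (derive1n n g) x 1.

Definition schwartzR {R : realType} (g : R -> R) : Prop :=
  smoothR g /\ forall k n : nat, exists M : R, forall x : R,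
    `| x ^+ k * derive1n n g x | <= M.

Definition schwartz {R : realType} (phi : R -> R[i]) : Prop :=
  schwartzR (fun x => complex.Re (phi x)) /\ schwartzR (fun x => complex.Im (phi x)).

Definition cmeasurable {R : realType} (f : R -> R[i]) : Prop :=
  measurable_fun setT (fun x => complex.Re (f x)) /\ measurable_fun setT (fun x => complex.Im (f x)).

Definition abs2 {R : realType} (f : R -> R[i]) (x : R) : R :=
  complex.Re (f x) ^+ 2 + complex.Im (f x) ^+ 2.

Definition L2 {R : realType} (f : R -> R[i]) : Prop :=
  cmeasurable f /\
  (\int[@lebesgue_measure R]_x ((abs2 f x)%:E) < +oo)%E.

Definition L2loc {R : realType} (f : R -> R[i]) : Prop :=
  cmeasurable f /\ forall a b : R,
  (\int[@lebesgue_measure R]_(x in `[a, b]) ((abs2 f x)%:E) < +oo)%E.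

Definition cint {R : realType} (F : R -> R[i]) : R[i] :=
  (Rintegral (@lebesgue_measure R) setT (fun x => complex.Re (F x)))
  +i* (Rintegral (@lebesgue_measure R) setT (fun x => complex.Im (F x))).

Definition expi {R : realType} (a : R) : R[i] := (cos a) +i* (sin a).

Definition invFT {R : realType} (phi : R -> R[i]) (xi : R) : R[i] :=
  cint (fun x => phi x * expi (2 * pi * x * xi)).

(* g is (a representative of) the inverse Fourier transform of f in L^2,
   characterized by duality against Schwartz functions. *)
Definition IsInvFT {R : realType} (f g : R -> R[i]) : Prop :=
  L2 g /\ forall phi : R -> R[i], schwartz phi ->
    cint (fun x => g x * phi x) = cint (fun x => f x * invFT phi x).

Definition wint2 {R : realType} (v : R -> R) (g : R -> R[i]) : \bar R :=
  (\int[@lebesgue_measure R]_x (((v x) ^+ 2 * abs2 g x)%:E))%E.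

Definition Wmem {R : realType} (v : R -> R) (f : R -> R[i]) : Prop :=
  L2 f /\ exists g, IsInvFT f g /\ (wint2 v g < +oo)%E.

(* || f ||_{W^2_v} = || v f^v ||_2  (the value does not depend on the a.e.
   representative g of f^v) *)
Definition Wnorm {R : realType} (v : R -> R) (f : R -> R[i]) : R :=
  Num.sqrt (fine (ereal_inf [set wint2 v g | g in [set g | IsInvFT f g]])).

Definition tau {R : realType} (t : R) (psi : R -> R[i]) : R -> R[i] :=
  fun x => psi (x - t).

Definition Hnorm {R : realType} (v : R -> R) (psi f : R -> R[i]) : \bar R :=
  ereal_sup [set (Wnorm v (fun x => tau t psi x * f x))%:E | t in [set: R]].

Definition Hmem {R : realType} (v : R -> R) (psi f : R -> R[i]) : Prop :=
  L2loc f /\ (forall t : R, Wmem v (fun x => tau t psi x * f x)) /\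
  (Hnorm v psi f < +oo)%E.

(* Main.v *)
Require Import Defs.
From HB Require Import structures.
From mathcomp Require Import all_boot all_order all_algebra.
From mathcomp Require Import all_classical all_reals all_analysis.
From mathcomp Require Import measurable_realfun.
From mathcomp Require Import complex.
From mathcomp Require Import ring lra.
Set Implicit Arguments. Unset Strict Implicit. Unset Printing Implicit Defensive.
Import Order.TTheory GRing.Theory Num.Theory.
Import numFieldNormedType.Exports.
Local Open Scope classical_set_scope.
Local Open Scope ring_scope.
Local Open Scope complex_scope.

(** Dividing by [eta] near a point where it does not vanish gives a compactly supported
    smooth [rho] whose translates by the points [s k] of a lattice satisfy
    [\sum_k tau (s k) (rho * eta) = 1].  Hence
    [tau t psi * f = \sum_k tau t (m k) * (tau (t + s k) eta * f)] with
    [m k := psi * tau (s k) rho], and on the Fourier side each term is the convolution of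
    [invFT (tau t (m k))] with the inverse transform of a piece of [f] whose weighted norm
    is controlled by [Hnorm v eta f].  An admissible [v] has polynomial growth, so with
    [w x := (1 + x^2)^-1] the kernels satisfy [v * |invFT (m k)| <= K * w (s k) * w]; as
    [v (x + y) <= 2 C v x v y], Young's inequality bounds the [k]-th term by a multiple of
    [w (s k) * Hnorm v eta f], which is summable in [k].

    Inverse transforms are defined by duality, so the pieces of [f] are only known to be
    square-integrable uniformly in [k] through the inequality [||h|| <= ||g||] for [g] an
    inverse transform of [h] (plancherel_le). *)

(** * Complex-valued integrals *)

(** Since [f] is only locally square-integrable, no transform of [f] itself is available: each
    estimate is made on a piece [tau b eta * f], and the sum over [k] is taken on both sides of the
    duality identity. Passing to the limit there needs a square-integrable majorant of the partial
    sums on each side; [v >= 1] lets the weighted bounds serve for this unweighted purpose too. The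
    constant is uniform in [t] because a translation multiplies an inverse transform by a unimodular
    factor only. The growth of [v], which is merely measurable, is obtained in two stages: a
    Steinhaus argument gives a bound near the origin, and the doubling inequality
    [v (2 x) <= 2 C v x] propagates it. Functions are handled pointwise everywhere whenever possible
    (bounded kernels, series converging at every point), so that exceptional null sets appear only
    in the Plancherel inequality. The weighted norm is an infimum over representatives of the
    inverse transform, which may not be attained a priori; the bounds are therefore proved up to an
    error [e], removed at the very end. *)

Notation Re := complex.Re.
Notation Im := complex.Im.
Notation cn := ComplexField.Normc.normc.
Notation leb := (@lebesgue_measure _).
Notation Rint f := (Rintegral (@lebesgue_measure _) setT f).
Notation intb f := ((@lebesgue_measure _).-integrable setT (EFin \o f)).

Section ComplexModulus.
Variable R : realType.
Implicit Types z w : R[i].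

Lemma ReD z w : Re (z + w) = Re z + Re w. Proof. by case: z w => ? ? []. Qed.
Lemma ImD z w : Im (z + w) = Im z + Im w. Proof. by case: z w => ? ? []. Qed.
Lemma ReN z : Re (- z) = - Re z. Proof. by case: z. Qed.
Lemma ImN z : Im (- z) = - Im z. Proof. by case: z. Qed.
Lemma ReM z w : Re (z * w) = Re z * Re w - Im z * Im w.
Proof. by case: z w => ? ? []. Qed.
Lemma ImM z w : Im (z * w) = Re z * Im w + Im z * Re w.
Proof. by case: z w => ? ? [? ?] /=. Qed.
Lemma ReJ z : Re (conjc z) = Re z. Proof. by case: z. Qed.
Lemma ImJ z : Im (conjc z) = - Im z. Proof. by case: z. Qed.
Definition ReImE := (ReD, ImD, ReN, ImN, ReM, ImM, ReJ, ImJ).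

Lemma ReIm_eq z w : Re z = Re w -> Im z = Im w -> z = w.
Proof. by case: z w => ? ? [? ?] /= -> ->. Qed.

Lemma cnE z : cn z = Num.sqrt (Re z ^+ 2 + Im z ^+ 2). Proof. by case: z. Qed.
Lemma cn_sqr z : cn z ^+ 2 = Re z ^+ 2 + Im z ^+ 2.
Proof. by rewrite cnE sqr_sqrtr// addr_ge0 ?sqr_ge0. Qed.
Lemma cn_ge0 z : 0 <= cn z. Proof. by rewrite cnE sqrtr_ge0. Qed.
Lemma cn_ler z (a : R) : 0 <= a -> Re z ^+ 2 + Im z ^+ 2 <= a ^+ 2 -> cn z <= a.
Proof. by move=> a0; rewrite -cn_sqr ler_pXn2r// nnegrE cn_ge0. Qed.
Lemma abs2E (F : R -> R[i]) x : abs2 F x = cn (F x) ^+ 2.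
Proof. by rewrite cn_sqr. Qed.
Lemma cnJ z : cn (conjc z) = cn z. Proof. by rewrite !cnE ReJ ImJ sqrrN. Qed.
Lemma cnN z : cn (- z) = cn z. Proof. by rewrite !cnE ReN ImN !sqrrN. Qed.
Lemma cnM z w : cn (z * w) = cn z * cn w. Proof. exact: ComplexField.Normc.normcM. Qed.
Lemma cnD z w : cn (z + w) <= cn z + cn w. Proof. exact: (@le_normcD R). Qed.
Lemma cn0 : cn (0 : R[i]) = 0.
Proof. exact: ComplexField.Normc.normc0. Qed.
Lemma Re_le_cn z : `|Re z| <= cn z.
Proof. by rewrite cnE -sqrtr_sqr ler_wsqrtr// lerDl sqr_ge0. Qed.
Lemma Im_le_cn z : `|Im z| <= cn z.
Proof. by rewrite cnE -sqrtr_sqr ler_wsqrtr// lerDr sqr_ge0. Qed.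
Lemma cn_le_ReIm z : cn z <= `|Re z| + `|Im z|.
Proof.
apply: cn_ler; first by rewrite addr_ge0.
rewrite sqrrD !real_normK ?num_real// -addrA [X in _ <= _ + X]addrC addrA lerDl.
by rewrite mulrn_wge0 // mulr_ge0.
Qed.
Lemma Re_rmul (a : R) z : Re (a%:C * z) = a * Re z.
Proof. by rewrite ReM /= mul0r subr0. Qed.
Lemma Im_rmul (a : R) z : Im (a%:C * z) = a * Im z.
Proof. by rewrite ImM /= mul0r addr0. Qed.
Lemma mul_conjc z : z * conjc z = (cn z ^+ 2)%:C.
Proof. by apply: ReIm_eq; rewrite !ReImE ?cn_sqr /=; ring. Qed.
Lemma cn_real (a : R) : cn (a%:C) = `|a|.
Proof. by rewrite cnE /= expr0n/= addr0 sqrtr_sqr. Qed.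
Lemma cn_expi (a : R) : cn (expi a) = 1.
Proof. by rewrite cnE /= cos2Dsin2 sqrtr1. Qed.
Lemma expiD (a b : R) : expi (a + b) = expi a * expi b.
Proof. by apply: ReIm_eq; rewrite ReImE /= ?cosD ?sinD; ring. Qed.
Lemma conjM z w : conjc (z * w) = conjc z * conjc w.
Proof. by apply: ReIm_eq; rewrite !ReImE; ring. Qed.
Lemma conj_expi (a : R) : conjc (expi a) = expi (- a).
Proof. by apply: ReIm_eq; rewrite /= ?cosN ?sinN. Qed.
End ComplexModulus.

Definition cmeas {R : realType} d (T : measurableType d) (F : T -> R[i]) :=
  measurable_fun setT (fun x => Re (F x)) /\ measurable_fun setT (fun x => Im (F x)).

Section ComplexMeasurable.
Context {R : realType} d (T : measurableType d).
Implicit Types F G : T -> R[i].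

Lemma cmeasD F G : cmeas F -> cmeas G -> cmeas (fun x => F x + G x).
Proof.
by move=> [a b] [c e]; split; under eq_fun do rewrite ReImE; apply: measurable_funD.
Qed.
Lemma cmeasM F G : cmeas F -> cmeas G -> cmeas (fun x => F x * G x).
Proof.
move=> [a b] [c e]; split; under eq_fun do rewrite ReImE.
  by apply: measurable_funB; apply: measurable_funM.
by apply: measurable_funD; apply: measurable_funM.
Qed.
Lemma cmeasJ F : cmeas F -> cmeas (fun x => conjc (F x)).
Proof.
move=> [a b]; split; under eq_fun do rewrite ReImE; first exact: a.
exact: (measurable_funN b).
Qed.
Lemma cmeas_cst c : cmeas (fun _ : T => c : R[i]).
Proof. by split; exact: measurable_cst. Qed.
Lemma cmeas_real (f : T -> R) : measurable_fun setT f -> cmeas (fun x => (f x)%:C).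
Proof. by move=> mf; split => //=; exact: measurable_cst. Qed.
Lemma cmeas_expi (f : T -> R) : measurable_fun setT f -> cmeas (fun x => expi (f x)).
Proof.
move=> mf; split => /=; [apply: (measurableT_comp (f := cos))|apply: (measurableT_comp (f := sin))] => //;
  apply: continuous_measurable_fun; [exact: continuous_cos|exact: continuous_sin].
Qed.
Lemma cmeas_cn F : cmeas F -> measurable_fun setT (fun x => cn (F x)).
Proof.
move=> [a b]; under eq_fun do rewrite cnE.
apply: (measurableT_comp (continuous_measurable_fun (@sqrt_continuous R))).
by apply: measurable_funD; apply: measurable_funX.
Qed.
Lemma cmeas_sum n (F : nat -> T -> R[i]) : (forall k, cmeas (F k)) ->
  cmeas (fun x => \sum_(k < n) F k x).
Proof.
move=> mF; elim: n => [|n IH].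
  under eq_fun do rewrite big_ord0; exact: cmeas_cst.
by under eq_fun do rewrite big_ord_recr/=; exact: cmeasD.
Qed.
End ComplexMeasurable.

Lemma cmeas_comp {R : realType} d1 d2 (T1 : measurableType d1) (T2 : measurableType d2)
  (F : T2 -> R[i]) (h : T1 -> T2) : measurable_fun setT h -> cmeas F ->
  cmeas (fun x => F (h x)).
Proof. by move=> mh [a b]; split; [exact: (measurableT_comp a mh)|exact: (measurableT_comp b mh)]. Qed.

Definition cI {R : realType} (F : R -> R[i]) :=
  intb (fun x => Re (F x)) /\ intb (fun x => Im (F x)).

Section ComplexIntegral.
Context {R : realType}.
Implicit Types F G : R -> R[i].
Implicit Types f g : R -> R.

Lemma EFin_meas f : measurable_fun setT f -> measurable_fun setT (EFin \o f).
Proof. by move=> mf; apply/measurable_EFinP. Qed.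

Lemma intb_meas f : intb f -> measurable_fun setT f.
Proof. by move=> /measurable_int /measurable_EFinP. Qed.

Lemma intb_le f g : measurable_fun setT f -> intb g -> (forall x, `|f x| <= g x) -> intb f.
Proof.
move=> mf ig fg; apply: (le_integrable _ _ _ ig) => //.
  exact/measurable_EFinP.
by move=> x _; rewrite /= lee_fin (le_trans (fg x))// ler_norm.
Qed.

Lemma intbD f g : intb f -> intb g -> intb (fun x => f x + g x).
Proof. by move=> a b; have := integrableD measurableT a b. Qed.
Lemma intbB f g : intb f -> intb g -> intb (fun x => f x - g x).
Proof. by move=> a b; have := integrableB measurableT a b. Qed.
Lemma intbZ (c : R) f : intb f -> intb (fun x => c * f x).
Proof. by move=> a; have := integrableZl measurableT c a. Qed.
Lemma intb_norm f : intb f -> intb (fun x => `|f x|).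
Proof. exact: integrable_norm. Qed.

Lemma cI_meas F : cI F -> cmeas F.
Proof. by move=> [/intb_meas a /intb_meas b]. Qed.

Lemma cI_le F g : cmeas F -> intb g -> (forall x, cn (F x) <= g x) -> cI F.
Proof.
move=> [a b] ig Fg; split; apply: (intb_le _ ig) => // x; apply: le_trans (Fg x).
  exact: Re_le_cn.
exact: Im_le_cn.
Qed.

Lemma cI_cn F : cI F -> intb (fun x => cn (F x)).
Proof.
move=> iF; have [a b] := iF.
apply: (@intb_le _ (fun x => `|Re (F x)| + `|Im (F x)|)).
- exact/cmeas_cn/cI_meas.
- by apply: intbD; exact: intb_norm.
- by move=> x; rewrite ger0_norm ?cn_ge0// cn_le_ReIm.
Qed.

Lemma cID F G : cI F -> cI G -> cI (fun x => F x + G x).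
Proof.
by move=> [a b] [c d]; split; under eq_fun do rewrite ReImE; apply: intbD.
Qed.

Lemma cIZ (c : R[i]) F : cI F -> cI (fun x => c * F x).
Proof.
move=> [a b]; split; under eq_fun do rewrite ReImE.
  by apply: intbB; apply: intbZ.
by apply: intbD; apply: intbZ.
Qed.

Lemma cint_add F G : cI F -> cI G -> cint (fun x => F x + G x) = cint F + cint G.
Proof.
move=> [a b] [c d]; apply: ReIm_eq; rewrite ReImE /=;
  under eq_Rintegral do rewrite ReImE; exact: RintegralD.
Qed.

Lemma cintZ (c : R[i]) F : cI F -> cint (fun x => c * F x) = c * cint F.
Proof.
move=> [a b]; apply: ReIm_eq; rewrite ReImE /=; under eq_Rintegral do rewrite ReImE.
- by rewrite RintegralB ?RintegralZl//; exact: intbZ.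
- by rewrite RintegralD ?RintegralZl//; exact: intbZ.
Qed.

Lemma cintJ F : cI F -> cint (fun x => conjc (F x)) = conjc (cint F).
Proof.
move=> [a b]; apply: ReIm_eq; rewrite ReImE /=; under eq_Rintegral do rewrite ReImE; first by [].
rewrite -[RHS]mulN1r -RintegralZl//; apply: eq_Rintegral => x _; by rewrite mulN1r.
Qed.

Lemma cint_sum n (F : nat -> R -> R[i]) : (forall k, cI (F k)) ->
  cI (fun x => \sum_(k < n) F k x) /\
  cint (fun x => \sum_(k < n) F k x) = \sum_(k < n) cint (F k).
Proof.
move=> iF; elim: n => [|n [IH1 IH2]].
  have -> : (fun x : R => \sum_(k < 0) F k x) = (fun _ => 0) by apply/funext => x; rewrite big_ord0.
  split; first by split; exact: integrable0.
  by rewrite big_ord0; apply: ReIm_eq; rewrite /= /Rintegral integral0.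
have -> : (fun x => \sum_(k < n.+1) F k x) = (fun x => (\sum_(k < n) F k x) + F n x).
  by apply/funext => x; rewrite big_ord_recr.
by split; [exact: cID|rewrite cint_add// IH2 big_ord_recr].
Qed.

Lemma Rint_le f g : intb f -> intb g -> (forall x, f x <= g x) -> Rint f <= Rint g.
Proof. by move=> a b fg; apply: le_Rintegral. Qed.

(** Multiplying by the conjugate of [z = cint F] makes the integral real: [|z|^2] is the real part
    of the integral of [conjc z * F], at most [|z|] times the integral of [|F|]. *)
Lemma cint_norm F : cI F -> cn (cint F) <= Rint (fun x => cn (F x)).
Proof.
move=> iF; set z := cint F.
have [z0|z0] := eqVneq (cn z) 0.
  by rewrite z0; apply: Rintegral_ge0 => x _; exact: cn_ge0.
have zp : 0 < cn z by rewrite lt_def z0 cn_ge0.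
rewrite -(ler_pM2l zp) -expr2 cn_sqr.
have -> : Re z ^+ 2 + Im z ^+ 2 = Re (cint (fun x => conjc z * F x)).
  by rewrite cintZ// ReImE ReJ ImJ -/z; ring.
rewrite -RintegralZl//; last exact: cI_cn.
apply: Rint_le.
- by case: (cIZ (conjc z) iF).
- by apply: intbZ; exact: cI_cn.
- by move=> x; rewrite (le_trans (ler_norm _))// (le_trans (Re_le_cn _))// cnM cnJ.
Qed.

Lemma eq_cint F G : (forall x, F x = G x) -> cint F = cint G.
Proof. by move=> FG; congr cint; apply/funext. Qed.

Lemma EFin_Rint f : intb f -> (Rint f)%:E = (\int[leb]_x (f x)%:E)%E.
Proof. by move=> ?; rewrite /Rintegral fineK//; exact: integrable_fin_num. Qed.

Lemma intb_ge0P f (c : R) : measurable_fun setT f -> (forall x, 0 <= f x) ->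
  (\int[@lebesgue_measure R]_x (f x)%:E <= c%:E)%E -> intb f.
Proof.
move=> mf f0 h; apply/integrableP; split; first exact/measurable_EFinP.
under eq_integral => x _ do rewrite /= ger0_norm//.
by apply: le_lt_trans h _; rewrite ltry.
Qed.

Lemma intb_ge0_lty f : measurable_fun setT f -> (forall x, 0 <= f x) ->
  (\int[@lebesgue_measure R]_x (f x)%:E < +oo)%E -> intb f.
Proof.
move=> mf f0 h; apply/integrableP; split; first exact/measurable_EFinP.
by under eq_integral => x _ do rewrite /= ger0_norm//.
Qed.

Lemma Rint_dct (f_ : nat -> R -> R) f g :
  (forall n, measurable_fun setT (f_ n)) -> (forall x, f_ n x @[n --> \oo] --> f x) ->
  intb g -> (forall n x, `|f_ n x| <= g x) ->
  intb f /\ Rint (f_ n) @[n --> \oo] --> Rint f.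
Proof.
move=> mf ff ig fg.
have mF : measurable_fun setT f by apply: (measurable_fun_cvg (h := f_)) => // x _; exact: ff.
have [||||h1 _ h3] := @dominated_convergence _ _ _ (@lebesgue_measure R) setT measurableT
  (fun n => EFin \o f_ n) (EFin \o f) (EFin \o g) _ _ _ ig _.
- by move=> n; exact: (EFin_meas (mf n)).
- exact: (EFin_meas mF).
- apply: (@aeW _ _ _ leb) => x _; apply: cvg_EFin; [exact: nearW|exact: ff].
- by apply: (@aeW _ _ _ leb) => x n _ /=; rewrite lee_fin; exact: fg.
split => //.
have i_ n : intb (f_ n) by apply: (intb_le _ ig).
apply/fine_cvg; rewrite EFin_Rint//.
Qed.

Definition ccvg (z_ : nat -> R[i]) (z : R[i]) :=
  (Re (z_ n) @[n --> \oo] --> Re z) /\ (Im (z_ n) @[n --> \oo] --> Im z).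

Lemma cint_dct (F_ : nat -> R -> R[i]) F g :
  (forall n, cmeas (F_ n)) -> (forall x, ccvg (fun n => F_ n x) (F x)) ->
  intb g -> (forall n x, cn (F_ n x) <= g x) ->
  cI F /\ ccvg (fun n => cint (F_ n)) (cint F).
Proof.
move=> mF FF ig Fg.
have [|||a1 a2] := @Rint_dct (fun n x => Re (F_ n x)) (fun x => Re (F x)) g _ _ ig.
- by move=> n; case: (mF n).
- by move=> x; case: (FF x).
- by move=> n x; apply: le_trans (Fg n x); exact: Re_le_cn.
have [|||b1 b2] := @Rint_dct (fun n x => Im (F_ n x)) (fun x => Im (F x)) g _ _ ig.
- by move=> n; case: (mF n).
- by move=> x; case: (FF x).
- by move=> n x; apply: le_trans (Fg n x); exact: Im_le_cn.
by [].
Qed.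

Lemma ccvg_unique z_ (z w : R[i]) : ccvg z_ z -> ccvg z_ w -> z = w.
Proof.
by move=> [a b] [c d]; apply: ReIm_eq; [exact: (cvg_unique _ a c)|exact: (cvg_unique _ b d)].
Qed.

Lemma tonelli_meas (h : R -> R -> R) :
  measurable_fun setT (fun p : R * R => h p.1 p.2) -> (forall x y, 0 <= h x y) ->
  measurable_fun setT (fun x : R => (\int[@lebesgue_measure R]_y (h x y)%:E)%E).
Proof.
move=> /measurable_EFinP mh h0.
by have := measurable_fun_fubini_tonelli_F (m2 := @lebesgue_measure R) _ mh; apply => p /=; rewrite lee_fin.
Qed.

Lemma tonelliR (h : R -> R -> R) :
  measurable_fun setT (fun p : R * R => h p.1 p.2) -> (forall x y, 0 <= h x y) ->
  (\int[@lebesgue_measure R]_x \int[@lebesgue_measure R]_y (h x y)%:E =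
   \int[@lebesgue_measure R]_y \int[@lebesgue_measure R]_x (h x y)%:E)%E.
Proof.
move=> /measurable_EFinP mh h0.
have := fubini_tonelli (m1 := @lebesgue_measure R) (m2 := @lebesgue_measure R) _ mh.
by apply => p /=; rewrite lee_fin.
Qed.

(** Sections are assumed integrable at every point, so that the real-valued [Rint (f x)] coincides
    everywhere with the extended-valued inner integral of Fubini's theorem. *)
Lemma Rint_Fubini (f : R -> R -> R) :
  measurable_fun setT (fun p : R * R => f p.1 p.2) ->
  (forall x, intb (f x)) -> (forall y, intb (f^~ y)) ->
  (\int[@lebesgue_measure R]_x \int[@lebesgue_measure R]_y (`|f x y|)%:E < +oo)%E ->
  intb (fun x => Rint (f x)) /\
  (Rint (fun x => Rint (f x)) = Rint (fun y => Rint (f^~ y))).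
Proof.
move=> mf fx fy fin.
pose F (p : R * R) := (f p.1 p.2)%:E.
have mF : measurable_fun setT F by exact/measurable_EFinP.
have iF : (@lebesgue_measure R \x @lebesgue_measure R)%E.-integrable setT F.
  by apply: (integrable12ltyP (@lebesgue_measure R) (@lebesgue_measure R) mF).2.
have e1 x : (Rint (f x))%:E = (\int[leb]_y F (x, y))%E by exact: EFin_Rint.
have e2 y : (Rint (f^~ y))%:E = (\int[leb]_x F (x, y))%E by exact: EFin_Rint.
have E1 : EFin \o (fun x => Rint (f x)) = (fun x => \int[leb]_y F (x, y))%E.
  exact/funext.
split; first by rewrite E1; exact: (integrable_fubini_F iF).
congr fine; under eq_integral do rewrite e1; under [RHS]eq_integral do rewrite e2.
exact: (Fubini iF).
Qed.

Lemma cFubini (F : R -> R -> R[i]) :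
  cmeas (fun p : R * R => F p.1 p.2) ->
  (forall x, cI (F x)) -> (forall y, cI (F^~ y)) ->
  (\int[@lebesgue_measure R]_x \int[@lebesgue_measure R]_y (cn (F x y))%:E < +oo)%E ->
  cI (fun x => cint (F x)) /\
  (cint (fun x => cint (F x)) = cint (fun y => cint (F^~ y))).
Proof.
move=> mF Fx Fy fin; have [mr mi] := mF.
have mc : measurable_fun setT (fun p : R * R => (cn (F p.1 p.2))%:E).
  by apply/measurable_EFinP; exact: (cmeas_cn mF).
have key (g : R -> R -> R) : measurable_fun setT (fun p : R * R => g p.1 p.2) ->
   (forall x y, `|g x y| <= cn (F x y)) ->
   (\int[@lebesgue_measure R]_x \int[@lebesgue_measure R]_y (`|g x y|)%:E < +oo)%E.
  move=> mg gF; apply: le_lt_trans fin.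
  have mg' : measurable_fun setT (fun p : R * R => (`|g p.1 p.2|)%:E).
    by apply/measurable_EFinP; apply: measurableT_comp.
  apply: ge0_le_integral => //.
  - by move=> x _; apply: integral_ge0 => y _; rewrite lee_fin.
  - apply: (tonelli_meas (h := fun x y => `|g x y|)) => //.
    exact/measurable_EFinP.
  - apply: (tonelli_meas (h := fun x y => cn (F x y))) => //.
      exact/measurable_EFinP.
    by move=> *; exact: cn_ge0.
  - move=> x _; apply: ge0_le_integral => //.
    + exact: (measurableT_comp mg' (pair1_measurable x)).
    + exact: (measurableT_comp mc (pair1_measurable x)).
    + by move=> y _; rewrite lee_fin.
have [r1 r2] := @Rint_Fubini (fun x y => Re (F x y)) mr (fun x => (Fx x).1) (fun y => (Fy y).1)
  (key _ mr (fun x y => Re_le_cn _)).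
have [s1 s2] := @Rint_Fubini (fun x y => Im (F x y)) mi (fun x => (Fx x).2) (fun y => (Fy y).2)
  (key _ mi (fun x y => Im_le_cn _)).
by split; [|apply: ReIm_eq].
Qed.

End ComplexIntegral.

(** * Change of variables and Young's inequality *)

Section ChangeOfVariables.
Context {R : realType}.
Local Notation mu := (@lebesgue_measure R).
Implicit Types (f : R -> R) (F : R -> R[i]).

Lemma measurable_affine (a b : R) : measurable_fun setT (fun x : R => a * x + b).
Proof.
by apply: measurable_funD => //; apply: measurable_funM.
Qed.

Lemma ge0_integral_affine (a b : R) (f : R -> \bar R) : 0 < a ->
  measurable_fun setT f -> (forall x, 0 <= f x)%E ->
  (\int[mu]_x f x = a%:E * \int[mu]_x f (a * x + b)%R)%E.
Proof.
move=> a0 mf f0; pose phi : measurableTypeR R -> measurableTypeR R := fun x => a * x + b.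
have mphi : measurable_fun setT phi := measurable_affine a b.
(* The image measure scaled by [a] agrees with Lebesgue measure on half-open intervals, hence
   everywhere; integrating against it unfolds to the right-hand side. *)
pose nu0 := mscale (NngNum (ltW a0)) (pushforward mu phi).
have := erefl (nu0 mphi); rewrite {1}/nu0; set nu := mscale _ _ => _.
transitivity (\int[nu]_x f x)%E.
  apply: eq_measure_integral => /= A mA _.
  apply: lebesgue_measure_unique => //= _ [[x y] _ <-].
  rewrite /nu /mscale/= /pushforward /=.
  have -> : phi @^-1` `]x, y] = `](x - b) / a, (y - b) / a]%classic.
    apply/seteqP; split => z /=; rewrite !in_itv/= /phi ltr_pdivrMr// ler_pdivlMr//;
      rewrite (mulrC z a) ltrBlDr lerBrDr //.
  rewrite !lebesgue_measure_itv/= !lte_fin ltr_pM2r ?invr_gt0// ltrD2r.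
  case: ifPn => _; last by rewrite mule0.
  by rewrite -!EFinB -EFinM; congr EFin; field; rewrite gt_eqF.
rewrite /nu ge0_integral_mscale//=; congr (_ * _)%E.
by rewrite (ge0_integral_pushforward (phi := phi))// preimage_setT.
Qed.

Lemma ge0_integral_opp (f : R -> \bar R) :
  measurable_fun setT f -> (forall x, 0 <= f x)%E ->
  (\int[mu]_x f (- x)%R = \int[mu]_x f x)%E.
Proof.
move=> mf f0.
pose phi : measurableTypeR R -> measurableTypeR R := -%R.
have mphi : measurable_fun setT phi  by exact: (oppr_measurable (D := setT)).
have := ge0_integral_pushforward mphi mu measurableT mf (fun x _ => f0 x).
rewrite preimage_setT => <-.
by apply: eq_measure_integral => //= A mA _; exact: lebesgue_measureN.
Qed.

(** Extends a change of variables known for nonnegative functions to signed ones through positive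
    and negative parts; [phi] is left abstract so as to cover both affine maps and the
    reflection. *)
Lemma intb_subst (phi : R -> R) (c : R) (f : R -> R) : 0 < c ->
  measurable_fun setT phi ->
  (forall g : R -> \bar R, measurable_fun setT g -> (forall x, (0 <= g x)%E) ->
    (\int[mu]_x g x = c%:E * \int[mu]_x g (phi x))%E) ->
  intb f -> intb (fun x => f (phi x)) /\ Rint f = c * Rint (fun x => f (phi x)).
Proof.
move=> c0 mphi H /[dup] /intb_meas mf /integrableP[mF fin].
have mff : measurable_fun setT (fun x => f (phi x)) by exact: (measurableT_comp mf mphi).
have i : intb (fun x => f (phi x)).
  apply/integrableP; split; first exact: (EFin_meas mff).
  move: fin; rewrite H//=; last by apply: EFin_meas; apply: measurableT_comp.
  by rewrite -lte_pdivlMl// mulry gtr0_sg ?invr_gt0// mul1e.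
split => //.
rewrite /Rintegral integralE [in RHS]integralE.
have mp := measurable_funepos (EFin_meas mf).
have mn := measurable_funeneg (EFin_meas mf).
rewrite (H _ mp)// (H _ mn)//.
have -> : (fun x => (EFin \o f)^\- (phi x))%E = (EFin \o (fun x => f (phi x)))^\-%E.
  by apply/funext => x; rewrite !funenegE.
have -> : (fun x => (EFin \o f)^\+ (phi x))%E = (EFin \o (fun x => f (phi x)))^\+%E.
  by apply/funext => x; rewrite !funeposE.
have fn := integrable_neg_fin_num measurableT i.
have fp := integrable_pos_fin_num measurableT i.
rewrite -muleBr//; last by rewrite fin_num_adde_defl// fin_numN.
by rewrite fineM// fin_numB fp fn.
Qed.

Lemma intb_affine (a b : R) f : 0 < a -> intb f -> intb (fun x => f (a * x + b)).
Proof.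
move=> a0 i; apply: (intb_subst a0 (measurable_affine a b) _ i).1.
by move=> g; exact: ge0_integral_affine.
Qed.

Lemma Rint_affine (a b : R) f : 0 < a -> intb f -> Rint f = a * Rint (fun x => f (a * x + b)).
Proof.
move=> a0 i; apply: (intb_subst a0 (measurable_affine a b) _ i).2.
by move=> g; exact: ge0_integral_affine.
Qed.

Lemma intb_shift (b : R) f : intb f -> intb (fun x => f (x + b)).
Proof.
by move=> /(intb_affine b ltr01); under [in X in X -> _]eq_fun do rewrite mul1r.
Qed.

Lemma Rint_shift (b : R) f : intb f -> Rint (fun x => f (x + b)) = Rint f.
Proof.
move=> i; rewrite (Rint_affine b ltr01 i) mul1r.
by apply: eq_Rintegral => x _; rewrite mul1r.
Qed.

Lemma measurable_opp : measurable_fun setT (fun x : R => - x).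
Proof. exact: (oppr_measurable (D := setT)). Qed.

Lemma intb_opp f : intb f -> intb (fun x => f (- x)).
Proof.
move=> i; apply: (intb_subst ltr01 measurable_opp _ i).1.
by move=> g mg g0; rewrite mul1e ge0_integral_opp.
Qed.

Lemma Rint_opp f : intb f -> Rint (fun x => f (- x)) = Rint f.
Proof.
move=> i; rewrite (intb_subst ltr01 measurable_opp _ i).2 ?mul1r//.
by move=> g mg g0; rewrite mul1e ge0_integral_opp.
Qed.

Lemma intb_reflect (b : R) f : intb f -> intb (fun x => f (b - x)).
Proof.
move=> /(intb_shift b)/intb_opp.
by under [in X in X -> _]eq_fun do rewrite addrC.
Qed.

Lemma Rint_reflect (b : R) f : intb f -> Rint (fun x => f (b - x)) = Rint f.
Proof.
move=> i; rewrite -(Rint_shift b i) -[RHS]Rint_opp; last exact: intb_shift.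
by apply: eq_Rintegral => x _; rewrite addrC.
Qed.

Lemma cint_shift (b : R) F : cI F -> cint (fun x => F (x + b)) = cint F.
Proof. by move=> [i j]; apply: ReIm_eq; [exact: (Rint_shift b i)|exact: (Rint_shift b j)]. Qed.
Lemma cint_opp F : cI F -> cint (fun x => F (- x)) = cint F.
Proof. by move=> [i j]; apply: ReIm_eq; [exact: (Rint_opp i)|exact: (Rint_opp j)]. Qed.
End ChangeOfVariables.

Section Young.
Context {R : realType}.
Local Notation mu := (@lebesgue_measure R).

(** The common core of the Cauchy-Schwarz inequalities below, for integrals and for finite sums. The
    optimal choice is [l = c / a]; when [a = 0] a large [l] forces [c = 0]. *)
Lemma quadratic_discriminant (a c X : R) : 0 <= a ->
  (forall l : R, 2 * l * c <= l ^+ 2 * a + X) -> c ^+ 2 <= a * X.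
Proof.
rewrite le_eqVlt => /predU1P[<- h|a0 h].
  rewrite mul0r; have [->|c0] := eqVneq c 0; first by rewrite expr0n.
  have := h ((X + 1) / (2 * c)).
  have -> : 2 * ((X + 1) / (2 * c)) * c = X + 1 by field; rewrite c0.
  by rewrite mulr0 add0r; lra.
have := h (c / a).
have -> : 2 * (c / a) * c = 2 * (c ^+ 2 / a) by field; rewrite gt_eqF.
have -> : (c / a) ^+ 2 * a = c ^+ 2 / a by field; rewrite gt_eqF.
move=> H; have {H} : c ^+ 2 / a <= X by lra.
by rewrite ler_pdivrMr// mulrC.
Qed.

Definition conv (p q : R -> R) (x : R) : R := Rint (fun y => p (x - y) * q y).

Variables (p q : R -> R) (M : R).
Hypothesis mp : measurable_fun setT p.
Hypothesis mq : measurable_fun setT q.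
Hypothesis p0 : forall x, 0 <= p x.
Hypothesis q0 : forall x, 0 <= q x.
Hypothesis pM : forall x, p x <= M.
Hypothesis ip : intb p.
Hypothesis iq2 : intb (fun x => q x ^+ 2).

Let ipr x : intb (fun y : R => p (x - y)). Proof. exact: intb_reflect. Qed.
Let mpr x : measurable_fun setT (fun y : R => p (x - y)). Proof. exact: intb_meas. Qed.

(** The bound [M] on [p] makes the convolution integrals converge at every point and not merely
    almost everywhere. *)
Lemma conv_int2 x : intb (fun y => p (x - y) * q y ^+ 2).
Proof.
apply: (@intb_le _ _ (fun y => M * q y ^+ 2)); last 2 first.
- exact: intbZ.
- by move=> y; rewrite ger0_norm ?mulr_ge0 ?sqr_ge0// ler_wpM2r ?sqr_ge0.
- by apply: measurable_funM => //; apply: measurable_funX.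
Qed.

Lemma conv_int x : intb (fun y => p (x - y) * q y).
Proof.
apply: (@intb_le _ _ (fun y => p (x - y) + p (x - y) * q y ^+ 2)); last 2 first.
- by apply: intbD => //; exact: conv_int2.
- move=> y; rewrite ger0_norm ?mulr_ge0// -{2}[p (x - y)]mulr1 -mulrDr ler_wpM2l//.
  by have := sqr_ge0 (q y - 1); have := q0 y; nra.
- exact: measurable_funM.
Qed.

Lemma conv_ge0 x : 0 <= conv p q x.
Proof. by apply: Rintegral_ge0 => y _; rewrite mulr_ge0. Qed.

(** Cauchy-Schwarz for the measure [p (x - y) dy], whose mass is [Rint p]. *)
Lemma conv_sqr x : conv p q x ^+ 2 <= Rint p * Rint (fun y => p (x - y) * q y ^+ 2).
Proof.
apply: quadratic_discriminant; first by apply: Rintegral_ge0 => y _.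
move=> l; rewrite -(Rint_reflect x ip) -!RintegralZl//; last exact: conv_int.
rewrite -RintegralD//; last 2 first.
- exact: intbZ.
- exact: conv_int2.
apply: Rint_le.
- by apply: intbZ; exact: conv_int.
- by apply: intbD; [exact: intbZ|exact: conv_int2].
- move=> y; have -> : 2 * l * (p (x - y) * q y) = p (x - y) * (2 * l * q y) by ring.
  have -> : l ^+ 2 * p (x - y) + p (x - y) * q y ^+ 2 = p (x - y) * (l ^+ 2 + q y ^+ 2) by ring.
  by rewrite ler_wpM2l//; have := sqr_ge0 (l - q y); nra.
Qed.

Lemma meas_pq (r : R -> R) : measurable_fun setT r ->
  measurable_fun setT (fun z : R * R => p (z.1 - z.2) * r z.2).
Proof.
move=> mr; apply: measurable_funM.
  by apply: (measurableT_comp mp); apply: measurable_funB.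
exact: (measurableT_comp mr).
Qed.

Lemma conv_meas : measurable_fun setT (conv p q).
Proof.
apply: (measurableT_comp (fine_measurable measurableT)).
apply: (tonelli_meas (h := fun x y => p (x - y) * q y)); first exact: meas_pq.
by move=> *; rewrite mulr_ge0.
Qed.

(** Integrating [conv_sqr] in [x] and exchanging the integrals by Tonelli produces the second factor
    [Rint p]. *)
Lemma young : intb (fun x => conv p q x ^+ 2) /\
  Rint (fun x => conv p q x ^+ 2) <= Rint p ^+ 2 * Rint (fun x => q x ^+ 2).
Proof.
set a := Rint p.
have a0 : 0 <= a by apply: Rintegral_ge0.
have mc2 : measurable_fun setT (fun x => conv p q x ^+ 2).
  by apply: measurable_funX; exact: conv_meas.
have H : (\int[mu]_x (conv p q x ^+ 2)%:E <= (a ^+ 2 * Rint (fun x => q x ^+ 2))%:E)%E.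
  apply: (@le_trans _ _ (a%:E * \int[mu]_x \int[mu]_y (p (x - y) * q y ^+ 2)%:E)%E).
    have mm : measurable_fun setT (fun z : R * R => p (z.1 - z.2) * q z.2 ^+ 2).
      by apply: (meas_pq (r := fun y => q y ^+ 2)); exact: measurable_funX.
    have mt := tonelli_meas (h := fun x y => p (x - y) * q y ^+ 2) mm
      (fun x y => mulr_ge0 (p0 _) (sqr_ge0 _)).
    have t0 x : (0 <= \int[mu]_y (p (x - y) * q y ^+ 2)%:E)%E.
      by apply: integral_ge0 => y _; rewrite lee_fin mulr_ge0 ?sqr_ge0.
    rewrite -ge0_integralZl//.
    apply: ge0_le_integral => //.
    - by move=> x _; rewrite lee_fin sqr_ge0.
    - exact: (EFin_meas mc2).
    - by apply: emeasurable_funM => //.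
    - by move=> x _; rewrite -EFin_Rint ?conv_int2// -EFinM lee_fin conv_sqr.
  rewrite (tonelliR (h := fun x y => p (x - y) * q y ^+ 2)); last 2 first.
  - by apply: (meas_pq (r := fun y => q y ^+ 2)); apply: measurable_funX.
  - by move=> *; rewrite mulr_ge0 ?sqr_ge0.
  under eq_integral => y _.
    under eq_integral => x _ do rewrite mulrC EFinM.
    rewrite ge0_integralZl//; last 3 first.
    - apply/measurable_EFinP; apply: (measurableT_comp mp); exact: measurable_funB.
    - by move=> x _; rewrite lee_fin.
    - by rewrite lee_fin sqr_ge0.
    rewrite -EFin_Rint; last exact: intb_shift.
    rewrite Rint_shift// -/a muleC -EFinM.
    over.
  rewrite -EFin_Rint; last exact: intbZ.
  by rewrite RintegralZl// -EFinM mulrA.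
have i := intb_ge0P mc2 (fun x => sqr_ge0 _) H.
by split => //; rewrite -lee_fin EFin_Rint.
Qed.

End Young.

(** * Schwartz functions *)

Section SmoothClasses.
Context {R : realType}.
Implicit Types f g h : R -> R.

Definition derivative_of g h := forall x : R, is_derive x 1 g (h x).

Lemma derivative_ofE g h : derivative_of g h -> derive1 g = h.
Proof. by move=> gh; apply/funext => x; rewrite derive1E; have [_ ->] := gh x. Qed.

Lemma derive1nSr n g : derive1n n.+1 g = derive1n n (derive1 g).
Proof. by rewrite /derive1n iterSr. Qed.

Lemma derivative_ext f g f1 g1 : derivative_of f g -> (forall x, f1 x = f x) ->
  (forall x, g1 x = g x) -> derivative_of f1 g1.
Proof. by move=> fg /funext -> /funext ->. Qed.

(** Iterated derivatives of products, quotients or compositions have no convenient closed form.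
    Smoothness and Schwartz decay are proved by exhibiting a class stable under one derivation: all
    the [derive1n n g] then stay in the class, and only bounds on its members remain. *)
Definition closed_under_derivation (P : (R -> R) -> Prop) :=
  forall g, P g -> exists2 h, P h & derivative_of g h.

Lemma closed_derive1n P n g : closed_under_derivation P -> P g -> P (derive1n n g).
Proof.
move=> cP; elim: n g => [//|n IH] g Pg.
by rewrite derive1nSr; have [h Ph /derivative_ofE ->] := cP _ Pg; exact: IH.
Qed.

Lemma smooth_class P g : closed_under_derivation P -> P g -> smoothR g.
Proof.
by move=> cP Pg n x; have [h _ /(_ x)[]] := cP _ (closed_derive1n n cP Pg).
Qed.

Lemma schwartz_class P g : closed_under_derivation P ->
  (forall h, P h -> forall k, exists M : R, forall x, `|x ^+ k * h x| <= M) ->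
  P g -> schwartzR g.
Proof.
move=> cP bP Pg; split; first exact: smooth_class Pg.
by move=> k n; apply: bP; exact: closed_derive1n.
Qed.

Lemma smooth_closed : closed_under_derivation smoothR.
Proof.
move=> g sg; exists (derive1 g); first by move=> n x; rewrite -derive1nSr; exact: sg.
by move=> x; rewrite derive1E; apply: DeriveDef => //; exact: (sg 0%N).
Qed.

Lemma schwartz_closed : closed_under_derivation schwartzR.
Proof.
move=> g [/smooth_closed[h sh gh] bg]; exists h => //; split => // k n.
by have := bg k n.+1; rewrite derive1nSr (derivative_ofE gh).
Qed.

Lemma schwartz_bound g k : schwartzR g -> exists2 M : R, 0 <= M & forall x, `|x ^+ k * g x| <= M.
Proof. by move=> [_ /(_ k 0%N)[M gM]]; exists M => //; exact: le_trans (gM 0). Qed.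

Lemma derivative_cst (c : R) : derivative_of (fun _ => c) (fun _ => 0).
Proof. by move=> x; exact: is_derive_cst. Qed.

Lemma derivativeD f g f' g' : derivative_of f f' -> derivative_of g g' ->
  derivative_of (fun x => f x + g x) (fun x => f' x + g' x).
Proof. by move=> a b x; have := is_deriveD (a x) (b x). Qed.

Lemma derivativeM f g f' g' : derivative_of f f' -> derivative_of g g' ->
  derivative_of (fun x => f x * g x) (fun x => f' x * g x + f x * g' x).
Proof.
move=> a b x; have := is_deriveM (a x) (b x).
by rewrite -![_ *: _]/(_ * _) [X in is_derive _ _ _ X]addrC [g x * _]mulrC.
Qed.

Lemma derivativeN f f' : derivative_of f f' ->
  derivative_of (fun x => - f x) (fun x => - f' x).
Proof. by move=> a x; have := is_deriveN (a x). Qed.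

Lemma derivativeZ c f f' : derivative_of f f' ->
  derivative_of (fun x => c * f x) (fun x => c * f' x).
Proof.
move=> a; apply: (derivative_ext (derivativeM (derivative_cst c) a)) => // x.
by rewrite mul0r add0r.
Qed.

Lemma derivative_comp f g f' g' : derivative_of f f' -> derivative_of g g' ->
  derivative_of (fun x => f (g x)) (fun x => f' (g x) * g' x).
Proof. by move=> a b x; have := is_derive1_comp (a (g x)) (b x). Qed.

Lemma derivative_id : derivative_of (fun x => x) (fun _ => 1).
Proof. by move=> x; exact: is_derive_id. Qed.

Lemma derivative_affine (a b : R) : derivative_of (fun x => a * x + b) (fun _ => a).
Proof.
apply: (derivative_ext (derivativeD (derivativeZ a derivative_id) (derivative_cst b))) => //.
by move=> x; rewrite mulr1 addr0.
Qed.

Lemma derivativeV f f' : (forall x, f x != 0) -> derivative_of f f' ->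
  derivative_of (fun x => (f x)^-1) (fun x => - f' x * (f x)^-1 * (f x)^-1).
Proof.
move=> f0 a x; have := is_deriveV (f0 x) (a x).
by rewrite -[_ *: _]/(_ * _) -exprVn expr2 !mulNr mulrC mulrA.
Qed.

Lemma derivative_continuous f f' : derivative_of f f' -> continuous f.
Proof.
by move=> a x; apply: differentiable_continuous; apply/derivable1_diffP; have [] := a x.
Qed.

Lemma smooth_continuous f : smoothR f -> continuous f.
Proof. by move=> /smooth_closed[h _ /derivative_continuous]. Qed.

(* The algebra generated by the functions in [B]: by Leibniz' rule it is closed
   under derivation as soon as the derivatives of its generators belong to it. *)
Inductive generated (B : (R -> R) -> Prop) : (R -> R) -> Prop :=
| gen_base g : B g -> generated B g
| gen_add f g : generated B f -> generated B g -> generated B (fun x => f x + g x)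
| gen_mul f g : generated B f -> generated B g -> generated B (fun x => f x * g x).

Lemma generated_closed (B : (R -> R) -> Prop) :
  (forall g, B g -> exists2 h, generated B h & derivative_of g h) ->
  closed_under_derivation (generated B).
Proof.
move=> H g; elim => {g} [//|f g _ [f' Gf ff'] _ [g' Gg gg']|
   f g Pf [f' Gf ff'] Pg [g' Gg gg']].
- by exists (fun x => f' x + g' x); [exact: gen_add|exact: derivativeD].
- exists (fun x => f' x * g x + f x * g' x); last exact: derivativeM.
  by apply: gen_add; apply: gen_mul.
Qed.

Lemma generated_smooth g : generated smoothR g -> smoothR g.
Proof.
apply: smooth_class; apply: generated_closed => {}g /smooth_closed[h sh gh].
by exists h => //; exact: gen_base.
Qed.

Lemma smooth_cst (c : R) : smoothR (fun _ => c).
Proof.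
apply: (@smooth_class (fun g => exists c, g = (fun _ => c))); last by exists c.
by move=> _ [d ->]; exists (fun _ => 0); [exists 0|exact: derivative_cst].
Qed.

Lemma smoothD f g : smoothR f -> smoothR g -> smoothR (fun x => f x + g x).
Proof. by move=> sf sg; apply: generated_smooth; apply: gen_add; apply: gen_base. Qed.

Lemma smoothM f g : smoothR f -> smoothR g -> smoothR (fun x => f x * g x).
Proof. by move=> sf sg; apply: generated_smooth; apply: gen_mul; apply: gen_base. Qed.

Lemma smoothN f : smoothR f -> smoothR (fun x => - f x).
Proof.
move=> sf; have -> : (fun x => - f x) = (fun x => -1 * f x) by apply/funext => x; rewrite mulN1r.
exact: (smoothM (@smooth_cst (-1)) sf).
Qed.

Lemma smooth_affine f (a b : R) : smoothR f -> smoothR (fun x => f (a * x + b)).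
Proof.
move=> sf; apply: (@smooth_class (fun g => exists c, exists2 f, smoothR f &
    g = fun x => c * f (a * x + b))); last first.
  by exists 1, f => //; under [RHS]eq_fun do rewrite mul1r.
move=> _ [c [{sf}f /smooth_closed[f' sf' ff'] ->]].
exists (fun x => c * a * f' (a * x + b)); first by exists (c * a), f'.
apply: (derivative_ext (derivativeZ c (derivative_comp ff' (derivative_affine a b)))) => // x.
by rewrite -mulrA [a * _]mulrC.
Qed.

(** Adjoining the single generator [1 / q] to the smooth functions gives an algebra stable under
    derivation, because the derivative of [1 / q] is [- q' * (1 / q) * (1 / q)]. *)
Lemma smoothV (q : R -> R) : smoothR q -> (forall x, q x != 0) -> smoothR (fun x => (q x)^-1).
Proof.
move=> sq q0.
pose B g := smoothR g \/ g = fun x => (q x)^-1.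
apply: (@smooth_class (generated B)); last by apply: gen_base; right.
have [q' sq' qq'] := smooth_closed sq.
apply: generated_closed => g [/smooth_closed[h sh gh]|->].
  by exists h => //; apply: gen_base; left.
exists (fun x => - q' x * (q x)^-1 * (q x)^-1); last exact: derivativeV.
apply: gen_mul; last by apply: gen_base; right.
apply: gen_mul; last by apply: gen_base; right.
by apply: gen_base; left; exact: smoothN.
Qed.

Lemma schwartzRD f g : schwartzR f -> schwartzR g -> schwartzR (fun x => f x + g x).
Proof.
move=> sf sg; apply: (@schwartz_class (fun h => exists f g, [/\ schwartzR f, schwartzR g &
    h = fun x => f x + g x])); last by exists f, g.
- move=> _ [{sf}f [{sg}g [/schwartz_closed[f' sf' ff'] /schwartz_closed[g' sg' gg'] ->]]].
  by exists (fun x => f' x + g' x); [exists f', g'|exact: derivativeD].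
- move=> _ [{sf}f [{sg}g [sf sg ->]]] k.
  have [M _ fM] := schwartz_bound k sf; have [N _ gN] := schwartz_bound k sg.
  by exists (M + N) => x; rewrite mulrDr (le_trans (ler_normD _ _))// lerD.
Qed.

Lemma schwartzRM f g : schwartzR f -> schwartzR g -> schwartzR (fun x => f x * g x).
Proof.
move=> sf sg.
(* [P] is the class of finite sums of products of two Schwartz functions, encoded as the least class
   containing the products and stable under addition. *)
pose P h := forall A : (R -> R) -> Prop,
  (forall f g, schwartzR f -> schwartzR g -> A (fun x => f x * g x)) ->
  (forall f g, A f -> A g -> A (fun x => f x + g x)) -> A h.
have Pmul (u v : R -> R) : schwartzR u -> schwartzR v -> P (fun x => u x * v x).
  by move=> su sv A A1 _; exact: A1.
have Padd (u v : R -> R) : P u -> P v -> P (fun x => u x + v x).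
  by move=> Pu Pv A A1 A2; apply: (A2 u v); [exact: Pu|exact: Pv].
apply: (@schwartz_class P); last exact: Pmul.
- move=> h Ph; apply: (Ph (fun h => exists2 h', P h' & derivative_of h h')).
    move=> u v su sv.
    have [u' su' uu'] := schwartz_closed su; have [v' sv' vv'] := schwartz_closed sv.
    exists (fun x => u' x * v x + u x * v' x); last exact: derivativeM.
    by apply: Padd; apply: Pmul.
  move=> u v [u' Pu' uu'] [v' Pv' vv'].
  by exists (fun x => u' x + v' x); [exact: Padd|exact: derivativeD].
- move=> h Ph k; apply: (Ph (fun h => exists M : R, forall x, `|x ^+ k * h x| <= M)).
    move=> u v su sv.
    have [M M0 uM] := schwartz_bound k su; have [N N0 vN] := schwartz_bound 0 sv.
    exists (M * N) => x; rewrite mulrA normrM ler_pM//.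
    by have := vN x; rewrite expr0 mul1r.
  move=> u v [M uM] [N vN].
  by exists (M + N) => x; rewrite mulrDr (le_trans (ler_normD _ _))// lerD.
Qed.

Lemma schwartzRZ (c : R) f : schwartzR f -> schwartzR (fun x => c * f x).
Proof.
move=> sf; apply: (@schwartz_class (fun h => exists2 f, schwartzR f & h = fun x => c * f x));
  last by exists f.
- move=> _ [{sf}f /schwartz_closed[f' sf' ff'] ->].
  by exists (fun x => c * f' x); [exists f'|exact: derivativeZ].
- move=> _ [{sf}f sf ->] k; have [M _ fM] := schwartz_bound k sf.
  by exists (`|c| * M) => x; rewrite mulrCA normrM ler_wpM2l.
Qed.

Lemma schwartzRN f : schwartzR f -> schwartzR (fun x => - f x).
Proof. by move=> /(schwartzRZ (-1)); under eq_fun do rewrite mulN1r. Qed.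

Lemma schwartzR0 : schwartzR (fun _ : R => 0).
Proof.
apply: (@schwartz_class (fun h => h = fun _ => 0)) => //.
- by move=> _ ->; exists (fun _ => 0) => //; exact: derivative_cst.
- by move=> _ -> k; exists 0 => x; rewrite mulr0 normr0.
Qed.

Lemma schwartzRX f : schwartzR f -> schwartzR (fun x => x * f x).
Proof.
move=> sf; apply: (@schwartz_class (fun h => exists f g, [/\ schwartzR f, schwartzR g &
    h = fun x => f x + x * g x])).
- move=> _ [{sf}f [g [/schwartz_closed[f' sf' ff'] sg ->]]].
  have [g' sg' gg'] := schwartz_closed sg.
  exists (fun x => (f' x + g x) + x * g' x).
    by exists (fun x => f' x + g x), g'; split => //; exact: schwartzRD.
  apply: (derivative_ext (derivativeD ff' (derivativeM derivative_id gg'))) => // x.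
  by rewrite mul1r addrA.
- move=> _ [{sf}f [g [sf sg ->]]] k.
  have [M _ fM] := schwartz_bound k sf; have [N _ gN] := schwartz_bound k.+1 sg.
  exists (M + N) => x; rewrite mulrDr (le_trans (ler_normD _ _))// lerD//.
  by rewrite mulrA -exprSr.
- exists (fun _ => 0), f; split => //; first exact: schwartzR0.
  by apply/funext => x; rewrite add0r.
Qed.

Lemma ler_expD (a b : R) k : 0 <= a -> 0 <= b -> (a + b) ^+ k <= 2 ^+ k * (a ^+ k + b ^+ k).
Proof.
move=> a0 b0; wlog ab : a b a0 b0 / a <= b => [H|].
  have [/H -> //|/ltW /H] := leP a b; by rewrite addrC [_ + a ^+ k]addrC => ->.
apply: (@le_trans _ _ ((2 * b) ^+ k)).
  by rewrite lerXn2r ?nnegrE ?addr_ge0 ?mulr_ge0//; lra.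
by rewrite exprMn ler_wpM2l ?exprn_ge0// lerDr exprn_ge0.
Qed.

Lemma schwartzR_shift (b : R) f : schwartzR f -> schwartzR (fun x => f (x + b)).
Proof.
move=> sf; apply: (@schwartz_class (fun h => exists2 f, schwartzR f & h = fun x => f (x + b)));
  last by exists f.
- move=> _ [{sf}f /schwartz_closed[f' sf' ff'] ->].
  exists (fun x => f' (x + b)); first by exists f'.
  apply: (derivative_ext (derivative_comp ff' (derivative_affine 1 b))) => x.
    by rewrite mul1r.
  by rewrite mul1r mulr1.
- move=> _ [{sf}f sf ->] k; have [M _ fM] := schwartz_bound k sf.
  have [N _ fN] := schwartz_bound 0 sf.
  exists (2 ^+ k * (M + `|b| ^+ k * N)) => x; rewrite normrM normrX.
  have /le_trans : `|x| ^+ k * `|f (x + b)| <=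
      (2 ^+ k * (`|x + b| ^+ k + `|b| ^+ k)) * `|f (x + b)|.
    rewrite ler_wpM2r// (le_trans _ (ler_expD _ _ _))//.
    rewrite lerXn2r ?nnegrE ?addr_ge0//.
    by have := ler_normB (x + b) b; rewrite addrK.
  apply; rewrite -mulrA ler_wpM2l ?exprn_ge0// mulrDl lerD//.
    by rewrite -normrX -normrM.
  by rewrite ler_wpM2l ?exprn_ge0//; have := fN (x + b); rewrite expr0 mul1r.
Qed.

Lemma schwartzR_opp f : schwartzR f -> schwartzR (fun x => f (- x)).
Proof.
move=> sf; apply: (@schwartz_class (fun h => exists2 f, schwartzR f & h = fun x => f (- x)));
  last by exists f.
- move=> _ [{sf}f /schwartz_closed[f' sf' ff'] ->].
  exists (fun x => - f' (- x)); first by exists (fun x => - f' x) => //; exact: schwartzRN.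
  apply: (derivative_ext (derivative_comp ff' (derivativeN derivative_id))) => // x.
  by rewrite mulrN1.
- move=> _ [{sf}f sf ->] k; have [M _ fM] := schwartz_bound k sf.
  exists M => x; have := fM (- x); by rewrite !normrM !normrX normrN.
Qed.

(** Derivatives vanish on the same set, since [N < |x|] is an open condition; on the remaining
    compact interval continuity gives the bounds. *)
Lemma schwartz_compact f (N : R) : smoothR f -> (forall x, N < `|x| -> f x = 0) -> schwartzR f.
Proof.
move=> sf f0.
apply: (@schwartz_class (fun h => smoothR h /\ forall x, N < `|x| -> h x = 0)) => //.
- move=> h [/smooth_closed[h' sh' hh'] h0]; exists h' => //; split => // x Nx.
  have [_ <-] := hh' x; rewrite -(derive_cst (0 : R) x 1).
  apply: near_eq_derive.
  near=> y; apply: h0; near: y.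
  have /cvgr_gt : `|y| @[y --> x] --> `|x| by exact: norm_continuous.
  by apply.
- move=> h [sh h0] k.
  (* [N] may be negative; [|N|] keeps the interval nonempty. *)
  have ch : {within `[- `|N|, `|N| ], continuous (fun x : R => `|x ^+ k * h x|)}.
    apply: continuous_subspaceT => x; apply: (cvg_norm (V := R^o)).
    by apply: cvgM; [exact: exprn_continuous|exact: smooth_continuous].
  have [|c _ cM] := EVT_max _ ch; first by rewrite ge0_cp// normr_ge0.
  exists `|c ^+ k * h c| => x.
  have [xN|Nx] := leP `|x| `|N|; first by apply: cM; rewrite in_itv/= -ler_norml.
  by rewrite h0 ?mulr0 ?normr0//; exact: le_lt_trans (ler_norm _) Nx.
Unshelve. all: by end_near. Qed.

End SmoothClasses.

(** * Decay of Schwartz functions measured by powers of [w] *)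

Section SchwartzBounds.
Context {R : realType}.
Implicit Types F G : R -> R[i].

Definition w (x : R) : R := (1 + x ^+ 2)^-1.

Lemma w_den_gt0 (x : R) : 0 < 1 + x ^+ 2.
Proof. by rewrite ltr_pwDl// sqr_ge0. Qed.
Lemma w_gt0 x : 0 < w x. Proof. by rewrite invr_gt0 w_den_gt0. Qed.
Lemma w_ge0 x : 0 <= w x. Proof. exact/ltW/w_gt0. Qed.
Lemma w_le1 x : w x <= 1.
Proof. by rewrite invf_le1 ?w_den_gt0// lerDl sqr_ge0. Qed.
Lemma wN x : w (- x) = w x. Proof. by rewrite /w sqrrN. Qed.
Lemma w_continuous : continuous w. Proof. exact: continuous_oneDsqrV. Qed.
Lemma w_meas : measurable_fun setT w.
Proof. exact: (continuous_measurable_fun w_continuous). Qed.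

Lemma w_int : intb w.
Proof.
apply: intb_ge0_lty; [exact: w_meas|exact: w_ge0|].
rewrite ge0_symfun_integralT//=.
- rewrite (_ : [set x | _] = `[0, +oo[%classic); last first.
    by apply/seteqP; split => x/=; rewrite in_itv/= andbT.
  by rewrite integral0y_oneDsqr -EFinM ltry.
- exact: w_ge0.
- exact: w_continuous.
- by move=> x /=; rewrite wN.
Qed.

(** Peetre's inequality, which trades decay in [x] and in [x - s] for decay in [s]. It follows from
    [s^2 <= 2 x^2 + 2 (x - s)^2], whose defect is the square of [2 x - s]. *)
Lemma peetre (x s : R) : w x * w (x - s) <= 2 * w s.
Proof.
rewrite /w -invfM -(invrK 2) -invfM lef_pV2 ?posrE ?mulr_gt0 ?invr_gt0 ?w_den_gt0//.
by rewrite mulrC ler_pdivrMr//; have := sqr_ge0 (2 * x - s); have := sqr_ge0 x;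
  have := sqr_ge0 (x * (x - s)); nra.
Qed.

Lemma schwartz_le_w F k : schwartz F -> exists2 M : R, 0 <= M &
  forall x, cn (F x) <= M * w x ^+ k.
Proof.
move=> [sr si].
have key (f : R -> R) : schwartzR f -> exists2 M : R, 0 <= M & forall x, `|f x| <= M * w x ^+ k.
  move=> sf; have [M M0 fM] := schwartz_bound 0 sf; have [N N0 fN] := schwartz_bound (2 * k) sf.
  exists (2 ^+ k * (M + N)) => [|x]; first by rewrite mulr_ge0 ?exprn_ge0 ?addr_ge0.
  rewrite /w exprVn ler_pdivlMr ?exprn_gt0 ?w_den_gt0// mulrC.
  have h : (1 + x ^+ 2) ^+ k <= 2 ^+ k * (1 + x ^+ (2 * k)).
    by have := ler_expD k ler01 (sqr_ge0 x); rewrite expr1n exprM.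
  apply: le_trans (ler_wpM2r (normr_ge0 (f x)) h) _.
  rewrite -mulrA ler_wpM2l ?exprn_ge0// mulrDl mul1r lerD//.
    by have := fM x; rewrite expr0 mul1r.
  by have := fN x; rewrite normrM ger0_norm// exprM exprn_ge0 ?sqr_ge0.
have [M M0 fM] := key _ sr; have [N N0 fN] := key _ si.
exists (M + N) => [|x]; first exact: addr_ge0.
by rewrite (le_trans (cn_le_ReIm _))// mulrDl lerD.
Qed.

Lemma schwartz_meas F : schwartz F -> cmeas F.
Proof.
by move=> [[a _] [b _]]; split; [exact: (continuous_measurable_fun (smooth_continuous a))|
  exact: (continuous_measurable_fun (smooth_continuous b))].
Qed.

Lemma schwartz_cI F : schwartz F -> cI F.
Proof.
move=> sF; have [M M0 FM] := schwartz_le_w 1 sF.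
apply: (@cI_le _ _ (fun x => M * w x)); first exact: schwartz_meas.
  exact/intbZ/w_int.
by move=> x; have := FM x; rewrite expr1.
Qed.

Lemma schwartz_bounded F : schwartz F -> exists2 M : R, 0 <= M & forall x, cn (F x) <= M.
Proof.
by move=> /(schwartz_le_w 0)[M M0 FM]; exists M => // x; have := FM x; rewrite expr0 mulr1.
Qed.

Lemma schwartz_sqr F : schwartz F -> intb (fun x => cn (F x) ^+ 2).
Proof.
move=> sF; have [M M0 FM] := schwartz_bounded sF.
apply: (@intb_le _ _ (fun x => M * cn (F x))).
- by apply: measurable_funX; exact/cmeas_cn/schwartz_meas.
- by apply: intbZ; exact/cI_cn/schwartz_cI.
- by move=> x; rewrite ger0_norm ?sqr_ge0// expr2 ler_wpM2r// cn_ge0.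
Qed.

Lemma schwartzD F G : schwartz F -> schwartz G -> schwartz (fun x => F x + G x).
Proof.
by move=> [a b] [c d]; split; under eq_fun do rewrite ReImE; apply: schwartzRD.
Qed.
Lemma schwartzM F G : schwartz F -> schwartz G -> schwartz (fun x => F x * G x).
Proof.
move=> [a b] [c d]; split; under eq_fun do rewrite ReImE.
  by apply: schwartzRD; [|apply: schwartzRN]; apply: schwartzRM.
by apply: schwartzRD; apply: schwartzRM.
Qed.
Lemma schwartzZ (c : R[i]) F : schwartz F -> schwartz (fun x => c * F x).
Proof.
move=> [a b]; split; under eq_fun do rewrite ReImE.
  by apply: schwartzRD; [|apply: schwartzRN]; apply: schwartzRZ.
by apply: schwartzRD; apply: schwartzRZ.
Qed.
Lemma schwartzJ F : schwartz F -> schwartz (fun x => conjc (F x)).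
Proof.
by move=> [a b]; split; under eq_fun do rewrite ReImE; [|apply: schwartzRN].
Qed.
Lemma schwartzX F : schwartz F -> schwartz (fun x => x%:C * F x).
Proof.
move=> [a b]; split; under eq_fun do rewrite ReImE /= mul0r ?subr0 ?addr0.
  exact: schwartzRX.
exact: schwartzRX.
Qed.
Lemma schwartz_shift (b : R) F : schwartz F -> schwartz (fun x => F (x + b)).
Proof. by move=> [sr si]; split; [exact: (schwartzR_shift b sr)|exact: (schwartzR_shift b si)]. Qed.
Lemma schwartz_opp F : schwartz F -> schwartz (fun x => F (- x)).
Proof. by move=> [sr si]; split; [exact: (schwartzR_opp sr)|exact: (schwartzR_opp si)]. Qed.
Definition cderivative_of F G :=
  derivative_of (fun x => Re (F x)) (fun x => Re (G x)) /\
  derivative_of (fun x => Im (F x)) (fun x => Im (G x)).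

Lemma cderivative_ext F G F1 G1 : cderivative_of F G -> (forall x, F1 x = F x) ->
  (forall x, G1 x = G x) -> cderivative_of F1 G1.
Proof. by move=> FG /funext -> /funext ->. Qed.

Lemma schwartz_cderivative F : schwartz F -> exists2 G, schwartz G & cderivative_of F G.
Proof.
move=> [/schwartz_closed[f sf Ff] /schwartz_closed[g sg Fg]].
by exists (fun x => f x +i* g x).
Qed.

Lemma cderivativeM F G F' G' : cderivative_of F F' -> cderivative_of G G' ->
  cderivative_of (fun x => F x * G x) (fun x => F' x * G x + F x * G' x).
Proof.
move=> [a b] [c d]; split.
  apply: (derivative_ext (derivativeD (derivativeM a c) (derivativeN (derivativeM b d)))).
    by move=> x; rewrite ReImE.
  by move=> x; rewrite !ReImE; ring.
apply: (derivative_ext (derivativeD (derivativeM a d) (derivativeM b c))).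
  by move=> x; rewrite ReImE.
by move=> x; rewrite !ReImE; ring.
Qed.

Lemma cderivative_shift (b : R) F F' : cderivative_of F F' ->
  cderivative_of (fun x => F (x + b)) (fun x => F' (x + b)).
Proof.
move=> [c d]; split.
  apply: (derivative_ext (derivative_comp c (derivative_affine 1 b))) => x.
    by rewrite mul1r.
  by rewrite mul1r mulr1.
apply: (derivative_ext (derivative_comp d (derivative_affine 1 b))) => x.
  by rewrite mul1r.
by rewrite mul1r mulr1.
Qed.

Lemma cderivative_expi (a : R) :
  cderivative_of (fun x => expi (a * x)) (fun x => (0 +i* a) * expi (a * x)).
Proof.
have e (g g' : R -> R) : derivative_of g g' -> derivative_of (fun x => g (a * x)) (fun x => g' (a * x) * a).
  move=> gg'; apply: (derivative_ext (derivative_comp gg' (derivative_affine a 0))) => x;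
    by rewrite addr0.
split => /=.
  apply: (derivative_ext (e _ _ (@is_derive_cos R))) => // x /=; rewrite mul0r; ring.
apply: (derivative_ext (e _ _ (@is_derive_sin R))) => // x /=; rewrite mul0r; ring.
Qed.

End SchwartzBounds.

(** * The Fourier transform on Schwartz functions *)

Section WholeLine.
Context {R : realType}.
Local Notation mu := (@lebesgue_measure R).
Implicit Types (F G u : R -> R[i]) (f g : R -> R).

Lemma cvg_w : w (n.+1%:R : R) @[n --> \oo] --> (0 : R).
Proof.
apply: (@squeeze_cvgr _ _ _ _ (fun _ => 0) (fun n => n.+1%:R^-1)) => //; last 2 first.
- exact: cvg_cst.
- exact: cvg_harmonic.
apply: nearW => n; rewrite w_ge0/= /w lef_pV2 ?posrE ?w_den_gt0//.
rewrite (le_trans _ (_ : n.+1%:R ^+ 2 <= _))// ?lerDr//.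
by rewrite expr2 ler_peMr// ler1n.
Qed.

(** The fundamental theorem of calculus on [[-(n+1), n+1]]: the decay of [f] kills the boundary
    terms and dominated convergence reaches the whole line. *)
Lemma Rint_derivative_eq0 f f' (M : R) : derivative_of f f' -> continuous f' ->
  intb f' -> (forall x, `|f x| <= M * w x) -> Rint f' = 0.
Proof.
move=> ff' cf' if' fM.
have M0 : 0 <= M by rewrite -(pmulr_lge0 _ (w_gt0 (0 : R))) (le_trans _ (fM 0)).
pose D n : set R := `[- n.+1%:R, n.+1%:R]%classic.
have e n : Rint (f' \_ (D n)) = f n.+1%:R - f (- n.+1%:R).
  rewrite -Rintegral_mkcond /Rintegral (@continuous_FTC2 _ f' f)//.
  - by rewrite gtrN// ltr0n.
  - exact: continuous_subspaceT.
  - split.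
    + by move=> x _; have [] := ff' x.
    + by apply: cvg_at_right_filter; exact: (derivative_continuous ff').
    + by apply: cvg_at_left_filter; exact: (derivative_continuous ff').
  - by move=> x _; rewrite (derivative_ofE ff').
have [||||_ h] := @Rint_dct _ (fun n => f' \_ (D n)) f' (fun x => `|f' x|).
- move=> n; apply/(measurable_restrictT _ _).1; first exact: measurable_itv.
  by apply: measurable_funTS; exact: intb_meas if'.
- move=> x; apply: cvg_near_cst; near=> n; rewrite patchE mem_set// /D/= in_itv/= -ler_norml.
  near: n; have [m _ mx] := nbhs_infty_ger `|x|.
  by exists m => // k /= mk; apply: le_trans (mx _ mk) _; rewrite ler_nat.
- exact: intb_norm.
- by move=> n x; rewrite patchE; case: ifPn => // _; rewrite normr0.
move: h; under eq_fun do rewrite e; move=> h.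
apply: (cvg_unique _ h) => //.
apply: norm_cvg0.
apply: (@squeeze_cvgr _ _ _ _ (fun _ => 0) (fun n => (M + M) * w (n.+1%:R : R))).
- apply: nearW => n; rewrite normr_ge0/= (le_trans (ler_normB _ _))// mulrDl lerD//.
  by have := fM (- n.+1%:R); rewrite wN.
- exact: cvg_cst.
- rewrite -[X in _ --> X](mulr0 (M + M)); apply: cvgM; [exact: cvg_cst|exact: cvg_w].
Unshelve. all: by end_near. Qed.

Lemma derivative_under_integral (f f1 : R -> R -> R) (G : R -> R) :
  (forall y, derivative_of (f^~ y) (f1^~ y)) -> (forall x, intb (f x)) -> intb G ->
  (forall x y, `|f1 x y| <= G y) ->
  derivative_of (fun x => Rint (f x)) (fun x => Rint (f1 x)).
Proof.
move=> ff1 fi Gi fG a.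
have e x y : partial1of2 f x y = f1 x y by rewrite /partial1of2 (derivative_ofE (ff1 y)).
have Ia : [set` `]a - 1, a + 1[] a by rewrite /= in_itv/= ltrBlDr ltrDl ltr01.
have G0 y : 0 <= G y by apply: le_trans (fG 0 y).
have ub x y : [set` `]a - 1, a + 1[] x -> setT y -> `|partial1of2 f x y| <= G y.
  by move=> _ _; rewrite e.
have df x y : [set` `]a - 1, a + 1[] x -> [set: R] y -> derivable (f^~ y) x 1.
  by move=> _ _; have [] := ff1 y x.
have d := derivable_under_integral measurableT Ia (fun x _ => fi x) df G0 Gi ub.
have d' := differentiation_under_integral measurableT Ia (fun x _ => fi x) df G0 Gi ub.
apply: DeriveDef => //.
rewrite -derive1E d'.
by apply: eq_Rintegral => y _; rewrite e.
Qed.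

Lemma cderivative_under_integral (F F1 : R -> R -> R[i]) (G : R -> R) :
  (forall y, cderivative_of (F^~ y) (F1^~ y)) -> (forall x, cI (F x)) -> intb G ->
  (forall x y, cn (F1 x y) <= G y) ->
  cderivative_of (fun x => cint (F x)) (fun x => cint (F1 x)).
Proof.
move=> FF1 Fi Gi FG; split => /=.
  apply: (derivative_under_integral (G := G)) => //.
  - by move=> y; case: (FF1 y).
  - by move=> x; case: (Fi x).
  - by move=> x y; apply: le_trans (Re_le_cn _) (FG x y).
apply: (derivative_under_integral (G := G)) => //.
- by move=> y; case: (FF1 y).
- by move=> x; case: (Fi x).
- by move=> x y; apply: le_trans (Im_le_cn _) (FG x y).
Qed.

End WholeLine.

Section FourierBasics.
Context {R : realType}.
Local Notation mu := (@lebesgue_measure R).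
Implicit Types (F G u phi : R -> R[i]) (f g : R -> R).

Lemma cn_kernel (z : R[i]) (a : R) : cn (z * expi a) = cn z.
Proof. by rewrite cnM cn_expi mulr1. Qed.

Lemma kernel_cI u (xi : R) : cI u -> cI (fun x => u x * expi (2 * pi * x * xi)).
Proof.
move=> iu; apply: (cI_le _ (cI_cn iu)) => [|x]; last by rewrite cn_kernel.
apply: cmeasM; first exact: cI_meas.
by apply: cmeas_expi; apply: measurable_funM => //; apply: measurable_funM.
Qed.

Lemma cn_invFT u (xi : R) : cI u -> cn (invFT u xi) <= Rint (fun x => cn (u x)).
Proof.
move=> iu; apply: le_trans (cint_norm (kernel_cI xi iu)) _.
by under eq_Rintegral do rewrite cn_kernel.
Qed.

Lemma invFT_D u1 u2 (xi : R) : cI u1 -> cI u2 ->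
  invFT (fun x => u1 x + u2 x) xi = invFT u1 xi + invFT u2 xi.
Proof.
move=> i1 i2; rewrite /invFT -cint_add; try exact: kernel_cI.
by apply: eq_cint => x; rewrite mulrDl.
Qed.

Lemma invFT_Z (c : R[i]) u (xi : R) : cI u -> invFT (fun x => c * u x) xi = c * invFT u xi.
Proof.
move=> iu; rewrite /invFT -cintZ; last exact: kernel_cI.
by apply: eq_cint => x; rewrite mulrA.
Qed.

Lemma invFT_J u (xi : R) : cI u -> conjc (invFT u xi) = invFT (fun x => conjc (u x)) (- xi).
Proof.
move=> iu; rewrite /invFT -cintJ; last exact: kernel_cI.
by apply: eq_cint => x; rewrite conjM conj_expi mulrN.
Qed.

Lemma invFT_shift (b : R) u (xi : R) : cI u ->
  invFT (fun x => u (x - b)) xi = expi (2 * pi * b * xi) * invFT u xi.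
Proof.
move=> iu; rewrite /invFT -cintZ; last exact: kernel_cI.
rewrite -[RHS](cint_shift (- b)); last exact/cIZ/kernel_cI.
apply: eq_cint => x; rewrite mulrCA -expiD; congr (_ * expi _); ring.
Qed.

Lemma kernel_derivative u u' (xi : R) : cderivative_of u u' ->
  cderivative_of (fun x => u x * expi (2 * pi * x * xi))
   (fun x => u' x * expi (2 * pi * x * xi) +
     (0 +i* (2 * pi * xi)) * (u x * expi (2 * pi * x * xi))).
Proof.
move=> uu'; apply: (cderivative_ext (cderivativeM uu' (cderivative_expi (2 * pi * xi)))) => x.
  by congr (_ * expi _); ring.
have -> : 2 * pi * x * xi = 2 * pi * xi * x by ring.
by rewrite [in LHS]mulrCA.
Qed.

(** Integration by parts: with [e] the Fourier kernel, [u' e + 2 i pi xi u e] is the derivative of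
    [u e], so its integral vanishes. The existence of [u''] provides the continuity that the
    fundamental theorem of calculus asks for. *)
Lemma invFT_derivative_bounded u u' (M : R) (xi : R) : cderivative_of u u' ->
  (exists u'', cderivative_of u' u'') -> cI u -> cI u' -> (forall x, cn (u x) <= M * w x) ->
  invFT u' xi = - (0 +i* (2 * pi * xi)) * invFT u xi.
Proof.
move=> uu' [u'' u2] iu iu' uM.
have [a b] := kernel_derivative xi uu'.
set F' := fun x => _ in a b.
have [c d] : cI (fun x => u' x * expi (2 * pi * x * xi) +
     (0 +i* (2 * pi * xi)) * (u x * expi (2 * pi * x * xi))).
  by apply: cID; [|apply: cIZ]; exact: kernel_cI.
have z : cint (fun x => u' x * expi (2 * pi * x * xi) +
     (0 +i* (2 * pi * xi)) * (u x * expi (2 * pi * x * xi))) = 0.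
  have [e1 e2] := kernel_derivative xi u2.
  have [f1 f2] : cderivative_of (fun x => (0 +i* (2 * pi * xi)) * (u x * expi (2 * pi * x * xi)))
     (fun x => 0 * (u x * expi (2 * pi * x * xi)) + (0 +i* (2 * pi * xi)) *
       (u' x * expi (2 * pi * x * xi) + (0 +i* (2 * pi * xi)) * (u x * expi (2 * pi * x * xi)))).
    apply: cderivativeM; last exact: kernel_derivative.
    by split => x; exact: is_derive_cst.
  apply: ReIm_eq => /=.
    apply: (Rint_derivative_eq0 a _ c (M := M)).
      apply: (derivative_continuous (f' := _)).
      apply: (derivative_ext (derivativeD e1 f1)) => // x; by rewrite ReD.
    by move=> x; rewrite (le_trans (Re_le_cn _))// cn_kernel.
  apply: (Rint_derivative_eq0 b _ d (M := M)).
    apply: (derivative_continuous (f' := _)).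
    apply: (derivative_ext (derivativeD e2 f2)) => // x; by rewrite ImD.
  by move=> x; rewrite (le_trans (Im_le_cn _))// cn_kernel.
move: z; rewrite cint_add; last 2 first.
- exact: kernel_cI.
- by apply: cIZ; exact: kernel_cI.
rewrite cintZ; last exact: kernel_cI.
by rewrite -/(invFT u' xi) -/(invFT u xi) => /eqP; rewrite addr_eq0 mulNr => /eqP.
Qed.

Lemma invFT_derivative u u' (xi : R) : schwartz u -> cderivative_of u u' -> schwartz u' ->
  invFT u' xi = - (0 +i* (2 * pi * xi)) * invFT u xi.
Proof.
move=> su uu' su'; have [M M0 uM] := schwartz_le_w 1 su.
apply: (invFT_derivative_bounded (M := M) xi uu').
- by have [u'' _] := schwartz_cderivative su'; exists u''.
- exact: schwartz_cI.
- exact: schwartz_cI.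
- by move=> x; have := uM x; rewrite expr1.
Qed.

Lemma derivative_invFT u : schwartz u ->
  cderivative_of (invFT u) (invFT (fun x => (0 +i* (2 * pi)) * (x%:C * u x))).
Proof.
move=> su.
have sX : schwartz (fun x => (0 +i* (2 * pi)) * (x%:C * u x)) by exact/schwartzZ/schwartzX.
apply: (cderivative_under_integral (F := fun xi x => u x * expi (2 * pi * x * xi))
  (F1 := fun xi x => (0 +i* (2 * pi)) * (x%:C * u x) * expi (2 * pi * x * xi))
  (G := fun x => cn ((0 +i* (2 * pi)) * (x%:C * u x)))).
- move=> x; have [a b] : cderivative_of (fun xi => u x * expi (2 * pi * x * xi))
     (fun xi => 0 * expi (2 * pi * x * xi) + u x * ((0 +i* (2 * pi * x)) * expi (2 * pi * x * xi))).
    apply: cderivativeM; last exact: cderivative_expi.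
    by split => y; exact: is_derive_cst.
  have e : (0 +i* (2 * pi * x)) = (0 +i* (2 * pi)) * x%:C :> R[i].
    by apply: ReIm_eq; rewrite ReImE /=; ring.
  by split; [apply: (derivative_ext a)|apply: (derivative_ext b)] => // xi;
    rewrite mul0r add0r e; congr (_ _); ring.
- by move=> xi; apply: kernel_cI; exact: schwartz_cI.
- exact/cI_cn/schwartz_cI.
- by move=> xi x; rewrite cn_kernel.
Qed.

Lemma schwartz_invFT u : schwartz u -> schwartz (invFT u).
Proof.
move=> su.
have bd k : forall u, schwartz u -> exists2 M : R, 0 <= M & forall xi, `|xi| ^+ k * cn (invFT u xi) <= M.
  elim: k => [|k IH] {su}u su.
    exists (Rint (fun x => cn (u x))); first by apply: Rintegral_ge0 => *; exact: cn_ge0.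
    by move=> xi; rewrite expr0 mul1r cn_invFT//; exact: schwartz_cI.
  have [u' su' uu'] := schwartz_cderivative su.
  have [M M0 uM] := IH _ su'.
  exists M => // xi; apply: le_trans (uM xi).
  rewrite exprSr -mulrA ler_wpM2l ?exprn_ge0// (invFT_derivative xi su uu' su').
  rewrite cnM cnN ler_wpM2r ?cn_ge0// cnE /= expr0n/= add0r sqrtr_sqr !normrM.
  rewrite ler_peMl// (ger0_norm (pi_ge0 R)) ger0_norm//.
  by have := pi_ge2 R; lra.
(* Differentiating a transform multiplies the transformed function by [2 i pi x], which preserves
   the Schwartz space, so this class is stable under derivation. *)
pose P g := exists2 v, schwartz v & g = (fun x => Re (invFT v x)) \/ g = (fun x => Im (invFT v x)).
have cP : closed_under_derivation P.
  move=> _ [v sv [->|->]]; have [a b] := derivative_invFT sv.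
  - exists (fun x => Re (invFT (fun x => (0 +i* (2 * pi)) * (x%:C * v x)) x)) => //.
    by eexists; [|by left]; exact/schwartzZ/schwartzX.
  - exists (fun x => Im (invFT (fun x => (0 +i* (2 * pi)) * (x%:C * v x)) x)) => //.
    by eexists; [|by right]; exact/schwartzZ/schwartzX.
have bP h : P h -> forall k, exists M : R, forall x, `|x ^+ k * h x| <= M.
  move=> [v sv hE] k; have [M _ vM] := bd k _ sv; exists M => x.
  apply: le_trans (vM x); rewrite normrM normrX ler_wpM2l ?exprn_ge0//.
  by case: hE => ->; [exact: Re_le_cn|exact: Im_le_cn].
by split; apply: (schwartz_class cP bP); exists u => //; [left|right].
Qed.

(** The multiplication formula: the kernel is symmetric in its two variables, so Fubini moves the
    transform from one factor to the other. *)
Lemma exchange u phi : cI u -> cI phi ->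
  cint (fun x => invFT u x * phi x) = cint (fun x => u x * invFT phi x).
Proof.
move=> iu ip.
have mu_ := cI_meas iu; have mp_ := cI_meas ip.
pose F (x y : R) := u y * expi (2 * pi * y * x) * phi x.
have Fx x : cI (F x).
  have := cIZ (phi x) (kernel_cI x iu).
  by congr cI; apply/funext => y; rewrite mulrC.
have Fy y : cI (F^~ y).
  have := cIZ (u y) (kernel_cI y ip).
  congr cI; apply/funext => x; rewrite /F -[RHS]mulrA [_ * phi x]mulrC.
  by congr (_ * (_ * expi _)); ring.
have cnF x y : cn (F x y) = cn (phi x) * cn (u y) by rewrite /F cnM cn_kernel mulrC.
have mF : cmeas (fun p : R * R => F p.1 p.2).
  apply: cmeasM; last exact: cmeas_comp mp_.
  apply: cmeasM; first exact: cmeas_comp mu_.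
  apply: cmeas_expi; apply: measurable_funM => //; apply: measurable_funM => //.
have fin : (\int[mu]_x \int[mu]_y (cn (F x y))%:E < +oo)%E.
  under eq_integral => x _.
    under eq_integral => y _ do rewrite cnF.
    rewrite -EFin_Rint; last exact/intbZ/cI_cn.
    rewrite RintegralZl//; last exact: cI_cn.
    rewrite mulrC.
    over.
  by rewrite -EFin_Rint ?ltry//; exact/intbZ/cI_cn.
have [_ e] := cFubini mF Fx Fy fin.
rewrite (eq_cint (G := fun x => cint (F x))); last first.
  move=> x; rewrite /invFT mulrC -cintZ; last exact: kernel_cI.
  by apply: eq_cint => y; rewrite mulrC.
rewrite e; apply: eq_cint => y; rewrite /invFT -cintZ; last exact: kernel_cI.
apply: eq_cint => x; rewrite /F -mulrA; congr (_ * _).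
by rewrite mulrC; congr (_ * expi _); ring.
Qed.

End FourierBasics.

(** * The Gaussian and its transform *)

Section Gaussian.
Context {R : realType}.
Local Notation mu := (@lebesgue_measure R).
Local Notation gauss := (@gauss_fun R).

(** The [m]-th power of [y / m <= expR (y / m)]. It gives both the decay of the Gaussian and the
    flatness at 0 of [expR (- 1 / x)]. *)
Lemma expR_bound (m : nat) (y : R) : 0 <= y -> y ^+ m * expR (- y) <= m%:R ^+ m.
Proof.
move=> y0; case: m => [|m]; first by rewrite !expr0 mul1r expR_le1// oppr_le0.
rewrite expRN ler_pdivrMr ?expR_gt0//.
have -> : y = (m.+1%:R : R) * (y / m.+1%:R) by rewrite mulrCA divff ?mulr1// pnatr_eq0.
rewrite exprMn expRM_natl ler_wpM2l ?exprn_ge0//.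
rewrite lerXn2r ?nnegrE ?divr_ge0 ?expR_ge0//.
by apply: le_trans (expR_ge1Dx _); rewrite lerDr.
Qed.

Lemma gauss_derivative : derivative_of gauss (fun x => - (2 * x) * gauss x).
Proof.
apply: (derivative_ext (derivative_comp (@is_derive_expR R)
  (derivativeN (derivativeM derivative_id derivative_id)))) => x.
  by rewrite /gauss_fun expr2.
by rewrite /gauss_fun -expr2 mulrC mul1r mulr1; congr (_ * _); ring.
Qed.

(** The products of the Gaussian with polynomials, a space stable under derivation. *)
Inductive gauss_span : (R -> R) -> Prop :=
| gauss_mono n : gauss_span (fun x => x ^+ n * gauss x)
| gauss_add f g : gauss_span f -> gauss_span g -> gauss_span (fun x => f x + g x)
| gauss_scale (c : R) f : gauss_span f -> gauss_span (fun x => c * f x).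

Lemma derivativeX n : derivative_of (fun x : R => x ^+ n) (fun x => n%:R * x ^+ n.-1).
Proof.
elim: n => [|n IH]; first by apply: (derivative_ext (derivative_cst (1 : R))) => x; rewrite ?mul0r.
apply: (derivative_ext (derivativeM derivative_id IH)) => x; first by rewrite exprS.
rewrite mul1r /=; case: n {IH} => [|n]; first by rewrite expr0 mul0r mulr0 addr0 mulr1.
by rewrite /= mulrCA -exprS -natr1; ring.
Qed.

Lemma schwartzR_gauss : schwartzR gauss.
Proof.
apply: (@schwartz_class _ gauss_span).
- move=> h; elim => {h} [n|f g _ [f' Pf ff'] _ [g' Pg gg']|c f _ [f' Pf ff']].
  + exists (fun x => n%:R * (x ^+ n.-1 * gauss x) + (-2) * (x ^+ n.+1 * gauss x)).
      by apply: gauss_add; apply: gauss_scale; exact: gauss_mono.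
    apply: (derivative_ext (derivativeM (derivativeX n) gauss_derivative)) => // x.
    by rewrite exprS; ring.
  + by exists (fun x => f' x + g' x); [exact: gauss_add|exact: derivativeD].
  + by exists (fun x => c * f' x); [exact: gauss_scale|exact: derivativeZ].
- move=> h; elim => {h} [n|f g _ IHf _ IHg|c f _ IHf] k.
  + exists (1 + (k + n)%:R ^+ (k + n)) => x.
    rewrite mulrA -exprD normrM normrX (ger0_norm (gauss_fun_ge0 x)).
    have [x1|x1] := leP `|x| 1.
      rewrite ler_wpDr ?exprn_ge0// -[leRHS]mulr1 ler_pM ?exprn_ge0 ?gauss_fun_ge0 ?gauss_fun_le1//.
      by rewrite exprn_ile1.
    rewrite ler_wpDl// (le_trans _ (expR_bound (k + n) (sqr_ge0 x)))//.
    rewrite ler_wpM2r ?expR_ge0// -[x ^+ 2]real_normK ?num_real// -exprM.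
    by rewrite ler_eXn2l// leq_pmull.
  + have [M fM] := IHf k; have [N gN] := IHg k.
    by exists (M + N) => x; rewrite mulrDr (le_trans (ler_normD _ _))// lerD.
  + have [M fM] := IHf k.
    by exists (`|c| * M) => x; rewrite mulrCA normrM ler_wpM2l.
- have -> : gauss = (fun x => x ^+ 0 * gauss x) by apply/funext => x; rewrite expr0 mul1r.
  exact: gauss_mono.
Qed.

Lemma schwartz_real (f : R -> R) : schwartzR f -> schwartz (fun x => (f x)%:C).
Proof. by move=> sf; split => //=; exact: schwartzR0. Qed.

Lemma Rint_gauss : Rint gauss = Num.sqrt pi.
Proof. by rewrite /Rintegral integralT_gauss. Qed.

(** From [g' = -2 x g], transforming both sides gives [G' = -2 pi^2 x G], so [G * expR ((pi x)^2)]
    has zero derivative. Its value at 0 is the Gaussian integral. *)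
Lemma invFT_gauss (x : R) :
  invFT (fun y => (gauss y)%:C) x = (Num.sqrt pi * expR (- (pi * x) ^+ 2))%:C.
Proof.
pose g y := (gauss y)%:C; pose G := invFT g.
have sg : schwartz g := schwartz_real schwartzR_gauss.
have ig := schwartz_cI sg.
pose g' y := (- 2 : R)%:C * (y%:C * g y).
have sg' : schwartz g' by exact/schwartzZ/schwartzX.
have gg' : cderivative_of g g'.
  split; first by apply: (derivative_ext gauss_derivative) => // y; rewrite /g' !ReImE /=; ring.
  by apply: (derivative_ext (derivative_cst 0)) => // y; rewrite /g' !ReImE /=; ring.
have [dR dI] := derivative_invFT sg.
have e y : invFT (fun x => (0 +i* (2 * pi)) * (x%:C * g x)) y = (- 2 * pi ^+ 2 * y)%:C * G y.
  have -> : (fun x => (0 +i* (2 * pi)) * (x%:C * g x)) = (fun x => (0 +i* (- pi)) * g' x).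
    apply/funext => z; rewrite /g' !mulrA; congr (_ * _ * _).
    by apply: ReIm_eq; rewrite ReImE /=; ring.
  rewrite invFT_Z; last exact: schwartz_cI.
  rewrite (invFT_derivative y sg gg' sg') mulrA -/G; congr (_ * _).
  by apply: ReIm_eq; rewrite !ReImE /=; ring.
have dE : derivative_of (fun y : R => expR ((pi * y) ^+ 2))
    (fun y : R => (2 * pi ^+ 2 * y) * expR ((pi * y) ^+ 2)).
  have d1 : derivative_of (fun y : R => pi * y) (fun _ => pi).
    by apply: (derivative_ext (derivative_affine pi 0)) => y //; rewrite addr0.
  apply: (derivative_ext (derivative_comp (@is_derive_expR R) (derivativeM d1 d1))) => y.
    by rewrite expr2.
  by rewrite -expr2 mulrC; congr (_ * _); ring.
have cst (f : R -> R) (c : R) : derivative_of f (fun y => (- 2 * pi ^+ 2 * y) * f y) -> f 0 = c ->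
    f x = c * expR (- (pi * x) ^+ 2).
  move=> df f0.
  have d0 : derivative_of (fun y => f y * expR ((pi * y) ^+ 2)) (fun _ => 0).
    by apply: (derivative_ext (derivativeM df dE)) => // y; ring.
  have := is_derive_0_is_cst x 0 d0.
  rewrite mulr0 expr0n/= expR0 mulr1 f0 => <-.
  by rewrite -mulrA -expRD subrr expR0 mulr1.
have G0 : G 0 = (Num.sqrt pi)%:C.
  rewrite /G /invFT; apply: ReIm_eq => /=.
    rewrite -Rint_gauss; apply: eq_Rintegral => y _.
    by rewrite mulr0 cos0 sin0 mulr1 mul0r subr0.
  rewrite /Rintegral; under eq_integral => y _.
    rewrite mulr0 cos0 sin0 mulr0 mul0r addr0.
    over.
  by rewrite integral0.
rewrite -/g -/G; apply: ReIm_eq.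
  apply: (cst (fun y => Re (G y))); last by rewrite G0.
  by apply: (derivative_ext dR) => // y; rewrite e ReImE /=; ring.
rewrite (cst (fun y => Im (G y)) 0) ?G0 ?mul0r//.
by apply: (derivative_ext dI) => // y; rewrite e ReImE /=; ring.
Qed.

Lemma cint_affine (a b : R) (F : R -> R[i]) : 0 < a -> cI F ->
  cint F = a%:C * cint (fun x => F (a * x + b)).
Proof.
move=> a0 [i j]; apply: ReIm_eq; rewrite !ReImE /= mul0r ?subr0 ?addr0; exact: Rint_affine.
Qed.

Lemma cI_affine (a b : R) (F : R -> R[i]) : 0 < a -> cI F -> cI (fun x => F (a * x + b)).
Proof. by move=> a0 [i j]; split; [exact: (intb_affine b a0 i)|exact: (intb_affine b a0 j)]. Qed.

Lemma Rint_gauss_pi : Rint (fun x : R => Num.sqrt pi * expR (- (pi * x) ^+ 2)) = 1.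
Proof.
have ig : intb gauss := integrableT_gauss.
have i2 : intb (fun x => gauss (pi * x + 0)) := intb_affine 0 (pi_gt0 R) ig.
have E : (fun x : R => expR (- (pi * x) ^+ 2)) = (fun x => gauss (pi * x + 0)).
  by apply/funext => x; rewrite addr0.
rewrite RintegralZl// ?E//.
have := Rint_affine 0 (pi_gt0 R) ig; rewrite Rint_gauss.
set J := (X in pi * X) => h.
have p0 : pi != 0 :> R by rewrite gt_eqF// pi_gt0.
by apply: (mulfI p0); rewrite mulrCA -h -expr2 sqr_sqrtr ?mulr1// pi_ge0.
Qed.

End Gaussian.

(** * Fourier inversion and the Plancherel identity for Schwartz functions *)

Section Inversion.
Context {R : realType}.
Local Notation mu := (@lebesgue_measure R).
Local Notation gauss := (@gauss_fun R).
Implicit Types (u : R -> R[i]).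

Lemma ccvgM_real (z_ : nat -> R[i]) (z : R[i]) (a_ : nat -> R) (a : R) :
  ccvg z_ z -> a_ n @[n --> \oo] --> a -> ccvg (fun n => z_ n * (a_ n)%:C) (z * a%:C).
Proof.
move=> [zr zi] aa; split; under eq_fun do rewrite !ReImE /= mulr0; rewrite !ReImE /= mulr0.
  under eq_fun do rewrite subr0; rewrite subr0; exact: cvgM.
under eq_fun do rewrite add0r; rewrite add0r; exact: cvgM.
Qed.

Lemma ccvg_cst (z : R[i]) : ccvg (fun _ => z) z.
Proof. by split; exact: cvg_cst. Qed.

Lemma cvg_div_nat (x : R) : x / n.+1%:R @[n --> \oo] --> (0 : R).
Proof.
rewrite -(mulr0 x); apply: cvgM; [exact: cvg_cst|exact: cvg_harmonic].
Qed.

(** Gaussian regularization. With [gn n] the Gaussian dilated by [n + 1], the multiplication formula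
    and a scaling turn the integral of [invFT u * gn n] into that of [u (y / (n + 1)) * G y]. By
    dominated convergence the two sides tend to [cint (invFT u)] and to [u 0] times the integral of
    [G], which is 1. *)
Lemma inversion0 u : schwartz u -> cint (invFT u) = u 0.
Proof.
move=> su; have iu := schwartz_cI su.
have sU := schwartz_invFT su; have iU := schwartz_cI sU.
pose G x := (Num.sqrt pi * expR (- (pi * x) ^+ 2))%:C : R[i].
have sg : schwartz (fun y => (gauss y)%:C) := schwartz_real schwartzR_gauss.
have GE : G = invFT (fun y => (gauss y)%:C) by apply/funext => x; rewrite invFT_gauss.
have sG : schwartz G by rewrite GE; exact: schwartz_invFT.
have iG := schwartz_cI sG.
have igg := schwartz_cI sg.
pose a n : R := n.+1%:R^-1.
have a0 n : 0 < a n by rewrite invr_gt0 ltr0n.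
pose gn n y := (gauss (a n * y + 0))%:C : R[i].
have ign n : cI (gn n) := cI_affine 0 (a0 n) igg.
have J n : cint (fun x => invFT u x * gn n x) = cint (fun y => u (a n * y + 0) * G y).
  rewrite exchange//.
  have E x : invFT (gn n) x = (n.+1%:R)%:C * G (n.+1%:R * x).
    rewrite /invFT (@cint_affine _ n.+1%:R 0) ?ltr0n//; last exact: kernel_cI.
    congr (_ * _); rewrite GE /invFT; apply: eq_cint => y; rewrite /gn /a !addr0.
    by rewrite mulrA mulVf ?pnatr_eq0// mul1r; congr (_ * expi _); ring.
  rewrite (@cint_affine _ (a n) 0)//; last first.
    apply: (@cI_le _ _ (fun x => Rint (fun y => cn (gn n y)) * cn (u x))).
    - apply: cmeasM; first exact: cI_meas.
      have -> : invFT (gn n) = (fun x => (n.+1%:R)%:C * G (n.+1%:R * x)) by apply/funext.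
      apply: cmeasM; first exact: cmeas_cst.
      apply: (cmeas_comp (F := G) (h := fun x : R => n.+1%:R * x)); last exact: cI_meas.
      by apply: measurable_funM.
    - by apply: intbZ; exact: cI_cn.
    - by move=> x; rewrite cnM mulrC ler_wpM2r ?cn_ge0// cn_invFT.
  rewrite -cintZ.
    apply: eq_cint => y; rewrite E.
    have -> : n.+1%:R * (a n * y + 0) = y by rewrite addr0 mulrA mulfV ?pnatr_eq0// mul1r.
    have h : (a n)%:C * (n.+1%:R)%:C = 1 :> R[i].
      by apply: ReIm_eq; rewrite !ReImE /= ?mulVf ?pnatr_eq0//; ring.
    by rewrite -[RHS]mul1r -h; ring.
  have -> : (fun x => u (a n * x + 0) * invFT (gn n) (a n * x + 0)) = 
     (fun y => (n.+1%:R)%:C * (u (a n * y + 0) * G y)).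
    apply/funext => y; rewrite E mulrCA; congr (_ * (_ * G _)).
    by rewrite addr0 mulrA mulfV ?pnatr_eq0// mul1r.
  apply: cIZ; have [M M0 uM] := schwartz_bounded su.
  apply: (@cI_le _ _ (fun y => M * cn (G y))).
  - apply: cmeasM; last exact: cI_meas.
    exact: (cmeas_comp (measurable_affine (a n) 0) (cI_meas iu)).
  - by apply: intbZ; exact: cI_cn.
  - by move=> y; rewrite cnM ler_wpM2r// cn_ge0.
have az (y : R) : a n * y + 0 @[n --> \oo] --> (0 : R).
  under eq_fun do rewrite addr0 mulrC; exact: cvg_div_nat.
have [_ c1] : cI (invFT u) /\ ccvg (fun n => cint (fun x => invFT u x * gn n x)) (cint (invFT u)).
  apply: (@cint_dct _ _ _ (fun x => cn (invFT u x))).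
  - by move=> n; apply: cmeasM; [exact: cI_meas|exact: cI_meas].
  - move=> x; rewrite -[X in ccvg _ X]mulr1; apply: ccvgM_real; first exact: ccvg_cst.
    have -> : 1 = gauss 0 by rewrite /gauss_fun expr0n oppr0 expR0.
    by apply: (cvg_comp _ _ (az x)); exact: continuous_gauss_fun.
  - exact: cI_cn.
  - move=> n x; rewrite cnM cn_real ger0_norm ?gauss_fun_ge0// ler_piMr ?cn_ge0//.
    exact: gauss_fun_le1.
have [M M0 uM] := schwartz_bounded su.
have [_ c2] : cI (fun y => u 0 * G y) /\
    ccvg (fun n => cint (fun y => u (a n * y + 0) * G y)) (cint (fun y => u 0 * G y)).
  apply: (@cint_dct _ _ _ (fun y => M * cn (G y))).
  - move=> n; apply: cmeasM; last exact: cI_meas.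
    exact: (cmeas_comp (measurable_affine (a n) 0) (cI_meas iu)).
  - move=> y; apply: ccvgM_real; last exact: cvg_cst.
    have [[c _] [d _]] := su.
    by split; [exact: (cvg_comp _ (fun x => Re (u x)) (az y) (smooth_continuous c (x := 0)))|
      exact: (cvg_comp _ (fun x => Im (u x)) (az y) (smooth_continuous d (x := 0)))].
  - by apply: intbZ; exact: cI_cn.
  - by move=> n y; rewrite cnM ler_wpM2r// cn_ge0.
rewrite (ccvg_unique c1 (w := cint (fun y => u 0 * G y))).
  rewrite cintZ// -[RHS]mulr1; congr (_ * _).
  apply: ReIm_eq => /=; first exact: Rint_gauss_pi.
  by rewrite /Rintegral integral0.
by under eq_fun do rewrite J.
Qed.

(** Translating [u] modulates its transform, so the value at [x] is [inversion0] for the translate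
    of [u] by [x]. *)
Lemma inversion u x : schwartz u -> invFT (fun xi => invFT u (- xi)) x = u x.
Proof.
move=> su; have iu := schwartz_cI su.
have := inversion0 (schwartz_shift x su); rewrite add0r => <-.
have sU := schwartz_invFT (schwartz_shift x su).
rewrite -(cint_opp (schwartz_cI sU)) /invFT; apply: eq_cint => xi.
have := invFT_shift (- x) (- xi) iu; under [in X in X -> _]eq_fun do rewrite opprK.
rewrite -!/(invFT _ _) => ->; rewrite mulrC; congr (expi _ * _); ring.
Qed.

(** [exchange] for [u] and the conjugate of its transform: that conjugate is the reflected transform
    of [conjc u], and [inversion] gives back [conjc u]. *)
Lemma plancherel u : schwartz u ->
  Rint (fun x => cn (invFT u x) ^+ 2) = Rint (fun x => cn (u x) ^+ 2).
Proof.
move=> su; have iu := schwartz_cI su; have sU := schwartz_invFT su.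
have key (F : R -> R[i]) : Rint (fun x => cn (F x) ^+ 2) = Re (cint (fun x => F x * conjc (F x))).
  apply: eq_Rintegral => x _; rewrite cn_sqr !ReImE; ring.
rewrite !key; congr Re.
have sV := schwartzJ su.
rewrite (exchange iu (schwartz_cI (schwartzJ sU))); apply: eq_cint => x; congr (_ * _).
rewrite -(inversion x sV); congr (invFT _ x); apply/funext => xi.
exact: invFT_J.
Qed.

End Inversion.

(** * Compactly supported smooth functions *)

Section Bump.
Context {R : realType}.

(** [x^-n exp (- 1 / x)] extended by 0. The index [n] is there for derivation: the derivative of the
    [n]-th function is a combination of those of index [n + 1] and [n + 2], so the family generates
    a stable algebra. *)
Definition flat_exp (n : nat) (x : R) : R := if 0 < x then x^-1 ^+ n * expR (- x^-1) else 0.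

Lemma flat_exp_ge0 n x : 0 <= flat_exp n x.
Proof. by rewrite /flat_exp; case: ifPn => // x0; rewrite mulr_ge0 ?expR_ge0 ?exprn_ge0 ?invr_ge0 ?ltW. Qed.

(** [expR_bound] at exponent [n + 2] and argument [1 / x]. The two spare powers of [x] give the
    derivative at 0, the only point where no formula is valid on both sides. *)
Lemma flat_exp_quadratic n x : flat_exp n x <= n.+2%:R ^+ n.+2 * x ^+ 2.
Proof.
rewrite /flat_exp; case: ifPn => x0; last by rewrite mulr_ge0 ?sqr_ge0 ?exprn_ge0.
have xV : 0 <= x^-1 by rewrite invr_ge0 ltW.
have := expR_bound n.+2 xV.
move=> /(ler_wpM2r (sqr_ge0 x)); congr (_ <= _).
have e : x^-1 ^+ 2 * x ^+ 2 = 1 by rewrite -exprMn mulVf ?expr1n// gt_eqF.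
by rewrite -addn2 exprD -[RHS]mulr1 -e; ring.
Qed.

Lemma is_derive_quadratic (f : R -> R) (C : R) : (forall x, `|f x| <= C * x ^+ 2) ->
  is_derive (0 : R) (1 : R) f 0.
Proof.
move=> fC.
have f0 : f 0 = 0 by apply/eqP; rewrite -normr_le0 (le_trans (fC 0))// expr0n/= mulr0.
have C0 : 0 <= C by have := fC 1; rewrite expr1n mulr1; exact: le_trans.
have h : h^-1 *: (f (h *: (1 : R) + 0) - f 0) @[h --> (0 : R)^'] --> (0 : R).
  apply: norm_cvg0.
  apply: (@squeeze_cvgr _ _ _ _ (fun _ => 0) (fun h : R => C * `|h|)).
  - near=> h; rewrite normr_ge0/= addr0 f0 subr0 -[h *: 1]/(h * 1) mulr1.
    have h0 : h != 0 by near: h; exact: nbhs_dnbhs_neq.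
    rewrite -[_ *: _]/(_ * _) normrM normfV mulrC ler_pdivrMr ?normr_gt0//.
    by rewrite -mulrA -expr2 real_normK ?num_real.
  - exact: cvg_cst.
  - rewrite -[X in _ --> X](mulr0 C); apply: cvgM; first exact: cvg_cst.
    rewrite -[X in _ --> X](normr0 R).
    apply: (@cvg_within_filter _ _ (fun h : R => `|h|)).
    exact: norm_continuous.
apply: DeriveDef; first by apply/cvg_ex; exists 0.
exact/cvg_lim.
Unshelve. all: by end_near. Qed.

Lemma is_deriveX_pt n (x : R) : is_derive x 1 (fun x : R => x ^+ n) (n%:R * x ^+ n.-1).
Proof. exact: derivativeX. Qed.

Lemma flat_exp_derivative n :
  derivative_of (flat_exp n) (fun x => flat_exp n.+2 x + (- n%:R) * flat_exp n.+1 x).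
Proof.
move=> x; have [x0|x0|->] := ltgtP x 0.
- rewrite /flat_exp !ltNge !(ltW x0)/= mulr0 addr0.
  apply: (near_eq_is_derive _ (@derivative_cst R 0 x)).
  near=> y; rewrite ltNge [y <= 0](_ : _ = true)//; apply/ltW.
  by near: y; exact: lt_nbhsl.
- rewrite /flat_exp x0.
  have dV : is_derive x 1 (fun y : R => y^-1) (- x ^- 2).
    have := is_deriveV (lt0r_neq0 x0) (is_derive_id x 1).
    by rewrite -[_ *: _]/(_ * _) mulr1.
  have d1 := is_derive1_comp (is_deriveX_pt n x^-1) dV.
  have d2 : is_derive x 1 (fun y : R => expR (- y^-1)) (expR (- x^-1) * - - x ^- 2).
    exact: (@is_derive1_comp R expR (fun y => - y^-1) x _ _ (is_derive_expR _) (is_deriveN dV)).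
  have H : is_derive x 1 (fun y : R => y^-1 ^+ n * expR (- y^-1))
      (x^-1 ^+ n.+2 * expR (- x^-1) + 1 *- n * (x^-1 ^+ n.+1 * expR (- x^-1))).
    have := is_deriveM d1 d2; rewrite -![_ *: _]/(_ * _) /=.
    congr is_derive; rewrite -exprVn.
    have -> : n.+2 = (n + 2)%N by rewrite addn2.
    case: n {d1 d2} => [|n]; first by rewrite expr0 add0n; ring.
    by rewrite /= exprD !exprS; ring.
  apply: (near_eq_is_derive _ H).
  near=> y; rewrite [0 < y](_ : _ = true)//.
  by near: y; exact: lt_nbhsr.
- rewrite {2 3}/flat_exp ltxx mulr0 addr0.
  apply: (is_derive_quadratic (C := n.+2%:R ^+ n.+2)) => y.
  by rewrite ger0_norm ?flat_exp_ge0// flat_exp_quadratic.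
Unshelve. all: by end_near. Qed.

Lemma smooth_flat_exp n : smoothR (flat_exp n).
Proof.
pose B (g : R -> R) := (exists n, g = flat_exp n) \/ exists c, g = fun _ => c.
apply: (@smooth_class _ (generated B)); last by apply: gen_base; left; exists n.
apply: generated_closed => _ [[m ->]|[c ->]]; last first.
  by exists (fun _ => 0); [apply: gen_base; right; exists 0|exact: derivative_cst].
exists (fun x => flat_exp m.+2 x + (- m%:R) * flat_exp m.+1 x); last exact: flat_exp_derivative.
apply: gen_add; first by apply: gen_base; left; exists m.+2.
apply: gen_mul; first by apply: gen_base; right; exists (- m%:R).
by apply: gen_base; left; exists m.+1.
Qed.

Definition omega := flat_exp 0.
Lemma omega_ge0 x : 0 <= omega x. Proof. exact: flat_exp_ge0. Qed.
Lemma omega_gt0 x : 0 < x -> 0 < omega x.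
Proof. by move=> x0; rewrite /omega /flat_exp x0 expr0 mul1r expR_gt0. Qed.
Lemma omega_eq0 x : x <= 0 -> omega x = 0.
Proof. by move=> x0; rewrite /omega /flat_exp ltNge x0. Qed.
Lemma omega_le1 x : omega x <= 1.
Proof.
rewrite /omega /flat_exp; case: ifPn => // x0.
by rewrite expr0 mul1r expR_le1// oppr_le0 invr_ge0 ltW.
Qed.
Lemma smooth_omega (a b : R) : smoothR (fun x => omega (a * x + b)).
Proof. exact/smooth_affine/smooth_flat_exp. Qed.

(** A smooth step from 0 on the left of 0 to 1 on the right of 1; the denominator never vanishes
    because [x] and [1 - x] are not both nonpositive. *)
Definition sstep x := omega x / (omega x + omega (1 - x)).

Lemma sstep_den_neq0 x : omega x + omega (1 - x) != 0.
Proof.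
have [x0|x0] := leP x 0.
  by rewrite gt_eqF// ltr_wpDl ?omega_ge0// omega_gt0//; lra.
by rewrite gt_eqF// ltr_pwDl ?omega_ge0// omega_gt0.
Qed.
Lemma sstep0 x : x <= 0 -> sstep x = 0.
Proof. by move=> /omega_eq0; rewrite /sstep => ->; rewrite mul0r. Qed.
Lemma sstep1 x : 1 <= x -> sstep x = 1.
Proof.
move=> x1; have := sstep_den_neq0 x; rewrite /sstep (@omega_eq0 (1 - x)) ?subr_le0// addr0.
exact: divff.
Qed.
Lemma smooth_sstep : smoothR sstep.
Proof.
have s1 : smoothR omega by exact: smooth_flat_exp.
have s2 : smoothR (fun x => omega (1 - x)).
  have := @smooth_omega (-1) 1; congr smoothR; apply/funext => x; congr omega; ring.
exact: (smoothM s1 (smoothV (smoothD s1 s2) sstep_den_neq0)).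
Qed.

Definition bump0 x := omega (1 + x) * omega (1 - x).

Lemma bump0_ge0 x : 0 <= bump0 x. Proof. by rewrite mulr_ge0 ?omega_ge0. Qed.
Lemma bump0_le1 x : bump0 x <= 1.
Proof. by rewrite -[leRHS]mulr1 ler_pM ?omega_ge0 ?omega_le1. Qed.
Lemma bump0_eq0 x : 1 < `|x| -> bump0 x = 0.
Proof.
rewrite /bump0; have [x0|x0] := leP 0 x => x1.
  by rewrite [X in _ * X]omega_eq0 ?mulr0//; move: x1; rewrite ger0_norm//; lra.
by rewrite omega_eq0 ?mul0r//; move: x1; rewrite ltr0_norm//; lra.
Qed.
Lemma smooth_bump0 : smoothR bump0.
Proof.
have s1 : smoothR (fun x => omega (1 + x)).
  have := @smooth_omega 1 1; congr smoothR; apply/funext => x; congr omega; ring.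
have s2 : smoothR (fun x => omega (1 - x)).
  have := @smooth_omega (-1) 1; congr smoothR; apply/funext => x; congr omega; ring.
exact: (smoothM s1 s2).
Qed.
Lemma schwartzR_bump0 : schwartzR bump0.
Proof. exact: schwartz_compact smooth_bump0 bump0_eq0. Qed.

Lemma schwartzR_int (f : R -> R) : schwartzR f -> intb f.
Proof. by move=> sf; have [] := schwartz_cI (schwartz_real sf). Qed.

Lemma bump0_mass_gt0 : 0 < Rint bump0.
Proof.
(* On [[-1/2, 1/2]], of length 1, both [1 + x] and [1 - x] are at least [1/2], so each factor of
   [bump0] is at least [expR (-2)]. *)
apply: (@lt_le_trans _ _ (expR (- 4))); first exact: expR_gt0.
have := integrable_indic_itv (- 2^-1 : R) 2^-1 true false => i.
pose ind : R -> R := \1_`[- 2^-1, 2^-1].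
have ii : intb ind by apply: integrable_indic_itv.
have -> : expR (-4) = Rint (fun x => expR (-4) * ind x).
  rewrite RintegralZl// /Rintegral integral_indic//= setIT lebesgue_measure_itv/= lte_fin.
  rewrite gtrN// -EFinB/= opprK -mulr2n -(mulr_natr 2^-1) mulVf ?pnatr_eq0// mulr1//.
apply: Rint_le; first exact: intbZ.
  exact/schwartzR_int/schwartzR_bump0.
move=> x; rewrite /ind indicE; case: (boolP (x \in _)); last by rewrite mulr0 bump0_ge0.
rewrite inE/= in_itv/= mulr1 => /andP[x1 x2].
have k (y : R) : 2^-1 <= y -> expR (-2) <= omega y.
  move=> y2; have y0 : 0 < y by apply: lt_le_trans y2.
  rewrite /omega /flat_exp y0 expr0 mul1r ler_expR lerN2.
  by rewrite -[leRHS]invrK lef_pV2 ?posrE ?invr_gt0.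
have -> : expR (-4) = expR (-2) * expR (-2) :> R by rewrite -expRD; congr expR; ring.
by rewrite ler_pM ?expR_ge0// k//; lra.
Qed.

(* A smooth probability density supported in [-1/(n+1), 1/(n+1)]. *)
Definition bump n x := n.+1%:R / Rint bump0 * bump0 (n.+1%:R * x).

Lemma bump_ge0 n x : 0 <= bump n x.
Proof. by rewrite mulr_ge0 ?bump0_ge0 ?divr_ge0// ltW// bump0_mass_gt0. Qed.
Lemma bump_le n x : bump n x <= n.+1%:R / Rint bump0.
Proof. by rewrite ler_piMr ?bump0_le1 ?divr_ge0// ltW// bump0_mass_gt0. Qed.
Lemma bump_eq0 n x : n.+1%:R^-1 < `|x| -> bump n x = 0.
Proof.
move=> x1; rewrite /bump bump0_eq0 ?mulr0// normrM ger0_norm//.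
by rewrite -ltr_pdivrMl ?ltr0n// mulr1.
Qed.
Lemma bumpE n : bump n = fun x => n.+1%:R / Rint bump0 * bump0 (n.+1%:R * x + 0).
Proof. by apply/funext => x; rewrite addr0. Qed.
Lemma schwartzR_bump n : schwartzR (bump n).
Proof.
apply: (@schwartz_compact _ _ n.+1%:R^-1); last by move=> x; exact: bump_eq0.
rewrite bumpE.
exact: (smoothM (@smooth_cst R _) (@smooth_affine R bump0 n.+1%:R 0 smooth_bump0)).
Qed.
Lemma bump_mass n : Rint (bump n) = 1.
Proof.
have ib := schwartzR_int schwartzR_bump0.
have n0 : 0 < n.+1%:R :> R by rewrite ltr0n.
rewrite bumpE RintegralZl//; last exact: (intb_affine 0 n0 ib).
by rewrite mulrAC -(Rint_affine 0 n0 ib) divff// gt_eqF// bump0_mass_gt0.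
Qed.

End Bump.

(** * Square-integrable functions *)

Section SquareIntegrable.
Context {R : realType}.
Local Notation mu := (@lebesgue_measure R).
Implicit Types (F G h g m u phi : R -> R[i]).

Lemma L2P F : L2 F <-> cmeas F /\ intb (fun x => cn (F x) ^+ 2).
Proof.
have E : abs2 F = fun x => cn (F x) ^+ 2 by apply/funext => x; rewrite abs2E.
split=> [[mF fin]|[mF /integrableP[_ fin]]]; split => //.
- apply: intb_ge0_lty; first by apply: measurable_funX; exact: cmeas_cn.
    by move=> x; rewrite sqr_ge0.
  by under eq_integral do rewrite -abs2E.
- have m2 : measurable_fun setT (fun x => cn (F x) ^+ 2) by apply: measurable_funX; exact: cmeas_cn.
  rewrite E; apply: le_lt_trans fin; apply: ge0_le_integral => //.
  + by move=> x _; rewrite lee_fin sqr_ge0.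
  + exact: (EFin_meas m2).
  + by apply: measurableT_comp => //; exact: (EFin_meas m2).
  + by move=> x _ /=; rewrite lee_fin ger0_norm// sqr_ge0.
Qed.

Lemma schwartz_L2 F : schwartz F -> L2 F.
Proof. by move=> sF; apply/L2P; split; [exact: schwartz_meas|exact: schwartz_sqr]. Qed.

Lemma intb_mul (a b : R -> R) : measurable_fun setT a -> measurable_fun setT b ->
  intb (fun x => a x ^+ 2) -> intb (fun x => b x ^+ 2) -> intb (fun x => a x * b x).
Proof.
move=> ma mb ia ib; apply: (intb_le _ (intbD ia ib)); first exact: measurable_funM.
by move=> x; rewrite ler_norml; have := sqr_ge0 (a x - b x); have := sqr_ge0 (a x + b x);
  have := sqr_ge0 (a x); have := sqr_ge0 (b x); nra.
Qed.

Lemma L2_mul_cI F G : L2 F -> L2 G -> cI (fun x => F x * G x).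
Proof.
move=> /L2P[mF iF] /L2P[mG iG].
apply: (@cI_le _ _ (fun x => cn (F x) * cn (G x))).
- exact: cmeasM.
- by apply: intb_mul => //; exact: cmeas_cn.
- by move=> x; rewrite cnM.
Qed.

Lemma L2_bounded_mul (m : R -> R[i]) F (M : R) : cmeas m -> (forall x, cn (m x) <= M) ->
  L2 F -> L2 (fun x => m x * F x).
Proof.
move=> mm mM /L2P[mF iF]; apply/L2P; split; first exact: cmeasM.
apply: (@intb_le _ _ (fun x => M ^+ 2 * cn (F x) ^+ 2)).
- by apply: measurable_funX; apply: cmeas_cn; exact: cmeasM.
- exact: intbZ.
- move=> x; rewrite ger0_norm ?sqr_ge0// cnM exprMn ler_wpM2r ?sqr_ge0//.
  by rewrite lerXn2r ?nnegrE ?cn_ge0// (le_trans (cn_ge0 _) (mM x)).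
Qed.

(** Tonelli gives the measurability for nonnegative functions; [f] is the difference of [|f|] and
    [|f| - f], both nonnegative with integrable sections. *)
Lemma Rint_section_meas (f : R -> R -> R) :
  measurable_fun setT (fun p : R * R => f p.1 p.2) -> (forall x, intb (f x)) ->
  measurable_fun setT (fun x => Rint (f x)).
Proof.
move=> mf fi.
have ma : measurable_fun setT (fun p : R * R => `|f p.1 p.2|) by apply: measurableT_comp.
have -> : (fun x => Rint (f x)) = (fun x => Rint (fun y => `|f x y|) - Rint (fun y => `|f x y| - f x y)).
  apply/funext => x; rewrite -RintegralB//.
  - by apply: eq_Rintegral => y _; rewrite subKr.
  - exact: intb_norm.
  - by apply: intbB => //; exact: intb_norm.
have key (k : R -> R -> R) : measurable_fun setT (fun p : R * R => k p.1 p.2) ->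
    (forall x y, 0 <= k x y) -> measurable_fun setT (fun x => Rint (k x)).
  by move=> mk k0; apply: (measurableT_comp (fine_measurable measurableT)); exact: tonelli_meas.
apply: measurable_funB; apply: key => //.
  exact: measurable_funB.
by move=> x y; rewrite subr_ge0 ler_norm.
Qed.

Lemma cint_section_meas (F : R -> R -> R[i]) :
  cmeas (fun p : R * R => F p.1 p.2) -> (forall x, cI (F x)) -> cmeas (fun x => cint (F x)).
Proof.
move=> [a b] Fi; split => /=.
  by apply: (Rint_section_meas a) => x; case: (Fi x).
by apply: (Rint_section_meas b) => x; case: (Fi x).
Qed.

Lemma measurable_subpair : measurable_fun setT (fun p : R * R => p.1 - p.2).
Proof. exact: measurable_funB. Qed.

Lemma measurable_reflect (x : R) : measurable_fun setT (fun y : R => x - y).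
Proof. exact: measurable_funB. Qed.

Lemma convw_int (q : R -> R) (x : R) : measurable_fun setT q -> (forall y, 0 <= q y) ->
  intb (fun y => q y ^+ 2) -> intb (fun y => w (x - y) * q y).
Proof.
by move=> mq q0 iq; exact: (conv_int mq w_ge0 q0 w_le1 w_int iq).
Qed.

Lemma convw_young (q : R -> R) : measurable_fun setT q -> (forall y, 0 <= q y) ->
  intb (fun y => q y ^+ 2) ->
  intb (fun x => conv w q x ^+ 2) /\
  Rint (fun x => conv w q x ^+ 2) <= Rint w ^+ 2 * Rint (fun x => q x ^+ 2).
Proof.
by move=> mq q0 iq; apply: (young (M := 1)) => //; [exact: w_meas|exact: w_ge0|exact: w_le1|exact: w_int].
Qed.

Lemma convw_meas (q : R -> R) : measurable_fun setT q -> (forall y, 0 <= q y) ->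
  measurable_fun setT (conv w q).
Proof. by move=> mq q0; apply: conv_meas => //; [exact: w_meas|exact: w_ge0]. Qed.

(* The square of [conv w q] is at most [Rint w * conv w (q^2)], and [w <= 1]. *)
Lemma convw_bounded (q : R -> R) (x : R) : measurable_fun setT q -> (forall y, 0 <= q y) ->
  intb (fun y => q y ^+ 2) -> conv w q x <= Rint w + Rint (fun y => q y ^+ 2).
Proof.
move=> mq q0 iq; rewrite /conv -[Rint w](Rint_reflect x w_int) -RintegralD//; last exact: intb_reflect w_int.
apply: Rint_le.
- exact: convw_int.
- by apply: intbD => //; exact: intb_reflect w_int.
- move=> y; have := w_ge0 (x - y); have := w_le1 (x - y); have := q0 y.
  move=> a b c; have [q1|q1] := leP (q y) 1.
    by rewrite ler_wpDr ?sqr_ge0// ler_piMr.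
  rewrite ler_wpDl//; apply: (@le_trans _ _ (q y)); first by rewrite ler_piMl.
  by rewrite expr2 ler_peMr// ltW.
Qed.

Definition cconv (m g : R -> R[i]) (x : R) : R[i] := cint (fun y => m (x - y) * g y).

Section Multiplier.
Variables (m g : R -> R[i]) (c : R).
Hypotheses (mm : cmeas m) (mc : forall x, cn (m x) <= c * w x) (Lg : L2 g).

Let mq : measurable_fun setT (fun y => cn (g y)). Proof. by apply: cmeas_cn; case/L2P: Lg. Qed.
Let q0 y : 0 <= cn (g y). Proof. exact: cn_ge0. Qed.
Let iq : intb (fun y => cn (g y) ^+ 2). Proof. by case/L2P: Lg. Qed.
Let mg : cmeas g. Proof. by case/L2P: Lg. Qed.
Let c0 : 0 <= c.
Proof. by rewrite -(pmulr_lge0 _ (w_gt0 (0 : R))) (le_trans _ (mc 0))// cn_ge0. Qed.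

Lemma cconv_int x : cI (fun y => m (x - y) * g y).
Proof.
apply: (@cI_le _ _ (fun y => c * (w (x - y) * cn (g y)))).
- apply: cmeasM => //; exact: (cmeas_comp (measurable_reflect x) mm).
- by apply: intbZ; exact: convw_int.
- by move=> y; rewrite cnM mulrA ler_wpM2r ?cn_ge0.
Qed.

Lemma cn_cconv x : cn (cconv m g x) <= c * conv w (fun y => cn (g y)) x.
Proof.
apply: le_trans (cint_norm (cconv_int x)) _.
rewrite /conv -RintegralZl//; last exact: convw_int.
apply: Rint_le.
- exact/cI_cn/cconv_int.
- by apply: intbZ; exact: convw_int.
- by move=> y; rewrite cnM mulrA ler_wpM2r ?cn_ge0.
Qed.

Lemma cconv_pair_meas : cmeas (fun p : R * R => m (p.1 - p.2) * g p.2).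
Proof.
apply: cmeasM; first exact: (cmeas_comp measurable_subpair mm).
exact: (cmeas_comp measurable_snd mg).
Qed.

Lemma cconv_meas : cmeas (cconv m g).
Proof.
exact: (cint_section_meas (F := fun x y => m (x - y) * g y) cconv_pair_meas cconv_int).
Qed.

Lemma cconv_L2 : L2 (cconv m g).
Proof.
apply/L2P; split; first exact: cconv_meas.
have [i _] := convw_young mq q0 iq.
apply: (intb_le _ (intbZ (c ^+ 2) i)).
  by apply: measurable_funX; apply: cmeas_cn; exact: cconv_meas.
move=> x; rewrite ger0_norm ?sqr_ge0// -exprMn lerXn2r ?nnegrE ?cn_ge0//; last exact: cn_cconv.
by rewrite (le_trans _ (cn_cconv x))// cn_ge0.
Qed.

(** Fubini: the absolute double integral is controlled by that of [conv w |g| * |phi|], a product of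
    two square-integrable functions by Young's inequality. *)
Lemma cconv_swap phi : cI phi -> L2 phi ->
  cint (fun x => cconv m g x * phi x) =
  cint (fun y => g y * cint (fun x => m (x - y) * phi x)).
Proof.
move=> iphi /L2P[mphi i2phi].
pose F (x y : R) := m (x - y) * g y * phi x.
have mF : cmeas (fun p : R * R => F p.1 p.2).
  by apply: cmeasM; [exact: cconv_pair_meas|exact: (cmeas_comp measurable_fst mphi)].
have Fx x : cI (F x).
  by have := cIZ (phi x) (cconv_int x); congr cI; apply/funext => y; rewrite mulrC.
have my (y : R) : cI (fun x => m (x - y) * phi x).
  apply: (@cI_le _ _ (fun x => c * cn (phi x))).
  - apply: cmeasM => //; apply: (cmeas_comp (F := m) (h := fun x : R => x - y)) => //.
    exact: measurable_funB.
  - by apply: intbZ; exact: cI_cn.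
  - move=> x; rewrite cnM ler_wpM2r ?cn_ge0// (le_trans (mc _))//.
    by rewrite ler_piMr// w_le1.
have Fy y : cI (F^~ y).
  have := cIZ (g y) (my y); congr cI; apply/funext => x; rewrite /F; ring.
have fin : (\int[mu]_x \int[mu]_y (cn (F x y))%:E < +oo)%E.
  have [i _] := convw_young mq q0 iq.
  have ib : intb (fun x => c * (conv w (fun y => cn (g y)) x * cn (phi x))).
    apply: intbZ; apply: intb_mul => //.
    - exact: convw_meas.
    - exact: cmeas_cn.
  apply: (@le_lt_trans _ _ (\int[mu]_x (c * (conv w (fun y => cn (g y)) x * cn (phi x)))%:E)%E).
    apply: ge0_le_integral => //.
    - by move=> x _; apply: integral_ge0 => y _; rewrite lee_fin cn_ge0.
    - apply: (tonelli_meas (h := fun x y => cn (F x y))); first exact: (cmeas_cn mF).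
      by move=> *; exact: cn_ge0.
    - exact: (EFin_meas (intb_meas ib)).
    - move=> x _; rewrite -EFin_Rint; last exact: cI_cn.
      rewrite lee_fin mulrA [leRHS]mulrC.
      rewrite /conv -RintegralZl//; last exact: convw_int.
      rewrite -RintegralZl//; last by apply: intbZ; exact: convw_int.
      apply: Rint_le; first exact: cI_cn.
        by apply: intbZ; apply: intbZ; exact: convw_int.
      move=> y; rewrite /F !cnM [leLHS]mulrC ler_wpM2l ?cn_ge0// mulrA ler_wpM2r ?cn_ge0//.
  by rewrite -EFin_Rint ?ltry.
have [_ e] := cFubini mF Fx Fy fin.
transitivity (cint (fun x => cint (F x))).
  apply: eq_cint => x; rewrite /cconv mulrC -cintZ; last exact: cconv_int.
  by apply: eq_cint => y; rewrite mulrC.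
rewrite e; apply: eq_cint => y; rewrite -(cintZ (g y) (my y)).
apply: eq_cint => x; rewrite /F; ring.
Qed.

End Multiplier.

(** The convolution theorem by duality. Testing the convolution against [phi] moves [invFT m] onto
    [phi] and yields [Phi]; the duality between [h] and [g] applies to [Phi], and Fourier inversion
    recovers [m * invFT phi]. *)
Lemma IsInvFT_mul m h g : schwartz m -> L2 h -> IsInvFT h g ->
  IsInvFT (fun x => m x * h x) (cconv (invFT m) g).
Proof.
move=> sm Lh [Lg dual].
have sM := schwartz_invFT sm; have [c _ Mc] := schwartz_le_w 1 sM.
have {}Mc x : cn (invFT m x) <= c * w x by have := Mc x; rewrite expr1.
have mM := schwartz_meas sM.
split; first exact: (cconv_L2 mM Mc Lg).
move=> phi sphi; rewrite (cconv_swap mM Mc Lg (schwartz_cI sphi) (schwartz_L2 sphi)).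
have sphi' := schwartz_invFT sphi.
pose u x := m x * invFT phi x.
have su : schwartz u by exact: schwartzM.
(* The reflection makes [invFT Phi] equal to [u] by [inversion]. *)
pose Phi y := invFT u (- y).
have sPhi : schwartz Phi by exact/schwartz_opp/schwartz_invFT.
transitivity (cint (fun y => g y * Phi y)).
  apply: eq_cint => y; congr (_ * _).
  have im := schwartz_cI sm.
  have ik := kernel_cI (- y) im.
  transitivity (cint (fun x => phi x * invFT (fun z => m z * expi (2 * pi * z * - y)) x)).
    apply: eq_cint => x; rewrite mulrC; congr (_ * _); apply: eq_cint => z.
    by rewrite -[RHS]mulrA -expiD; congr (_ * expi _); ring.
  rewrite -exchange//; last exact: schwartz_cI.
  by apply: eq_cint => x; rewrite /u mulrA [invFT phi x * _]mulrC.
rewrite (dual _ sPhi); apply: eq_cint => x; rewrite (inversion x su).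
by rewrite /u mulrA [h x * _]mulrC.
Qed.

End SquareIntegrable.

(** * Mollification and the Plancherel inequality for square-integrable functions *)

Section Mollification.
Context {R : realType}.
Local Notation mu := (@lebesgue_measure R).
Implicit Types (F G h g m u phi : R -> R[i]).

Lemma derivative_mollify (s s' q : R -> R) (M : R) : derivative_of s s' -> measurable_fun setT s' ->
  (forall x, `|s x| <= M) -> (forall x, `|s' x| <= M) -> intb q ->
  derivative_of (fun x => Rint (fun y => s (y - x) * q y))
    (fun x => - Rint (fun y => s' (y - x) * q y)).
Proof.
move=> ss' ms' sM s'M iq.
have ms : measurable_fun setT s by apply: continuous_measurable_fun; exact: derivative_continuous ss'.
have i (t : R -> R) (x : R) : measurable_fun setT t -> (forall x, `|t x| <= M) ->
    intb (fun y => t (y - x) * q y).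
  move=> mt tM; apply: (intb_le _ (intbZ M (intb_norm iq))).
    apply: measurable_funM; last exact: intb_meas iq.
    apply: (measurableT_comp mt (g := fun y : R => y - x)); exact: measurable_funB.
  by move=> y; rewrite normrM ler_wpM2r.
have := @derivative_under_integral R (fun x y => s (y - x) * q y)
  (fun x y => - (s' (y - x) * q y)) (fun y => M * `|q y|).
move=> H; apply: (derivative_ext (H _ _ _ _)) => //.
- move=> y; apply: (derivative_ext (derivativeM (derivative_comp ss' (derivative_affine (-1) y))
    (@derivative_cst R (q y)))) => x; rewrite mulN1r addrC//.
  by rewrite mulr0 addr0 mulrN1 mulNr.
- by move=> x; exact: i.
- by apply: intbZ; exact: intb_norm.
- by move=> x y; rewrite normrN normrM ler_wpM2r.
- move=> x; rewrite -mulN1r -RintegralZl//; last exact: i.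
  by apply: eq_Rintegral => y _; rewrite mulN1r.
Qed.

(** The derivative falls on [s], so the integrals against a fixed [q] form a class stable under
    derivation, and the supports add up to [a + N]. The argument is [y - x] because the lemma serves
    for the adjoint of a mollification. *)
Lemma schwartzR_mollify (s q : R -> R) (a N : R) : schwartzR s -> intb q ->
  (forall x, a < `|x| -> s x = 0) -> (forall x, N < `|x| -> q x = 0) ->
  schwartzR (fun x => Rint (fun y => s (y - x) * q y)).
Proof.
move=> ss iq sa qN; apply: (@schwartz_compact _ _ (a + N)).
  apply: (@smooth_class _ (fun g : R -> R => exists2 s : R -> R, schwartzR s &
      g = fun x : R => Rint (fun y : R => s (y - x) * q y)));
    last by exists s.
  move=> _ [{sa}s {}ss ->]; have [s' ss' d] := schwartz_closed ss.
  have [M M0 sM] := schwartz_bound 0 ss; have [M' M'0 sM'] := schwartz_bound 0 ss'.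
  have is' := schwartzR_int ss'.
  exists (fun x => - Rint (fun y => s' (y - x) * q y)).
    exists (fun x => - s' x); first exact: schwartzRN.
    apply/funext => x; rewrite -mulN1r -RintegralZl//.
      by apply: eq_Rintegral => y _; rewrite mulN1r mulNr.
    apply: (intb_le _ (intbZ M' (intb_norm iq))).
      apply: measurable_funM; last exact: intb_meas iq.
      apply: (measurableT_comp (intb_meas is') (g := fun y : R => y - x)); exact: measurable_funB.
    by move=> y; rewrite normrM ler_wpM2r//; have := sM' (y - x); rewrite expr0 mul1r.
  apply: (derivative_mollify (M := M + M') d (intb_meas is') _ _ iq) => x.
    by have := sM x; rewrite expr0 mul1r => /le_trans; apply; rewrite lerDl.
  by have := sM' x; rewrite expr0 mul1r => /le_trans; apply; rewrite lerDr.
move=> x xa; rewrite /Rintegral -[RHS](_ : fine (\int[mu]_y (0%:E : \bar R))%E = 0); last by rewrite integral0.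
congr fine; apply: eq_integral => y _; have [yN|yN] := ltP N `|y|.
  by rewrite qN// mulr0.
rewrite sa ?mul0r//; have := ler_normB y (y - x); rewrite opprB addrC subrK => h; lra.
Qed.

Lemma lebesgue_pt_mollify (f : R -> R) (y : R) :
  (forall n, intb (fun x => bump n (y - x) * f x)) -> measurable_fun setT f -> lebesgue_pt f y ->
  Rint (fun x => bump n (y - x) * f x) @[n --> \oo] --> f y.
Proof.
move=> bi mf ly.
set Z := Rint (@bump0 R); have Z0 : 0 < Z := bump0_mass_gt0.
(* Twice the radius of the support, so that [bump n] vanishes off the open ball. The ball has length
   [4 / (n + 1)] and [bump n] is at most [(n + 1) / Z], whence the constant [4 / Z] in front of the
   mean deviation. *)
pose r n : R := 2 / n.+1%:R.
have r0 n : 0 < r n by rewrite divr_gt0// ltr0n.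
have bd n : ((`|Rint (fun x => bump n (y - x) * f x) - f y|)%:E <= (4 / Z)%:E * davg f y (r n))%E.
  have ib : intb (fun x => bump n (y - x)) by apply: intb_reflect; exact/schwartzR_int/schwartzR_bump.
  have -> : Rint (fun x => bump n (y - x) * f x) - f y = Rint (fun x => bump n (y - x) * (f x - f y)).
    under [RHS]eq_Rintegral do rewrite mulrBr.
    rewrite RintegralB//; last by under eq_fun do rewrite mulrC; exact: intbZ.
    by rewrite RintegralZr// Rint_reflect ?bump_mass ?mul1r//; exact/schwartzR_int/schwartzR_bump.
  have ibf : intb (fun x => bump n (y - x) * (f x - f y)).
    under eq_fun do rewrite mulrBr.
    by apply: intbB => //; under eq_fun do rewrite mulrC; exact: intbZ.
  apply: (@le_trans _ _ (Rint (fun x => `|bump n (y - x) * (f x - f y)|))%:E).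
    by rewrite lee_fin le_normr_Rintegral.
  rewrite (EFin_Rint (intb_norm ibf)).
  rewrite /davg /iavg lebesgue_measure_ball ?(ltW (r0 n))//.
  have mfy : measurable_fun setT (fun x => f x - f y) by exact: measurable_funB.
  apply: (@le_trans _ _ (\int[mu]_(x in ball y (r n)) (n.+1%:R / Z * `|f x - f y|)%:E)%E).
    rewrite [leRHS]integral_mkcond; apply: ge0_le_integral => //.
    - by apply/measurable_EFinP; apply: measurableT_comp => //; exact: intb_meas ibf.
    - apply/(measurable_restrictT _ _).1; first exact: measurable_ball.
      apply: measurable_funTS; apply/measurable_EFinP; apply: measurable_funM => //.
      exact: measurableT_comp.
    - move=> x _; rewrite patchE; case: ifPn => xy.
        by rewrite lee_fin normrM ler_wpM2r// ger0_norm ?bump_ge0// bump_le.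
      rewrite bump_eq0 ?mul0r ?normr0//; move: xy; rewrite notin_setE /ball/= => /negP.
      rewrite -leNgt; apply: lt_le_trans.
      by rewrite /r -[ltLHS]mul1r ltr_pM2r ?invr_gt0 ?ltr0n// ltr1n.
  under eq_integral do rewrite EFinM.
  rewrite ge0_integralZl//; last 3 first.
  - exact: measurable_ball.
  - apply: measurable_funTS; apply/measurable_EFinP; exact: measurableT_comp.
  - by rewrite lee_fin divr_ge0// ltW.
  rewrite muleA inver mulrn_eq0/= gt_eqF//= -EFinM.
  rewrite (_ : 4 / Z * (r n *+ 2)^-1 = n.+1%:R / Z)//.
  rewrite /r -mulr_natr; field.
  by rewrite gt_eqF//= nat1r pnatr_eq0.
have rc : r n @[n --> \oo] --> (0 : R)^'+.
  move=> P [e /= e0 eP]; have /cvgrPdist_lt/(_ _ e0) := cvg_div_nat (2 : R).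
  by apply: filterS => n rn; apply: eP => //; exact: r0.
have davg0 : davg f y (r n) @[n --> \oo] --> 0%E by exact: (cvg_comp _ _ rc ly).
have e0 : ((4 / Z)%:E * davg f y (r n))%E @[n --> \oo] --> 0%E.
  by rewrite -(mule0 (4 / Z)%:E); apply: cvgeZl.
apply/subr_cvg0; apply: norm_cvg0.
have H : (`|Rint (fun x => bump n (y - x) * f x) - f y|)%:E @[n --> \oo] --> 0%:E.
  apply: (@squeeze_cvge _ _ _ _ (fun _ => 0%E) _ _ _ _ _ e0); last exact: cvg_cst.
  by apply: nearW => n; rewrite bd andbT lee_fin.
exact: (fine_cvg H).
Qed.

Lemma L2_locally_integrable (f : R -> R) : measurable_fun setT f ->
  intb (fun x => f x ^+ 2) -> locally_integrable setT f.
Proof.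
move=> mf i2; split => //; first exact: openT.
move=> K _ cK; have mK := compact_measurable cK.
apply: (@le_lt_trans _ _ (\int[mu]_(x in K) (1 + f x ^+ 2)%:E)%E).
  apply: ge0_le_integral => //.
  - by apply: measurable_funTS; apply/measurable_EFinP; apply: measurableT_comp.
  - apply: measurable_funTS; apply/measurable_EFinP; apply: measurable_funD => //.
    exact: measurable_funX.
  - move=> x _; rewrite lee_fin -(real_normK (num_real (f x))).
    by have := sqr_ge0 (`|f x| - 1); nra.
under eq_integral do rewrite EFinD.
rewrite ge0_integralD//; last 2 first.
- by move=> x _; rewrite lee_fin sqr_ge0.
- by apply: measurable_funTS; apply/measurable_EFinP; exact: measurable_funX.
rewrite integral_cst// mul1e lte_add_pinfty ?compact_finite_measure//.
apply: (@le_lt_trans _ _ (\int[mu]_x (f x ^+ 2)%:E)%E).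
  apply: ge0_subset_integral => //.
  - by apply/measurable_EFinP; exact: measurable_funX.
  - by move=> x _; rewrite lee_fin sqr_ge0.
by rewrite -EFin_Rint// ltry.
Qed.

Lemma cn_L2_Re F : L2 F -> intb (fun x => Re (F x) ^+ 2) /\ intb (fun x => Im (F x) ^+ 2).
Proof.
move=> /L2P[[mr mi] i]; split; apply: (intb_le _ i); try exact: measurable_funX.
  by move=> x; rewrite ger0_norm ?sqr_ge0// cn_sqr lerDl sqr_ge0.
by move=> x; rewrite ger0_norm ?sqr_ge0// cn_sqr lerDr sqr_ge0.
Qed.

Section Plancherel.
Variables (h g : R -> R[i]).
Hypotheses (Lh : L2 h) (hg : IsInvFT h g).

Let rho n (x : R) : R[i] := (bump n x)%:C.
Let srho n : schwartz (rho n). Proof. exact/schwartz_real/schwartzR_bump. Qed.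
Let mrho n : cmeas (rho n). Proof. exact: schwartz_meas. Qed.
Let crho n : exists c, forall x, cn (rho n x) <= c * w x.
Proof.
by have [c _ rc] := schwartz_le_w 1 (srho n); exists c => x; have := rc x; rewrite expr1.
Qed.

Let H n := cconv (rho n) h.
(** The truncation gives compact support, so that mollifying once more produces a test function; the
    conjugate makes [H n * q n] equal to [|q n|^2]. *)
Let q n (y : R) : R[i] := (\1_`[- n%:R, n%:R] y)%:C * conjc (H n y).

Let LH n : L2 (H n). Proof. have [c rc] := crho n; exact: (cconv_L2 (mrho n) rc Lh). Qed.

Let ind01 n (y : R) : cn ((\1_`[- n%:R, n%:R] y)%:C : R[i]) <= 1.
Proof. by rewrite cn_real ger0_norm ?indicE// lern1 leq_b1. Qed.

Let mq n : cmeas (q n).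
Proof.
by apply: cmeasM; [exact: cmeas_real|apply: cmeasJ; case/L2P: (LH n)].
Qed.

Let qH n y : cn (q n y) <= cn (H n y).
Proof. by rewrite cnM cnJ ler_piMl ?cn_ge0. Qed.

Let Lq n : L2 (q n).
Proof.
have /L2P[mH iH] := LH n; apply/L2P; split; first exact: mq.
apply: (intb_le _ iH); first by apply: measurable_funX; exact: cmeas_cn.
by move=> x; rewrite ger0_norm ?sqr_ge0// lerXn2r ?nnegrE ?cn_ge0.
Qed.

Let q0 n y : n%:R < `|y| -> q n y = 0.
Proof.
move=> yn; rewrite /q indicE memNset/= ?in_itv/=; first exact: mul0r.
by move=> /andP[a b]; move: yn; rewrite ltNge ler_norml a b.
Qed.

Let iq n : cI (q n).
Proof.
have /L2P[_ i] := Lq n; have ii : intb (fun y : R => \1_`[- n%:R, n%:R] y : R).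
  exact: integrable_indic_itv.
apply: (@cI_le _ _ (fun y => \1_`[- n%:R, n%:R] y + cn (q n y) ^+ 2)) => //; first exact: intbD.
move=> y; have [yn|yn] := ltP n%:R `|y|.
  by rewrite q0// cn0 expr0n addr0 indicE.
rewrite indicE mem_set/= ?in_itv/= -?ler_norml//.
by have := sqr_ge0 (cn (q n y) - 1); have := cn_ge0 (q n y); nra.
Qed.

Let T n := Rint (fun y => cn (q n y) ^+ 2).
(** The adjoint mollification of [q n]: pairing [H n] with [q n] amounts to pairing [h] with
    [u n]. *)
Let u n y := cint (fun x => rho n (x - y) * q n x).

Let schwartz_u n : schwartz (u n).
Proof.
have [ir ii] := iq n.
have k (f : R -> R) : intb f -> (forall x, n%:R < `|x| -> f x = 0) ->
   schwartzR (fun y => Rint (fun x => bump n (x - y) * f x)).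
  move=> fi f0; apply: (schwartzR_mollify (schwartzR_bump n) fi _ f0); exact: bump_eq0.
have e1 : (fun y => Re (u n y)) = (fun y => Rint (fun x => bump n (x - y) * Re (q n x))).
  by apply/funext => y; apply: eq_Rintegral => x _; rewrite Re_rmul.
have e2 : (fun y => Im (u n y)) = (fun y => Rint (fun x => bump n (x - y) * Im (q n x))).
  by apply/funext => y; apply: eq_Rintegral => x _; rewrite Im_rmul.
by split; rewrite ?e1 ?e2; apply: k => // x xn; rewrite q0.
Qed.

Let ib n : intb (bump n : R -> R). Proof. exact/schwartzR_int/schwartzR_bump. Qed.

(** Young's inequality for a kernel of mass 1. *)
Let u_le_T n : Rint (fun y => cn (u n y) ^+ 2) <= T n.
Proof.
pose p (x : R) := bump n (- x).
have ip : intb p := intb_opp (ib n).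
have mcq : measurable_fun setT (fun y => cn (q n y)) by exact: cmeas_cn.
have /L2P[_ i2] := Lq n.
have p0 x : 0 <= p x by exact: bump_ge0.
have pM x : p x <= n.+1%:R / Rint (@bump0 R) by exact: bump_le.
have cq0 x : 0 <= cn (q n x) by exact: cn_ge0.
have [i3 le3] := young (intb_meas ip) mcq p0 cq0 pM ip i2.
apply: le_trans (_ : _ <= Rint (fun y => conv p (fun y => cn (q n y)) y ^+ 2)) _.
  apply: Rint_le => //; first exact: schwartz_sqr.
  move=> y; rewrite lerXn2r ?nnegrE ?cn_ge0 ?conv_ge0//.
  have ii := conv_int mcq p0 cq0 pM ip i2 y.
  have E x : cn (rho n (x - y) * q n x) = p (y - x) * cn (q n x).
    by rewrite cnM cn_real ger0_norm ?bump_ge0// /p opprB.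
  have iu : cI (fun x => rho n (x - y) * q n x).
    apply: (cI_le _ ii); last by move=> x; rewrite E.
    apply: cmeasM => //; apply: (cmeas_comp (F := rho n) (h := fun x : R => x - y)) => //.
    exact: measurable_funB.
  apply: le_trans (cint_norm iu) _.
  by under eq_Rintegral do rewrite E.
apply: le_trans le3 _.
by rewrite /p Rint_opp// bump_mass expr1n mul1r.
Qed.

(** By duality the pairing of [h] with [u n] is that of [g] with [phi], the reflected transform of
    [u n]. As [||phi|| = ||u n|| <= ||q n||], the inequality [2 a b <= a^2 + b^2] gives
    [T <= ||g||^2 / 2 + T / 2], and the last term is absorbed on the left. *)
Let T_le n : T n <= Rint (fun x => cn (g x) ^+ 2).
Proof.
have [Lg dual] := hg; have su := schwartz_u n; have sU := schwartz_invFT su.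
pose phi x := invFT (u n) (- x); have sphi : schwartz phi by exact: schwartz_opp.
have [c rc] := crho n.
have TE : T n = Re (cint (fun x => H n x * q n x)).
  apply: eq_Rintegral => x _.
  rewrite /q mulrCA Re_rmul mul_conjc cnM cnJ cn_real exprMn /= indicE.
  by case: (_ \in _); rewrite ?normr1 ?normr0 ?expr1n ?expr0n.
have e : cint (fun x => H n x * q n x) = cint (fun x => g x * phi x).
  rewrite (cconv_swap (mrho n) rc Lh (iq n) (Lq n)) (dual _ sphi).
  by apply: eq_cint => x; rewrite (inversion x su).
have phiT : Rint (fun x => cn (phi x) ^+ 2) <= T n.
  rewrite (Rint_opp (f := fun x => cn (invFT (u n) x) ^+ 2)); last exact: schwartz_sqr.
  rewrite (plancherel su); exact: u_le_T.
have igp : cI (fun x => g x * phi x) by apply: L2_mul_cI => //; exact: schwartz_L2.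
have /L2P[mg ig] := Lg.
have i1 : intb (fun x => 2^-1 * cn (g x) ^+ 2) by exact: intbZ.
have i2 : intb (fun x => 2^-1 * cn (phi x) ^+ 2) by apply: intbZ; exact: schwartz_sqr.
have : T n <= Rint (fun x => 2^-1 * cn (g x) ^+ 2 + 2^-1 * cn (phi x) ^+ 2).
  rewrite TE e; apply: Rint_le; [by case: igp|exact: intbD|move=> x].
  apply: le_trans (ler_norm _) _; apply: le_trans (Re_le_cn _) _; rewrite cnM.
  by have := sqr_ge0 (cn (g x) - cn (phi x)); nra.
rewrite RintegralD// !RintegralZl//; last exact: schwartz_sqr.
by move: phiT; set A := Rint _; set B := Rint _; lra.
Qed.

(** At a common Lebesgue point [y] of the real and imaginary parts of [h] the mollifications
    converge, and the truncation is inactive once [n >= |y|]. *)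
Let cvg_q : {ae mu, forall x, (cn (q n x) ^+ 2)%:E @[n --> \oo] --> (cn (h x) ^+ 2)%:E}.
Proof.
have /L2P[[mr mi] ih] := Lh.
have [ir2 ii2] := cn_L2_Re Lh.
have := lebesgue_differentiation (L2_locally_integrable mr ir2).
have := lebesgue_differentiation (L2_locally_integrable mi ii2).
apply: (@filterS2 _ _ (ae_filter_ringOfSetsType mu)) => y Ly1 Ly2; apply: cvg_EFin; first exact: nearW.
have ci n : cI (fun x => rho n (y - x) * h x).
  have [c rc] := crho n; exact: (cconv_int (mrho n) rc Lh y).
have E1 n : (fun x => Re (rho n (y - x) * h x)) = (fun x => bump n (y - x) * Re (h x)).
  by apply/funext => x; rewrite Re_rmul.
have E2 n : (fun x => Im (rho n (y - x) * h x)) = (fun x => bump n (y - x) * Im (h x)).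
  by apply/funext => x; rewrite Im_rmul.
have c1 : Re (H n y) @[n --> \oo] --> Re (h y).
  rewrite (_ : (fun n => Re (H n y)) = (fun n => Rint (fun x => bump n (y - x) * Re (h x))));
    last by apply/funext => n; rewrite -E1.
  apply: lebesgue_pt_mollify => // n; by have [+ _] := ci n; rewrite E1.
have c2 : Im (H n y) @[n --> \oo] --> Im (h y).
  rewrite (_ : (fun n => Im (H n y)) = (fun n => Rint (fun x => bump n (y - x) * Im (h x))));
    last by apply/funext => n; rewrite -E2.
  apply: lebesgue_pt_mollify => // n; by have [_ +] := ci n; rewrite E2.
have c3 : Re (H n y) ^+ 2 + Im (H n y) ^+ 2 @[n --> \oo] --> cn (h y) ^+ 2.
  by rewrite cn_sqr; apply: cvgD; rewrite !expr2; under eq_fun do rewrite expr2; apply: cvgM.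
apply: cvg_trans c3; apply: near_eq_cvg; near=> n.
have E : cn (q n y) ^+ 2 = Re (H n y) ^+ 2 + Im (H n y) ^+ 2.
  rewrite -cn_sqr /q cnM cnJ cn_real indicE mem_set ?normr1 ?mul1r//=.
  by rewrite in_itv/= -ler_norml; near: n; exact: nbhs_infty_ger.
by first [exact: E | exact: esym E].
Unshelve. all: by end_near. Qed.

(** Fatou's lemma along [cvg_q], with the uniform bound [T_le]. *)
Lemma plancherel_le : Rint (fun x => cn (h x) ^+ 2) <= Rint (fun x => cn (g x) ^+ 2).
Proof.
have /L2P[mh ih] := Lh.
have m2 n : measurable_fun setT (fun x => (cn (q n x) ^+ 2)%:E).
  by apply/measurable_EFinP; apply: measurable_funX; exact: cmeas_cn.
have p2 n (x : R) : setT x -> (0 <= (cn (q n x) ^+ 2)%:E)%E by move=> _; rewrite lee_fin sqr_ge0.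
have F := fatou mu measurableT m2 p2.
rewrite -lee_fin (EFin_Rint ih).
apply: (@le_trans _ _ (\int[mu]_x limn_einf (fun n => (cn (q n x) ^+ 2)%:E))%E).
  apply: ae_ge0_le_integral => //.
  - by move=> x _; rewrite lee_fin sqr_ge0.
  - by apply/measurable_EFinP; apply: measurable_funX; exact: cmeas_cn.
  - move=> x _; rewrite limn_einf_lim; apply: lime_ge; first exact: is_cvg_einfs.
    by apply: nearW => n; apply: le_ereal_inf_tmp => _ [m _ <-]; rewrite lee_fin sqr_ge0.
  - apply: (emeasurable_fun_cvg (fun n x => einfs (fun n => (cn (q n x) ^+ 2)%:E) n)).
      exact: measurable_fun_einfs.
    by move=> x _; rewrite limn_einf_lim; exact: is_cvg_einfs.
  - by apply: (@filterS _ _ (ae_filter_ringOfSetsType mu) _ _ _ cvg_q) => x /cvg_limn_einf_sup[-> _].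
apply: le_trans F _; rewrite limn_einf_lim; apply: lime_le; first exact: is_cvg_einfs.
apply: nearW => n; apply: (@le_trans _ _ (\int[mu]_x (cn (q n x) ^+ 2)%:E)%E).
  by apply: ereal_inf_lbound; exists n => /=.
by have /L2P[_ i] := Lq n; rewrite -EFin_Rint// lee_fin T_le.
Qed.

End Plancherel.

End Mollification.

(** * Growth of admissible weights and weighted series *)

Section Growth.
Context {R : realType}.
Local Notation mu := (@lebesgue_measure R).
Variables (v : R -> R) (C : R).
Hypotheses (mv : measurable_fun setT v) (v1 : forall x, 1 <= v x)
  (vC : forall s t, v (s + t) <= C * (v s + v t)).

Let A (n : nat) : set R := `[-1, 1] `&` v @^-1` `]-oo, n%:R].

Let mA n : measurable (A n).
Proof.
apply: measurableI; first exact: measurable_itv.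
by rewrite -[X in measurable X]setTI; apply: mv => //; exact: measurable_itv.
Qed.

Let i1 (a b : R) : intb (fun x : R => \1_`[a, b] x : R).
Proof. exact: integrable_indic_itv. Qed.

Let A_le n x : \1_(A n) x <= \1_`[-1, 1] x :> R.
Proof.
rewrite !indicE; case: (boolP (x \in A n)) => // /set_mem[xI _].
by rewrite mem_set.
Qed.

Let iA n : intb (fun x : R => \1_(A n) x : R).
Proof.
apply: (intb_le _ (i1 (-1) 1)); first exact: measurable_indic.
by move=> x; rewrite ger0_norm ?A_le// indicE.
Qed.

Lemma Rint_indic_itv (a b : R) : a <= b -> Rint (fun x : R => \1_`[a, b] x : R) = b - a.
Proof.
move=> ab; rewrite /Rintegral integral_indic//= setIT lebesgue_measure_itv/= lte_fin.
have [->|ab'] := eqVneq a b; first by rewrite ltxx subrr.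
by rewrite lt_neqAle ab' ab.
Qed.

(** The sets [A n] increase to [[-1, 1]], of measure 2. The threshold is half the length of
    [[-3/2, 3/2]], an interval that contains [A n] and, for [|x| <= 1/2], also [x - A n]. *)
Lemma v_large_sublevel : exists n, 3 / 2 < Rint (fun x : R => \1_(A n) x : R).
Proof.
have [|||_ h] := @Rint_dct _ (fun n (x : R) => \1_(A n) x : R) (fun x => \1_`[-1, 1] x) (fun x => \1_`[-1, 1] x) _ _ (i1 _ _).
- by move=> n; exact: measurable_indic.
- move=> x; apply: cvg_near_cst; near=> n; rewrite !indicE.
  have vn : v x <= n%:R by near: n; exact: nbhs_infty_ger.
  rewrite /A in_setI [X in _ && X](_ : _ = true) ?andbT//.
  by apply/mem_set; rewrite /= in_itv.
- by move=> n x; rewrite ger0_norm ?A_le// indicE.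
rewrite Rint_indic_itv in h; last by lra.
have /(cvgr_gt _ h) [N _ NP] : 3 / 2 < 1 - -1 :> R by lra.
by exists N; exact: (NP N (leqnn N)).
Unshelve. all: by end_near. Qed.

(* Steinhaus: the sublevel set [A n] and its reflection [x - A n] both have more than
   half of the measure of [-3/2, 3/2], hence they meet. *)
Lemma v_locally_bounded : exists2 K : R, 0 < K & forall x, `|x| <= 1 / 2 -> v x <= K.
Proof.
have [n An] := v_large_sublevel.
have C0 : 0 <= C by have := vC 0 0; have := v1 (0 + 0); have := v1 0; nra.
(* If [s] and [x - s] both lie in [A n], then [v x <= C (v s + v (x - s)) <= 2 C n]; the summand 1
   keeps the constant positive. *)
exists (2 * C * n%:R + 1); first by rewrite ltr_wpDl// mulr_ge0// mulr_ge0.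
move=> x x2; apply: contrapT => /negP; rewrite -ltNge => vx.
have disj s : \1_(A n) s + \1_(A n) (x - s) <= \1_`[-(3 / 2), 3 / 2] s :> R.
  rewrite !indicE; case: (boolP (s \in A n)) => [/set_mem[]|_].
    rewrite /= !in_itv/= => /andP[s1 s2] vs.
    rewrite [(s \in _)%:R](_ : _ = 1); last by rewrite mem_set//= in_itv/=; lra.
    case: (boolP (x - s \in A n)) => [/set_mem[_]|_]; last by rewrite addr0.
    rewrite /= in_itv/= => vxs; exfalso.
    have := vC s (x - s); rewrite addrC subrK => h.
    have : C * (v s + v (x - s)) <= C * (n%:R + n%:R) by rewrite ler_wpM2l// lerD.
    by lra.
  rewrite add0r; case: (boolP (x - s \in A n)) => [/set_mem[]|_]; last by case: (_ \in _).
  rewrite /= !in_itv/= => /andP[s1 s2] _; rewrite mem_set//= in_itv/=.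
  by move: x2; rewrite ler_norml => /andP[? ?]; lra.
have := Rint_le (intbD (iA n) (intb_reflect x (iA n))) (i1 (- (3 / 2)) (3 / 2)) disj.
rewrite RintegralD//; last exact: (intb_reflect x (iA n)).
rewrite (Rint_reflect x (iA n)) Rint_indic_itv; last by lra.
by lra.
Qed.

(** Each doubling of the argument costs a factor [2 C <= 2^D]; after [m] doublings from the origin
    the bound is [K (2^m)^D], a power of the size of the argument. *)
Lemma v_poly_bound : exists K : R, exists D : nat, 0 < K /\ forall x, v x <= K * (1 + x ^+ 2) ^+ D.
Proof.
have [K K0 vK] := v_locally_bounded.
have C0 : 0 <= C by have := vC 0 0; have := v1 (0 + 0); have := v1 0; nra.
have [D CD] : exists D, 2 * C <= 2 ^+ D.
  have [m _ mP] := nbhs_infty_ger (2 * C); exists m.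
  apply: le_trans (mP m (leqnn m)) _.
  by rewrite -natrX ler_nat ltnW// ltn_expl.
have db m x : `|x| <= 2 ^+ m / 2 -> v x <= K * (2 ^+ D) ^+ m.
  elim: m x => [|m IH] x; first by rewrite !expr0 mulr1; exact: vK.
  move=> xm; have /IH h : `|x / 2| <= 2 ^+ m / 2.
    by rewrite normrM [`|2^-1|]ger0_norm// ler_pM2r// (le_trans xm)// exprS mulrAC mulfV ?mul1r.
  have := vC (x / 2) (x / 2); have -> : x / 2 + x / 2 = x by lra.
  move=> /le_trans; apply; set E := 2 ^+ D ^+ m in h *.
  have vx0 : 0 <= v (x / 2) by apply: le_trans (v1 _).
  have -> : C * (v (x / 2) + v (x / 2)) = 2 * C * v (x / 2) by ring.
  rewrite exprS mulrCA -/E; apply: (@le_trans _ _ (2 ^+ D * v (x / 2))); first by rewrite ler_wpM2r.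
  by rewrite ler_wpM2l ?exprn_ge0.
exists (K * 4 ^+ D), D; split; first by rewrite mulr_gt0 ?exprn_gt0.
(* [m] is the least exponent with [|x| <= 2^m / 2]: by minimality [2^m < 4 |x|] unless [m = 0],
   which keeps [2^m] comparable with [1 + x^2]. *)
move=> x; have [m /andP[m1 m2]] : exists m, (`|x| <= 2 ^+ m / 2) && (2 ^+ m <= 4 * (1 + x ^+ 2)).
  have ex : exists m, `|x| <= 2 ^+ m / 2.
    have [m _ mP] := nbhs_infty_ger (2 * `|x|); exists m.
    rewrite ler_pdivlMr// mulrC (le_trans (mP m (leqnn m)))//.
    by rewrite -natrX ler_nat ltnW// ltn_expl.
  case: (ex_minnP ex) => m xm mmin; exists m; rewrite xm/=.
  have x0 := sqr_ge0 x; case: m xm mmin => [|m] xm mmin; first by rewrite expr0; lra.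
  have : 2 ^+ m / 2 < `|x| by rewrite ltNge; apply/negP => /mmin; rewrite ltnn.
  rewrite exprS; have := sqr_ge0 (`|x| - 1); rewrite -(real_normK (num_real x)) in x0 *.
  by move=> h1 h2; nra.
apply: le_trans (db _ _ m1) _; rewrite -mulrA ler_pM2l// -exprMn exprAC.
by rewrite lerXn2r ?nnegrE ?exprn_ge0// mulr_ge0// addr_ge0 ?sqr_ge0.
Qed.

End Growth.

(** * Decay of the transforms of products with a translated window *)

Section KernelDecay.
Context {R : realType}.
Implicit Types (psi rho : R -> R[i]).

Definition window psi rho (s : R) : R -> R[i] := fun x => psi x * rho (x - s).

Lemma schwartz_window psi rho s : schwartz psi -> schwartz rho -> schwartz (window psi rho s).
Proof. by move=> sp sr; apply: schwartzM => //; exact: schwartz_shift. Qed.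

Lemma window_bound psi rho : schwartz psi -> schwartz rho ->
  exists2 K : R, 0 <= K & forall s x, cn (window psi rho s x) <= K * w s * w x.
Proof.
move=> /(schwartz_le_w 2)[M M0 pM] /(schwartz_le_w 1)[N N0 rN].
exists (2 * M * N) => [|s x]; first by rewrite !mulr_ge0.
rewrite /window cnM; apply: (@le_trans _ _ ((M * w x ^+ 2) * (N * w (x - s)))).
  by rewrite ler_pM ?cn_ge0//; have := rN (x - s); rewrite expr1.
have -> : M * w x ^+ 2 * (N * w (x - s)) = M * N * w x * (w x * w (x - s)) by ring.
have -> : 2 * M * N * w s * w x = M * N * w x * (2 * w s) by ring.
by rewrite ler_wpM2l ?peetre// !mulr_ge0// w_ge0.
Qed.

(** A factor [xi] costs one derivative of the product, which is again a sum of two windows, for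
    [psi', rho] and for [psi, rho']. The induction on [j] therefore runs over all pairs; the factor
    [w s] comes from [window_bound] at its base. *)
Lemma invFT_window_decay j psi rho : schwartz psi -> schwartz rho ->
  exists2 K : R, 0 <= K & forall s xi, `|xi| ^+ j * cn (invFT (window psi rho s) xi) <= K * w s.
Proof.
elim: j psi rho => [|j IH] psi rho sp sr.
  have [K K0 pK] := window_bound sp sr; exists (K * Rint w) => [|s xi].
    by rewrite mulr_ge0//; apply: Rintegral_ge0 => x _; exact: w_ge0.
  have sw := schwartz_window s sp sr; have iw := schwartz_cI sw.
  rewrite expr0 mul1r (le_trans (cn_invFT xi iw))// mulrAC -RintegralZl//; last exact: w_int.
  by apply: Rint_le; [exact: cI_cn|apply: intbZ; exact: w_int|exact: pK].
have [psi' sp' dp] := schwartz_cderivative sp; have [rho' sr' dr] := schwartz_cderivative sr.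
have [K1 K10 h1] := IH _ _ sp' sr; have [K2 K20 h2] := IH _ _ sp sr'.
exists (K1 + K2) => [|s xi]; first exact: addr_ge0.
have sw := schwartz_window s sp sr.
have sw1 := schwartz_window s sp' sr; have sw2 := schwartz_window s sp sr'.
have dw : cderivative_of (window psi rho s) (fun x => window psi' rho s x + window psi rho' s x).
  exact: cderivativeM dp (cderivative_shift (- s) dr).
have e := invFT_derivative xi sw dw (schwartzD sw1 sw2).
have : `|xi| * cn (invFT (window psi rho s) xi) <=
    cn (invFT (window psi' rho s) xi) + cn (invFT (window psi rho' s) xi).
  apply: le_trans (cnD _ _); rewrite -(invFT_D xi (schwartz_cI sw1) (schwartz_cI sw2)) e.
  rewrite cnM cnN ler_wpM2r ?cn_ge0// cnE /= expr0n/= add0r sqrtr_sqr !normrM.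
  by rewrite ler_peMl// (ger0_norm (pi_ge0 R)) ger0_norm//; have := pi_ge2 R; lra.
move=> h; rewrite exprSr -mulrA.
apply: le_trans (ler_wpM2l (exprn_ge0 j (normr_ge0 xi)) h) _.
by rewrite mulrDr mulrDl lerD.
Qed.

(** The decay of orders 0 and [2 (D + 1)] together controls [(1 + xi^2)^(D + 1)]: [D] of these
    powers absorb the growth of [v], the last one leaves [w xi]. *)
Lemma invFT_window_bound psi rho (v : R -> R) (K0 : R) (D : nat) :
  0 < K0 -> (forall x, 0 <= v x) -> (forall x, v x <= K0 * (1 + x ^+ 2) ^+ D) ->
  schwartz psi -> schwartz rho ->
  exists2 K : R, 0 <= K & forall s xi, v xi * cn (invFT (window psi rho s) xi) <= K * w s * w xi.
Proof.
move=> K00 v0 vK sp sr.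
have [M M0 hM] := invFT_window_decay 0 sp sr.
have [N N0 hN] := invFT_window_decay (2 * D.+1) sp sr.
exists (K0 * (2 ^+ D.+1 * (M + N))) => [|s xi].
  by rewrite mulr_ge0 ?(ltW K00)// mulr_ge0 ?exprn_ge0// addr_ge0.
set z := cn _; have z0 : 0 <= z by exact: cn_ge0.
rewrite {2}/w ler_pdivlMr ?w_den_gt0//.
apply: (@le_trans _ _ (K0 * ((1 + xi ^+ 2) ^+ D.+1 * z))).
  have := ler_wpM2r (mulr_ge0 z0 (ltW (w_den_gt0 xi))) (vK xi).
  have -> : (1 + xi ^+ 2) ^+ D.+1 = (1 + xi ^+ 2) ^+ D * (1 + xi ^+ 2) by rewrite exprSr.
  by congr (_ <= _); ring.
rewrite -!mulrA ler_pM2l//.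
apply: (@le_trans _ _ (2 ^+ D.+1 * (1 + `|xi| ^+ (2 * D.+1)) * z)).
  rewrite ler_wpM2r//; have := ler_expD D.+1 ler01 (sqr_ge0 xi).
  by rewrite expr1n exprM real_normK ?num_real.
rewrite -mulrA ler_wpM2l ?exprn_ge0// mulrDl mul1r mulrDl lerD//.
  by have := hM s xi; rewrite expr0 mul1r.
exact: hN.
Qed.

End KernelDecay.

(** * Series of functions with summable weighted norms *)

Section Superposition.
Context {R : realType}.
Local Notation mu := (@lebesgue_measure R).

Lemma Rint_fatou (s_ : nat -> R -> R) (s : R -> R) (B : R) :
  (forall n, intb (s_ n)) -> (forall n x, 0 <= s_ n x) ->
  (forall x, s_ n x @[n --> \oo] --> s x) -> (forall n, Rint (s_ n) <= B) ->
  intb s /\ Rint s <= B.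
Proof.
move=> is_ s0 ss sB.
have m_ n : measurable_fun setT (fun x => (s_ n x)%:E) by exact: (EFin_meas (intb_meas (is_ n))).
have p_ n (x : R) : setT x -> (0 <= (s_ n x)%:E)%E by move=> _; rewrite lee_fin.
have ms : measurable_fun setT s.
  by apply: (measurable_fun_cvg (h := s_)) => // n; exact: intb_meas.
have sge0 x : 0 <= s x.
  rewrite -(cvg_lim (@Rhausdorff R) (ss x)); apply: limr_ge; last exact: nearW.
  by apply/cvg_ex; exists (s x).
have le : (\int[mu]_x (s x)%:E <= B%:E)%E.
  have F := fatou mu measurableT m_ p_.
  apply: le_trans (_ : _ <= \int[mu]_x limn_einf (fun n => (s_ n x)%:E))%E _.
    rewrite le_eqVlt; apply/orP; left; apply/eqP; apply: eq_integral => x _.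
    by have /cvg_limn_einf_sup[-> _] : (s_ n x)%:E @[n --> \oo] --> (s x)%:E
      by apply: cvg_EFin; [exact: nearW|exact: ss].
  apply: le_trans F _; rewrite limn_einf_lim; apply: lime_le; first exact: is_cvg_einfs.
  apply: nearW => n; apply: (@le_trans _ _ (\int[mu]_x (s_ n x)%:E)%E).
    by apply: ereal_inf_lbound; exists n => /=.
  by rewrite -EFin_Rint// lee_fin.
have i := intb_ge0P ms sge0 le.
by split => //; rewrite -lee_fin EFin_Rint.
Qed.

(** Cauchy-Schwarz with weights [c k]. For terms whose squares integrate to at most [c k ^+ 2 * B],
    the second factor integrates to at most [B] times the sum of the [c k], whence the total
    [a ^+ 2 * B] below. *)
Lemma weighted_sum_sqr n (c x_ : nat -> R) : (forall k, 0 < c k) ->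
  (\sum_(k < n) x_ k) ^+ 2 <= (\sum_(k < n) c k) * (\sum_(k < n) (c k)^-1 * x_ k ^+ 2).
Proof.
move=> c0; apply: quadratic_discriminant; first by apply: sumr_ge0 => k _; exact: ltW.
move=> l; rewrite !mulr_sumr -big_split/=; apply: ler_sum => k _.
have := c0 k; set a := c k; set y := x_ k => a0.
rewrite -subr_ge0 (_ : _ - _ = a^-1 * (l * a - y) ^+ 2); last by field; rewrite gt_eqF.
by rewrite mulr_ge0 ?sqr_ge0// invr_ge0 ltW.
Qed.

Section Series.
Variables (c : nat -> R) (a : R) (v : R -> R) (B : R) (f_ : nat -> R -> R[i]).
Hypotheses (c0 : forall k, 0 < c k) (ca : forall n, \sum_(k < n) c k <= a).
Hypotheses (mv : measurable_fun setT v) (v1 : forall x, 1 <= v x).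
Hypotheses (mf : forall k, cmeas (f_ k)).
Hypotheses (if2 : forall k, intb (fun x => (v x * cn (f_ k x)) ^+ 2)).
Hypotheses (f2B : forall k, Rint (fun x => (v x * cn (f_ k x)) ^+ 2) <= c k ^+ 2 * B).
Hypotheses (fL : forall x, exists L : R, forall k, cn (f_ k x) <= c k * L).

Let S n x := \sum_(k < n) (v x * cn (f_ k x)).
Let v0 x : 0 <= v x. Proof. exact: le_trans (v1 x). Qed.
Let S0 n x : 0 <= S n x.
Proof. by apply: sumr_ge0 => k _; rewrite mulr_ge0// cn_ge0. Qed.
Let a0 : 0 <= a. Proof. by have := ca 0; rewrite big_ord0. Qed.
Let B0 : 0 <= B.
Proof.
have := f2B 0; rewrite -(pmulr_rge0 _ (exprn_gt0 2 (c0 0))); apply: le_trans.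
by apply: Rintegral_ge0 => x _; rewrite sqr_ge0.
Qed.

Let mS n : measurable_fun setT (S n).
Proof.
elim: n => [|n IH]; rewrite /S.
  by under eq_fun do rewrite big_ord0; exact: measurable_cst.
under eq_fun do rewrite big_ord_recr/=.
by apply: measurable_funD => //; apply: measurable_funM => //; exact: cmeas_cn.
Qed.

Let T n x := \sum_(k < n) ((c k)^-1 * (v x * cn (f_ k x)) ^+ 2).
Let intT n : intb (T n) /\ Rint (T n) <= (\sum_(k < n) c k) * B.
Proof.
elim: n => [|n [IH1 IH2]]; rewrite /T.
  have -> : (fun x : R => \sum_(k < 0) ((c k)^-1 * (v x * cn (f_ k x)) ^+ 2)) = fun _ => 0.
    by apply/funext => x; rewrite big_ord0.
  by split; [exact: integrable0|rewrite big_ord0 mul0r /Rintegral integral0].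
have -> : (fun x : R => \sum_(k < n.+1) ((c k)^-1 * (v x * cn (f_ k x)) ^+ 2)) =
    fun x => T n x + (c n)^-1 * (v x * cn (f_ n x)) ^+ 2.
  by apply/funext => x; rewrite big_ord_recr.
split; first by apply: intbD => //; exact: intbZ.
rewrite RintegralD//; last exact: intbZ.
rewrite RintegralZl// big_ord_recr/= mulrDl lerD//.
rewrite -ler_pdivlMl ?invr_gt0// invrK mulrA -expr2; exact: f2B.
Qed.

Let S2 n : intb (fun x => S n x ^+ 2) /\ Rint (fun x => S n x ^+ 2) <= a ^+ 2 * B.
Proof.
have [iT lT] := intT n; set A := \sum_(k < n) c k in lT.
have ST x : S n x ^+ 2 <= A * T n x 
  by exact: (weighted_sum_sqr n (fun k => v x * cn (f_ k x)) c0).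
have i : intb (fun x => S n x ^+ 2).
  apply: (intb_le _ (intbZ A iT)); first exact: measurable_funX.
  by move=> x; rewrite ger0_norm ?sqr_ge0.
have A0 : 0 <= A by apply: sumr_ge0 => k _; exact: ltW.
split => //; apply: le_trans (Rint_le i (intbZ A iT) ST) _; rewrite RintegralZl//.
apply: le_trans (ler_wpM2l A0 lT) _.
by rewrite mulrA -expr2 ler_wpM2r// lerXn2r ?nnegrE//; exact: ca.
Qed.

Let X x := limn (fun n => S n x).

Let S_cvg x : S n x @[n --> \oo] --> X x.
Proof.
have [L fLx] := fL x.
apply: nondecreasing_is_cvgn.
  apply/nondecreasing_seqP => n; rewrite /S big_ord_recr/= lerDl.
  by rewrite mulr_ge0// cn_ge0.
exists (v x * (a * `|L|)) => _ [n _ <-]; rewrite /S -mulr_sumr ler_wpM2l//.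
apply: (@le_trans _ _ (\sum_(k < n) c k * `|L|)).
  apply: ler_sum => k _; apply: le_trans (fLx k) _.
  by rewrite ler_wpM2l ?(ltW (c0 _))// ler_norm.
by rewrite -mulr_suml ler_wpM2r.
Qed.

Let S_nd n x : S n x <= X x.
Proof.
apply: nondecreasing_cvgn_le; last by apply/cvg_ex; exists (X x); exact: S_cvg.
apply/nondecreasing_seqP => m; rewrite /S big_ord_recr/= lerDl.
by rewrite mulr_ge0// cn_ge0.
Qed.

Let X2 : intb (fun x => X x ^+ 2) /\ Rint (fun x => X x ^+ 2) <= a ^+ 2 * B.
Proof.
apply: (Rint_fatou (s_ := fun n x => S n x ^+ 2)).
- by move=> n; case: (S2 n).
- by move=> n x; rewrite sqr_ge0.
- move=> x; rewrite expr2; under eq_fun do rewrite expr2.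
  by apply: cvgM; exact: S_cvg.
- by move=> n; case: (S2 n).
Qed.

Let P n x := \sum_(k < n) f_ k x.

Let PS n x : cn (P n x) <= S n x.
Proof.
rewrite /P /S; elim: n => [|n IH]; first by rewrite !big_ord0 cn0.
rewrite !big_ord_recr/=; apply: le_trans (cnD _ _) _; rewrite lerD//.
by rewrite ler_peMl ?cn_ge0.
Qed.

(** [p] stands for the real or the imaginary part; the series converges absolutely, being dominated
    by the limit [X] of the sums of moduli. *)
Let part_cvg (p : R[i] -> R) (x : R) : (forall z, `|p z| <= cn z) ->
  (forall z z', p (z + z') = p z + p z') -> cvgn (fun n => p (P n x)).
Proof.
move=> pc pD.
have p0 : p 0 = 0 by have := pD 0 0; rewrite addr0; lra.
have E : (fun n => p (P n x)) = series (fun k => p (f_ k x)).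
  apply/funext => n; rewrite /series/= /P; elim: n => [|n IH].
    by rewrite big_ord0 big_geq.
  by rewrite big_ord_recr/= pD IH big_nat_recr.
rewrite E; apply: normed_cvg.
have -> : [normed series (fun k => p (f_ k x))] = fun n => \sum_(k < n) `|p (f_ k x)|.
  exact: (seriesEord (fun k => `|p (f_ k x)|)).
apply: nondecreasing_is_cvgn.
  by apply/nondecreasing_seqP => n; rewrite big_ord_recr/= lerDl.
exists (X x) => _ [n _ <-]; apply: le_trans (S_nd n x); apply: ler_sum => k _.
by apply: le_trans (pc _) _; rewrite ler_peMl ?cn_ge0.
Qed.

(** The pointwise bound [fL] gives a limit at every point, while the integral bounds pass to it by
    Fatou. The majorant [X] of all partial sums is returned as well, for the later use of dominated
    convergence in the duality identity. *)
Lemma weighted_series : exists (F : R -> R[i]) (X : R -> R),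
  [/\ cmeas F, forall x, ccvg (fun n => \sum_(k < n) f_ k x) (F x),
     intb (fun x => X x ^+ 2) /\ measurable_fun setT X,
     forall n x, cn (\sum_(k < n) f_ k x) <= X x &
     intb (fun x => (v x * cn (F x)) ^+ 2) /\
     Rint (fun x => (v x * cn (F x)) ^+ 2) <= a ^+ 2 * B].
Proof.
pose F x := limn (fun n => Re (P n x)) +i* limn (fun n => Im (P n x)).
have cF x : ccvg (fun n => P n x) (F x).
  have cr := @part_cvg (@Re R) x (@Re_le_cn R) (@ReD R).
  have ci := @part_cvg (@Im R) x (@Im_le_cn R) (@ImD R).
  split; [exact: cr|exact: ci].
have mP n : cmeas (P n) by exact: cmeas_sum.
have mF : cmeas F.
  split.
    apply: (measurable_fun_cvg (h := fun n x => Re (P n x))) => [n|x _]; first by case: (mP n).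
    by case: (cF x).
  apply: (measurable_fun_cvg (h := fun n x => Im (P n x))) => [n|x _]; first by case: (mP n).
  by case: (cF x).
have mX : measurable_fun setT X.
  by apply: (measurable_fun_cvg (h := S)) => // x _; exact: S_cvg.
exists F, X; split => //; first by split => //; case: X2.
- by move=> n x; apply: le_trans (PS n x) (S_nd n x).
- pose Q n x := (v x * cn (P n x)) ^+ 2.
  have mQ n : measurable_fun setT (Q n).
    by apply: measurable_funX; apply: measurable_funM => //; exact: cmeas_cn.
  have QS n x : Q n x <= S n x ^+ 2.
    rewrite lerXn2r ?nnegrE ?mulr_ge0 ?cn_ge0// /S -mulr_sumr ler_wpM2l//.
    rewrite /P; elim: n => [|n IH]; first by rewrite !big_ord0 cn0.
    by rewrite !big_ord_recr/=; apply: le_trans (cnD _ _) _; rewrite lerD.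
  have iQ n : intb (Q n).
    by apply: (intb_le _ (S2 n).1) => // x; rewrite ger0_norm ?sqr_ge0.
  apply: (Rint_fatou (s_ := Q)) => //.
  + by move=> n x; rewrite sqr_ge0.
  + move=> x; rewrite /Q; have [cr ci] := cF x.
    under eq_fun do rewrite exprMn cn_sqr; rewrite exprMn cn_sqr.
    apply: cvgM; first exact: cvg_cst.
    by apply: cvgD; rewrite expr2; under eq_fun do rewrite expr2; apply: cvgM.
  + by move=> n; apply: le_trans (Rint_le (iQ n) (S2 n).1 (QS n)) (S2 n).2.
Qed.

End Series.

End Superposition.

(** * Change of window *)

Section Partition.
Context {R : realType}.

(** A smooth function supported in [[-1, 1]], written as a difference so that the sum of its integer
    translates telescopes to 1. *)
Definition hat (y : R) : R := sstep (y + 1) - sstep y.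

Lemma hat_eq0 y : 1 <= `|y| -> hat y = 0.
Proof.
rewrite /hat ler_normr => /orP[y1|y1]; first by rewrite !sstep1 ?subrr//; lra.
by rewrite !sstep0 ?subrr//; lra.
Qed.

(** [rho] is [conjc eta / |eta|^2] cut off by [hat] near a point where [eta] does not vanish. *)
Lemma local_inverse (eta : R -> R[i]) : schwartz eta -> eta <> (fun _ => 0) ->
  exists x0 d : R, exists rho : R -> R[i], [/\ 0 < d, schwartz rho &
    forall x, rho x * eta x = (hat ((x - x0) / d))%:C].
Proof.
move=> seta eta0.
have [x0 ex0] : exists x0, eta x0 != 0.
  apply: contrapT => h; apply: eta0; apply/funext => x; apply/eqP.
  by apply/negP => ex; apply: h; exists x; apply/negP.
have [sr si] := seta.
pose e2 x := Re (eta x) * Re (eta x) + Im (eta x) * Im (eta x).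
have se2 : smoothR e2 by apply: smoothD; apply: smoothM; [case: sr|case: sr|case: si|case: si].
have e2E x : e2 x = cn (eta x) ^+ 2 by rewrite cn_sqr !expr2.
have e20 : 0 < e2 x0.
  by rewrite e2E exprn_gt0// lt_def cn_ge0 andbT; apply/eqP => /ComplexField.Normc.eq0_normc/eqP; exact/negP.
have /(_ x0) /cvgrPdist_lt /(_ _ e20) := smooth_continuous se2.
(* On the ball of radius [r] continuity keeps [e2] positive; half the radius puts the closed
   interval [|x - x0| <= d] inside this open ball. *)
move=> /nbhs_ballP[r /= r0 hr]; pose d := r / 2.
have d0 : 0 < d by rewrite divr_gt0.
have e2d x : `|(x - x0) / d| <= 1 -> 0 < e2 x.
  rewrite normrM normfV (gtr0_norm d0) ler_pdivrMr// mul1r => xd.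
  have /hr : ball x0 r x by rewrite /ball/= distrC (le_lt_trans xd)// /d; lra.
  by rewrite /= => /(le_lt_trans (ler_norm _)); lra.
pose y x := (x - x0) / d.
have yE : y = fun x => d^-1 * x + (- (x0 / d)) by apply/funext => x; rewrite /y; ring.
(* The two [omega] terms vanish for [|y x| <= 1], where [hat (y x)] lives, and their sum is positive
   elsewhere: [q] is a globally invertible substitute for [e2]. *)
pose q x := e2 x + (omega (y x - 1) + omega (-1 - y x)).
have sq : smoothR q.
  apply: (smoothD se2); apply: smoothD.
    have -> : (fun x => omega (y x - 1)) = fun x => omega (d^-1 * x + (- (x0 / d) - 1)).
      by apply/funext => x; congr omega; rewrite /y; ring.
    exact: smooth_omega.
  have -> : (fun x => omega (-1 - y x)) = fun x => omega (- d^-1 * x + (-1 + (x0 / d))).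
    by apply/funext => x; congr omega; rewrite /y; ring.
  exact: smooth_omega.
have q0 x : q x != 0.
  rewrite gt_eqF// /q; have e2x : 0 <= e2 x by rewrite e2E sqr_ge0.
  have := @omega_ge0 R (y x - 1); have := @omega_ge0 R (-1 - y x).
  have [/e2d|] := leP `|y x| 1; first by lra.
  by rewrite lter_normr => /orP[] h; [have := @omega_gt0 R (y x - 1)|have := @omega_gt0 R (-1 - y x)]; lra.
have shat : smoothR (fun x => hat (y x)).
  apply: smoothD; last apply: smoothN.
    have -> : (fun x => sstep (y x + 1)) = fun x => sstep (d^-1 * x + (- (x0 / d) + 1)).
      by apply/funext => x; congr sstep; rewrite /y; ring.
    by apply: smooth_affine; exact: smooth_sstep.
  by rewrite yE; apply: smooth_affine; exact: smooth_sstep.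
have sg : smoothR (fun x => hat (y x) * (q x)^-1) by exact: (smoothM shat (smoothV sq q0)).
exists x0, d, (fun x => (hat (y x) * (q x)^-1)%:C * conjc (eta x)); split; [exact: d0| |move=> x].
  have hat0 x : `|x0| + d < `|x| -> hat (y x) = 0.
    move=> xd; apply: hat_eq0; rewrite /y normrM normfV (gtr0_norm d0) ler_pdivlMr// mul1r.
    by have := ler_normD (x - x0) x0; rewrite subrK; lra.
  split; under eq_fun do [rewrite ?Re_rmul ?Im_rmul ReImE].
    apply: (@schwartz_compact _ _ (`|x0| + d)) => [|x /hat0 ->]; last by rewrite !mul0r.
    exact: (smoothM sg sr.1).
  apply: (@schwartz_compact _ _ (`|x0| + d)) => [|x /hat0 ->]; last by rewrite !mul0r.
  exact: (smoothM sg (smoothN si.1)).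
rewrite -mulrA [conjc _ * _]mulrC mul_conjc -e2E -rmorphM/=; congr _%:C.
have [y1|/ltW/hat_eq0] := leP `|y x| 1; last by rewrite /y => ->; rewrite !mul0r.
rewrite (_ : e2 x = q x) ?mulfVK//.
by move: y1; rewrite /q ler_norml => /andP[h1 h2]; rewrite !omega_eq0 ?addr0//; lra.
Qed.

(* The enumeration 0, -1, 1, -2, 2, ... of the integers. *)
Definition node (k : nat) : R := if odd k then - (k./2.+1)%:R else (k./2)%:R.

(** The first [2 m] nodes are the integers from [-m] to [m - 1], along which the differences
    defining [hat] telescope. *)
Lemma sum_hat_double m (y : R) :
  \sum_(k < m.*2) hat (y - node k) = sstep (y + m%:R + 1) - sstep (y - m%:R + 1).
Proof.
elim: m => [|m IH]; first by rewrite big_ord0 addr0 subr0 subrr.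
rewrite doubleS !big_ord_recr/= IH /node /= odd_double/= doubleK uphalf_double /hat -natr1.
have -> : y - (m%:R + 1) + 1 = y - m%:R by ring.
have -> : y - - (m%:R + 1) = y + (m%:R + 1) by ring.
by rewrite [y + m%:R + 1](_ : _ = y + (m%:R + 1)); ring.
Qed.

Lemma sum_hat (y : R) : \forall n \near \oo, \sum_(k < n) hat (y - node k) = 1.
Proof.
near=> n; have yn : `|y| + 2 <= (n./2)%:R.
  have : (2 * `|y| + 6)  <= n%:R by near: n; exact: nbhs_infty_ger.
  rewrite -{1}[n]odd_double_half natrD -mul2n natrM; case: (odd n) => h.
    by rewrite [true%:R](_ : _ = 1) in h => //; lra.
  by rewrite [false%:R](_ : _ = 0) in h => //; lra.
have y1 := ler_norm y; have y2 := ler_norm (- y); rewrite normrN in y2.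
have S2 : \sum_(k < (n./2).*2) hat (y - node k) = 1.
  by rewrite sum_hat_double sstep1 ?sstep0 ?subr0//; lra.
(* For odd [n] the one extra node [n./2] is too far from [y] to contribute. *)
rewrite -[n]odd_double_half; case: (odd n); last by rewrite add0n.
rewrite add1n big_ord_recr/= S2 hat_eq0 ?addr0// /node odd_double doubleK.
by rewrite ler_normr; apply/orP; right; lra.
Unshelve. all: by end_near. Qed.

(** Since [|node k| >= k / 2], the terms compare with the telescoping series of
    [1 / ((k + 1) (k + 2))]. The constant comes from [(k + 1) (k + 2) <= 2 + 6 k^2] and
    [6 k^2 <= (24 / d^2) (d * node k)^2]. *)
Lemma sum_node_le (d : R) n : 0 < d -> \sum_(k < n) w (d * node k) <= 2 + 24 / d ^+ 2.
Proof.
move=> d0; set a := 2 + _; have a2 : 2 <= a by rewrite lerDl divr_ge0// sqr_ge0.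
have node2 k : (k%:R / 2) ^+ 2 <= node k ^+ 2.
  have ke : k%:R = (odd k)%:R + 2 * (k./2)%:R :> R.
    by rewrite -{1}[k]odd_double_half natrD -mul2n natrM.
  have := ler0n R k./2; move: ke; rewrite /node; case: (odd k) => -> h.
    rewrite [true%:R](_ : _ = 1)// sqrrN -[k./2.+1%:R]natr1; move: h; set j : R := (k./2)%:R => h.
    by rewrite lerXn2r ?nnegrE; lra.
  rewrite [false%:R](_ : _ = 0)//; move: h; set j : R := (k./2)%:R => h.
  by rewrite lerXn2r ?nnegrE; lra.
have wk k : w (d * node k) <= a / (k.+1%:R * k.+2%:R).
  rewrite /w -[X in X <= _]mul1r ler_pdivrMr ?w_den_gt0// mulrAC ler_pdivlMr ?mulr_gt0// mul1r.
  have d2 : 0 < d ^+ 2 by rewrite exprn_gt0.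
  have : (k%:R / 2) ^+ 2 * d ^+ 2 <= (d * node k) ^+ 2 by rewrite [(d * _) ^+ 2]exprMn mulrC ler_wpM2l ?node2// ltW.
  rewrite -[k.+2%:R]natr1 -[k.+1%:R]natr1; set z := (d * _) ^+ 2; set x := k%:R => h.
  have z0 : 0 <= z by rewrite sqr_ge0.
  have hx : x * x * 6 <= 24 / d ^+ 2 * z.
    rewrite [leRHS]mulrAC ler_pdivlMr// (le_trans _ (ler_wpM2l (ler0n _ 24) h))//.
    by rewrite le_eqVlt; apply/orP; left; apply/eqP; field.
  have xx : x <= x * x.
    by rewrite /x; case: (k) => [|j]; [rewrite mul0r|rewrite ler_peMl// ler1n].
  have x0 : 0 <= x by rewrite /x.
  rewrite /a mulrDl !mulrDr.
  have : 0 <= 24 / d ^+ 2 by rewrite divr_ge0 ?ltW.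
  nra.
apply: (@le_trans _ _ (a * (1 - n.+1%:R^-1))).
  elim: n => [|n IH]; first by rewrite big_ord0 invr1 subrr mulr0.
  rewrite big_ord_recr/=; apply: le_trans (lerD IH (wk n)) _.
  rewrite le_eqVlt; apply/orP; left; apply/eqP; field.
  by have := ler0n R n => n0; rewrite !gt_eqF//; lra.
by rewrite ler_piMr ?(le_trans _ a2)// gerBl invr_ge0.
Qed.

End Partition.

(** * Sums and limits in the duality identity, and weighted convolution bounds *)

Section LimitOfDual.
Context {R : realType}.
Local Notation mu := (@lebesgue_measure R).
Implicit Types (F G g h : R -> R[i]).

Lemma ccvgMr z_ (z c : R[i]) : ccvg z_ z -> ccvg (fun n => z_ n * c) (z * c).
Proof.
move=> [a b]; split; rewrite ReImE; under eq_fun do rewrite ReImE.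
  by apply: cvgB; apply: cvgM => //; exact: cvg_cst.
by apply: cvgD; apply: cvgM => //; exact: cvg_cst.
Qed.

Lemma IsInvFT_sum n (h_ g_ : nat -> R -> R[i]) : (forall k, L2 (h_ k)) ->
  (forall k, IsInvFT (h_ k) (g_ k)) ->
  forall phi, schwartz phi -> cint (fun x => (\sum_(k < n) g_ k x) * phi x) =
    cint (fun x => (\sum_(k < n) h_ k x) * invFT phi x).
Proof.
move=> Lh hg phi sphi.
under eq_cint do rewrite mulr_suml; under [RHS]eq_cint do rewrite mulr_suml.
have [|_ ->] := @cint_sum _ n (fun k x => g_ k x * phi x).
  by move=> k; apply: L2_mul_cI; [case: (hg k)|exact: schwartz_L2].
have [|_ ->] := @cint_sum _ n (fun k x => h_ k x * invFT phi x).
  by move=> k; apply: L2_mul_cI; [exact: Lh|exact/schwartz_L2/schwartz_invFT].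
by apply: eq_bigr => k _; case: (hg k) => _ ->.
Qed.

(** Dominated convergence on both sides of the duality identity: a square-integrable majorant times
    a Schwartz function is integrable. *)
Lemma IsInvFT_limit (F_ G_ : nat -> R -> R[i]) F G (X Y : R -> R) :
  (forall n, cmeas (F_ n)) -> (forall n, cmeas (G_ n)) ->
  (forall x, ccvg (fun n => F_ n x) (F x)) -> (forall x, ccvg (fun n => G_ n x) (G x)) ->
  measurable_fun setT X -> measurable_fun setT Y ->
  intb (fun x => X x ^+ 2) -> intb (fun x => Y x ^+ 2) ->
  (forall n x, cn (F_ n x) <= X x) -> (forall n x, cn (G_ n x) <= Y x) ->
  L2 G ->
  (forall n phi, schwartz phi ->
     cint (fun x => G_ n x * phi x) = cint (fun x => F_ n x * invFT phi x)) ->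
  IsInvFT F G.
Proof.
move=> mF mG cF cG mX mY iX iY FX GY LG dual; split => // phi sphi.
have lim (H_ : nat -> R -> R[i]) H (Z : R -> R) u : schwartz u -> (forall n, cmeas (H_ n)) ->
    (forall x, ccvg (fun n => H_ n x) (H x)) -> measurable_fun setT Z ->
    intb (fun x => Z x ^+ 2) -> (forall n x, cn (H_ n x) <= Z x) ->
    ccvg (fun n => cint (fun x => H_ n x * u x)) (cint (fun x => H x * u x)).
  move=> su mH cH mZ iZ HZ; have mu_ := schwartz_meas su.
  have [||||//] := @cint_dct _ (fun n x => H_ n x * u x) (fun x => H x * u x) (fun x => Z x * cn (u x)).
  - by move=> n; exact: cmeasM.
  - by move=> x; exact: ccvgMr.
  - by apply: intb_mul => //; [exact: cmeas_cn|exact: schwartz_sqr].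
  - by move=> n x; rewrite cnM ler_wpM2r ?cn_ge0.
apply: ccvg_unique (lim _ _ _ _ sphi mG cG mY iY GY) _.
under eq_fun do rewrite (dual _ _ sphi).
exact: lim (schwartz_invFT sphi) mF cF mX iX FX.
Qed.

Lemma cn_cconv_weighted (v : R -> R) (C c : R) (m g : R -> R[i]) :
  measurable_fun setT v -> (forall x, 1 <= v x) -> (forall s t, v (s + t) <= C * (v s + v t)) ->
  cmeas m -> (forall x, v x * cn (m x) <= c * w x) -> cmeas g ->
  intb (fun x => (v x * cn (g x)) ^+ 2) ->
  forall x, v x * cn (cconv m g x) <= 2 * C * c * conv w (fun y => v y * cn (g y)) x.
Proof.
move=> mv v1 vC mm mc mg ig x.
have v0 y : 0 <= v y by exact: le_trans (v1 y).
have C0 : 0 <= C by have := vC 0 0; have := v1 (0 + 0); have := v1 0; nra.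
have c0 : 0 <= c by rewrite -(pmulr_lge0 _ (w_gt0 0)) (le_trans _ (mc 0))// mulr_ge0// cn_ge0.
have mc' y : cn (m y) <= c * w y by apply: le_trans (mc y); rewrite ler_peMl ?cn_ge0.
have mq : measurable_fun setT (fun y => v y * cn (g y)) by apply: measurable_funM => //; exact: cmeas_cn.
have q0 y : 0 <= v y * cn (g y) by rewrite mulr_ge0 ?cn_ge0.
have Lg : L2 g.
  apply/L2P; split => //; apply: (intb_le _ ig); first by apply: measurable_funX; exact: cmeas_cn.
  by move=> y; rewrite ger0_norm ?sqr_ge0// lerXn2r ?nnegrE ?cn_ge0// ler_peMl ?cn_ge0.
have ic := cconv_int mm mc' Lg x.
apply: le_trans (ler_wpM2l (v0 x) (cint_norm ic)) _.
rewrite -RintegralZl//; last exact: cI_cn.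
rewrite /conv -RintegralZl//; last exact: convw_int.
apply: Rint_le; [exact/intbZ/cI_cn|exact/intbZ/convw_int|].
move=> y; rewrite cnM.
(* As [v >= 1], the sum of two values of [v] is at most twice their product. *)
have vx : v x <= 2 * C * (v (x - y) * v y).
  have := vC (x - y) y; rewrite subrK => /le_trans; apply.
  rewrite -mulrA mulrCA ler_wpM2l//; have := v1 (x - y); have := v1 y; nra.
apply: le_trans (ler_wpM2r _ vx) _; first by rewrite mulr_ge0 ?cn_ge0.
have -> : 2 * C * (v (x - y) * v y) * (cn (m (x - y)) * cn (g y)) =
  2 * C * (v y * cn (g y)) * (v (x - y) * cn (m (x - y))) by ring.
have -> : 2 * C * c * (w (x - y) * (v y * cn (g y))) =
  2 * C * (v y * cn (g y)) * (c * w (x - y)) by ring.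
by rewrite ler_wpM2l// mulr_ge0// mulr_ge0.
Qed.

End LimitOfDual.

Section ChangeOfWindow.
Context {R : realType}.
Local Notation mu := (@lebesgue_measure R).
Variables (v : R -> R) (C : R) (eta psi rho : R -> R[i]) (s : nat -> R) (a : R).
Hypotheses (mv : measurable_fun setT v) (v1 : forall x, 1 <= v x)
  (vC : forall s t, v (s + t) <= C * (v s + v t)).
Hypotheses (seta : schwartz eta) (spsi : schwartz psi) (srho : schwartz rho).
Hypothesis wa : forall n, \sum_(k < n) w (s k) <= a.
Hypothesis part1 : forall x,
  \forall n \near \oo, \sum_(k < n) (rho (x - s k) * eta (x - s k)) = 1.

Let v0 x : 0 <= v x. Proof. exact: le_trans (v1 x). Qed.

(** Phrased with explicit representatives and a bound [B] rather than with [Wnorm], so that the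
    infimum is handled separately; [K] is fixed before [f], [t] and [B], which is the uniformity
    sought. *)
Lemma change_of_window : exists2 K : R, 0 <= K & forall (f : R -> R[i]) (t B : R),
  (forall b, exists g, [/\ L2 (fun x => tau b eta x * f x),
     IsInvFT (fun x => tau b eta x * f x) g,
     intb (fun x => (v x * cn (g x)) ^+ 2) &
     Rint (fun x => (v x * cn (g x)) ^+ 2) <= B]) ->
  L2 (fun x => tau t psi x * f x) /\ exists G,
    [/\ IsInvFT (fun x => tau t psi x * f x) G,
     intb (fun x => (v x * cn (G x)) ^+ 2) &
     Rint (fun x => (v x * cn (G x)) ^+ 2) <= K * B].
Proof.
have C0 : 0 <= C by have := vC 0 0; have := v1 (0 + 0); have := v1 0; nra.
have [K0 [D [K00 vK]]] := v_poly_bound mv v1 vC.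
have [K Kge0 hK] := invFT_window_bound K00 v0 vK spsi srho.
have [N N0 hN] := window_bound spsi srho.
have [M M0 hM] := schwartz_bounded seta.
pose c k := w (s k); have c0 k : 0 < c k by exact: w_gt0.
pose E := 2 * C * K; have E0 : 0 <= E by rewrite mulr_ge0// mulr_ge0.
(* [E] collects the constant [2 C] of the product bound on [v] and the kernel bound [K];
   [Rint w ^+ 2] is the factor from Young's inequality and [a ^+ 2] that from the summation over
   [k]. *)
exists (a ^+ 2 * (E ^+ 2 * Rint w ^+ 2)) => [|f t B hB]; first by apply: mulr_ge0; [|apply: mulr_ge0]; exact: sqr_ge0.
have /choice[g_ hg] : forall k, exists g, _ := fun k => hB (t + s k).
pose m_ k x := window psi rho (s k) (x - t).
pose b_ k x := tau (t + s k) eta x * f x.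
pose h_ k x := m_ k x * b_ k x.
pose G_ k := cconv (invFT (m_ k)) (g_ k).
have sm k : schwartz (m_ k) := schwartz_shift (- t) (schwartz_window (s k) spsi srho).
have Lb k : L2 (b_ k) by case: (hg k).
have bg k : IsInvFT (b_ k) (g_ k) by case: (hg k).
have mg k : cmeas (g_ k) by case: (hg k) => _ [/L2P[]].
have ig k : intb (fun x => (v x * cn (g_ k x)) ^+ 2) by case: (hg k).
have gB k : Rint (fun x => (v x * cn (g_ k x)) ^+ 2) <= B by case: (hg k).
have B0 : 0 <= B by apply: le_trans (gB 0%N); apply: Rintegral_ge0 => x _; exact: sqr_ge0.
have mN k x : cn (m_ k x) <= N * c k.
  by apply: le_trans (hN _ _) _; rewrite ler_piMr ?w_le1// mulr_ge0 ?w_ge0.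
(* The translation by [t] contributes a factor of modulus 1, so the bound does not depend on [t]. *)
have mV k x : v x * cn (invFT (m_ k) x) <= K * c k * w x.
  rewrite (invFT_shift t x (schwartz_cI (schwartz_window (s k) spsi srho))) cnM cn_expi mul1r.
  exact: hK.
have Lh k : L2 (h_ k) := L2_bounded_mul (schwartz_meas (sm k)) (mN k) (Lb k).
have hG k : IsInvFT (h_ k) (G_ k) := IsInvFT_mul (sm k) (Lb k) (bg k).
have mG k : cmeas (G_ k) by case: (hG k) => /L2P[].
pose q_ k x := v x * cn (g_ k x).
have mq k : measurable_fun setT (q_ k) by apply: measurable_funM => //; exact: cmeas_cn.
have q0 k x : 0 <= q_ k x by rewrite mulr_ge0 ?cn_ge0.
have GV k x : v x * cn (G_ k x) <= c k * (E * conv w (q_ k) x).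
  have := cn_cconv_weighted mv v1 vC (schwartz_meas (schwartz_invFT (sm k))) (mV k) (mg k) (ig k) x.
  by congr (_ <= _); rewrite /E; ring.
(* On the side of [f] the weight is 1: the aim is the square-integrability of [F] and the majorant
   [X]. The norms of the pieces [b_ k] are bounded through [plancherel_le] and [v >= 1]. *)
have [F [X [mF cF [iX mX] FX [iF _]]]] : exists (F : R -> R[i]) (X : R -> R),
  [/\ cmeas F, forall x, ccvg (fun n => \sum_(k < n) h_ k x) (F x),
     intb (fun x => X x ^+ 2) /\ measurable_fun setT X,
     forall n x, cn (\sum_(k < n) h_ k x) <= X x &
     intb (fun x => (1 * cn (F x)) ^+ 2) /\
     Rint (fun x => (1 * cn (F x)) ^+ 2) <= a ^+ 2 * (N ^+ 2 * B)].
  apply: (@weighted_series _ c a (fun _ => 1) (N ^+ 2 * B) h_) => //.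
  - by move=> k; case/L2P: (Lh k).
  - by move=> k; under eq_fun do rewrite mul1r; case/L2P: (Lh k).
  - move=> k; under eq_Rintegral do rewrite mul1r.
    have /L2P[_ ih] := Lh k; have /L2P[_ ib] := Lb k.
    apply: (@le_trans _ _ ((N * c k) ^+ 2 * Rint (fun x => cn (b_ k x) ^+ 2))).
      rewrite -RintegralZl//; apply: Rint_le => //; first exact: intbZ.
      move=> x; rewrite cnM -exprMn lerXn2r ?nnegrE ?mulr_ge0 ?cn_ge0 ?w_ge0//.
      by rewrite ler_wpM2r ?cn_ge0.
    rewrite exprMn mulrAC [c k ^+ 2 * _]mulrC ler_wpM2r ?sqr_ge0// ler_wpM2l ?sqr_ge0//.
    have Lg : L2 (g_ k) by case: (hg k) => _ [].
    apply: le_trans (plancherel_le (Lb k) (bg k)) _.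
    apply: le_trans (gB k); apply: Rint_le => //; first by case/L2P: Lg.
    by move=> x; rewrite lerXn2r ?nnegrE ?mulr_ge0 ?cn_ge0// ler_peMl ?cn_ge0.
  - move=> x; exists (N * M * cn (f x)) => k.
    rewrite /h_ cnM /b_ [cn (tau _ _ _ * _)]cnM [leRHS](_ : _ = N * c k * (M * cn (f x))); last by ring.
    apply: ler_pM; [exact: cn_ge0|by rewrite mulr_ge0 ?cn_ge0|exact: mN|].
    by apply: ler_wpM2r; [exact: cn_ge0|exact: hM].
(* On the Fourier side the weight is [v], and the bound obtained is the one claimed. *)
have [G [Y [mGl cG [iY mY] GY [iG GB]]]] : exists (G : R -> R[i]) (Y : R -> R),
  [/\ cmeas G, forall x, ccvg (fun n => \sum_(k < n) G_ k x) (G x),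
     intb (fun x => Y x ^+ 2) /\ measurable_fun setT Y,
     forall n x, cn (\sum_(k < n) G_ k x) <= Y x &
     intb (fun x => (v x * cn (G x)) ^+ 2) /\
     Rint (fun x => (v x * cn (G x)) ^+ 2) <= a ^+ 2 * (E ^+ 2 * Rint w ^+ 2 * B)].
  have G2 k x : (v x * cn (G_ k x)) ^+ 2 <= (c k * E) ^+ 2 * conv w (q_ k) x ^+ 2.
    rewrite -exprMn lerXn2r ?nnegrE ?mulr_ge0 ?cn_ge0//.
    - exact: w_ge0.
    - by apply: conv_ge0; [exact: w_ge0|exact: q0].
    - by rewrite -mulrA GV.
  have iG2 k : intb (fun x => (v x * cn (G_ k x)) ^+ 2).
    apply: (intb_le _ (intbZ ((c k * E) ^+ 2) (convw_young (mq k) (q0 k) (ig k)).1)).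
      by apply: measurable_funX; apply: measurable_funM => //; exact: cmeas_cn.
    by move=> x; rewrite ger0_norm ?sqr_ge0.
  apply: (@weighted_series _ c a v _ G_) => //.
  - move=> k; have [iy ly] := convw_young (mq k) (q0 k) (ig k).
    apply: le_trans (Rint_le (iG2 k) (intbZ ((c k * E) ^+ 2) iy) (G2 k)) _.
    rewrite RintegralZl// (_ : c k ^+ 2 * _ = (c k * E) ^+ 2 * (Rint w ^+ 2 * B)); last by ring.
    rewrite ler_wpM2l ?sqr_ge0//.
    exact: le_trans ly (ler_wpM2l (sqr_ge0 _) (gB k)).
  - move=> x; exists (E * (Rint w + B)) => k.
    apply: le_trans (_ : _ <= v x * cn (G_ k x)) _; first by rewrite ler_peMl ?cn_ge0.
    apply: le_trans (GV k x) _; rewrite ler_wpM2l ?(ltW (c0 k))// ler_wpM2l//.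
    by apply: le_trans (convw_bounded x (mq k) (q0 k) (ig k)) _; rewrite lerD2l; exact: gB.
(* At each point the partial sums of the partition of unity eventually equal 1, so the partial sums
   of the [h_ k] are eventually constant. *)
have FE : F = fun x => tau t psi x * f x.
  apply/funext => x; apply: ccvg_unique (cF x) _.
  have hE n : \sum_(k < n) h_ k x =
      tau t psi x * f x * \sum_(k < n) (rho (x - t - s k) * eta (x - t - s k)).
    rewrite mulr_sumr; apply: eq_bigr => k _.
    by rewrite /h_ /m_ /b_ /window /tau opprD addrA; ring.
  by split; apply: cvg_near_cst; have := part1 (x - t); apply: filterS => n; rewrite hE => ->; rewrite mulr1.
rewrite -FE; split.
  by apply/L2P; split => //; under eq_fun do rewrite -[cn _]mul1r.
exists G; split => //; last by rewrite -mulrA.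
apply: (IsInvFT_limit (F_ := fun n x => \sum_(k < n) h_ k x)
  (G_ := fun n x => \sum_(k < n) G_ k x) (X := X) (Y := Y)) => //.
- by move=> n; apply: cmeas_sum => k; case/L2P: (Lh k).
- by move=> n; exact: cmeas_sum.
- apply/L2P; split => //; apply: (intb_le _ iG); first by apply: measurable_funX; exact: cmeas_cn.
  by move=> x; rewrite ger0_norm ?sqr_ge0// lerXn2r ?nnegrE ?mulr_ge0 ?cn_ge0// ler_peMl ?cn_ge0.
- by move=> n phi; exact: IsInvFT_sum.
Qed.

End ChangeOfWindow.

(** * The weighted norm as an infimum over representatives *)

Section WeightedNorm.
Context {R : realType}.
Local Notation mu := (@lebesgue_measure R).
Variables (v : R -> R).
Hypotheses (mv : measurable_fun setT v) (v1 : forall x, 1 <= v x).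

Lemma wint2E g : wint2 v g = (\int[mu]_x ((v x * cn (g x)) ^+ 2)%:E)%E.
Proof. by apply: eq_integral => x _; rewrite abs2E exprMn. Qed.

Lemma wint2_ge0 g : (0 <= wint2 v g)%E.
Proof. by rewrite wint2E; apply: integral_ge0 => x _; rewrite lee_fin sqr_ge0. Qed.

Lemma wint2_intb g (B : R) : L2 g -> (wint2 v g <= B%:E)%E ->
  intb (fun x => (v x * cn (g x)) ^+ 2) /\ Rint (fun x => (v x * cn (g x)) ^+ 2) <= B.
Proof.
move=> /L2P[mg _]; rewrite wint2E => gB.
have i : intb (fun x => (v x * cn (g x)) ^+ 2).
  apply: (intb_ge0P _ _ gB) => [|x]; last exact: sqr_ge0.
  by apply: measurable_funX; apply: measurable_funM => //; exact: cmeas_cn.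
by split => //; rewrite -lee_fin EFin_Rint.
Qed.

Lemma wint2_Rint g : intb (fun x => (v x * cn (g x)) ^+ 2) ->
  wint2 v g = (Rint (fun x => (v x * cn (g x)) ^+ 2))%:E.
Proof. by move=> i; rewrite wint2E EFin_Rint. Qed.

Lemma Wnorm_le f g (B : R) : IsInvFT f g -> (wint2 v g <= B%:E)%E -> Wnorm v f <= Num.sqrt B.
Proof.
move=> fg gB; rewrite /Wnorm ler_wsqrtr//.
have inf_le : (ereal_inf [set wint2 v g | g in [set g | IsInvFT f g]] <= B%:E)%E.
  by apply: le_trans gB; apply: ereal_inf_lbound; exists g.
rewrite -lee_fin fineK// ge0_fin_numE; first by rewrite (le_lt_trans inf_le) ?ltry.
by apply: le_ereal_inf_tmp => _ [h _ <-]; exact: wint2_ge0.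
Qed.

(** A representative within [e] of the infimum; membership makes that infimum finite, which is what
    allows the approximation and the passage through [fine]. *)
Lemma Wmem_approx f (e : R) : Wmem v f -> 0 < e ->
  exists2 g, IsInvFT f g & (wint2 v g <= (Wnorm v f ^+ 2 + e)%:E)%E.
Proof.
move=> [_ [g0 [fg0 g0oo]]] e0; rewrite /Wnorm.
set S := [set wint2 v g | g in [set g | IsInvFT f g]].
have S0 : (0 <= ereal_inf S)%E.
  by apply: le_ereal_inf_tmp => _ [h _ <-]; exact: wint2_ge0.
have Sfin : ereal_inf S \is a fin_num.
  by rewrite ge0_fin_numE// (le_lt_trans _ g0oo)//; apply: ereal_inf_lbound; exists g0.
have [_ [g fg <-] ge] := lb_ereal_inf_adherent e0 Sfin.
by exists g => //; rewrite sqr_sqrtr ?fine_ge0// EFinD fineK// ltW.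
Qed.

End WeightedNorm.

Theorem theorem4p3 (R : realType) (v : R -> R) (eta psi : R -> R[i]) :
  admissible v ->
  schwartz eta -> eta <> (fun _ => 0) ->
  schwartz psi -> psi <> (fun _ => 0) ->
  exists C : R, 0 < C /\
    forall f : R -> R[i], Hmem v eta f ->
      Hmem v psi f /\ (Hnorm v psi f <= C%:E * Hnorm v eta f)%E.
Proof.
move=> [mv [v1 [C vC]]] seta eta0 spsi _.
have [x0 [d [rho [d0 srho rhoE]]]] := local_inverse seta eta0.
(* The lattice has step [d]: in the variable [(x - x0) / d] the shifts by [d * node k] become
   integer shifts of [hat]. *)
have [|K K0 hK] := @change_of_window _ v C eta psi rho (fun k => d * node k) _ mv v1 vC seta spsi srho
  (fun n => @sum_node_le R d n d0).
  move=> x; have := sum_hat ((x - x0) / d); apply: filterS => n hn.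
  have -> : \sum_(k < n) (rho (x - d * node k) * eta (x - d * node k)) =
      \sum_(k < n) (hat ((x - x0) / d - node k))%:C.
    apply: eq_bigr => k _; rewrite rhoE; congr (hat _)%:C.
    by field; rewrite gt_eqF.
  by rewrite -rmorph_sum/= hn.
(* [K] is only known to be nonnegative, and the constant has to be positive. *)
exists (Num.sqrt (K + 1)); split; first by rewrite sqrtr_gt0 ltr_wpDl.
move=> f [Lf [Wf Hf]].
have Hf0 : (0 <= Hnorm v eta f)%E.
  apply: le_trans (_ : _ <= (Wnorm v (fun x => tau 0 eta x * f x))%:E)%E _.
    by rewrite lee_fin sqrtr_ge0.
  by apply: ereal_sup_ubound; exists 0.
have Hfin : Hnorm v eta f \is a fin_num by rewrite ge0_fin_numE.
set A := fine (Hnorm v eta f); have A0 : 0 <= A by exact: fine_ge0.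
have WA t : Wnorm v (fun x => tau t eta x * f x) <= A.
  by rewrite -lee_fin fineK//; apply: ereal_sup_ubound; exists t.
have main t e : 0 < e -> L2 (fun x => tau t psi x * f x) /\ exists2 G,
    IsInvFT (fun x => tau t psi x * f x) G & (wint2 v G <= (K * (A ^+ 2 + e))%:E)%E.
  move=> e0; have [b|L [G [fG iG GB]]] := hK f t (A ^+ 2 + e).
    have [g fg gB] := Wmem_approx (Wf b) e0.
    have Lg : L2 g by case: fg.
    have [|ig gB'] := wint2_intb mv Lg (le_trans gB _ : (wint2 v g <= (A ^+ 2 + e)%:E)%E).
      by rewrite lee_fin lerD2r lerXn2r ?nnegrE ?sqrtr_ge0.
    by exists g; split => //; case: (Wf b).
  by split => //; exists G => //; rewrite (wint2_Rint iG) lee_fin.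
have Wpsi t : Wnorm v (fun x => tau t psi x * f x) <= Num.sqrt (K + 1) * A.
  have We e : 0 < e -> Wnorm v (fun x => tau t psi x * f x) ^+ 2 <= K * A ^+ 2 + e.
    (* The error is multiplied by [K] along the way, and [K * (e / (K + 1)) <= e]. *)
    move=> e0; have e'0 : 0 < e / (K + 1) by rewrite divr_gt0// ltr_wpDl.
    have [_ [G fG GB]] := main t _ e'0.
    have Ke : K * (A ^+ 2 + e / (K + 1)) <= K * A ^+ 2 + e.
      rewrite mulrDr lerD2l mulrCA ger_pMr// ler_pdivrMr ?ltr_wpDl//; lra.
    apply: le_trans Ke; rewrite -[leRHS]sqr_sqrtr; last first.
      by rewrite mulr_ge0// addr_ge0 ?sqr_ge0// ltW.
    by rewrite lerXn2r ?nnegrE ?sqrtr_ge0//; exact: Wnorm_le GB.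
  rewrite -(@ler_pXn2r _ 2)// ?nnegrE ?mulr_ge0 ?sqrtr_ge0//.
  rewrite exprMn [_ (K + 1) ^+ 2]sqr_sqrtr ?addr_ge0//.
  apply: (@le_trans _ _ (K * A ^+ 2)); first exact/ler_addgt0Pr.
  by rewrite ler_wpM2r ?sqr_ge0// lerDl.
have HC : (Hnorm v psi f <= (Num.sqrt (K + 1))%:E * Hnorm v eta f)%E.
  by apply: ge_ereal_sup => _ [t _ <-]; rewrite -(fineK Hfin) -EFinM lee_fin.
split; last exact: HC.
split; first exact: Lf.
split.
  move=> t; have [L [G fG GB]] := main t 1 ltr01; split; first exact: L.
  by exists G; split; [exact: fG|rewrite (le_lt_trans GB) ?ltry].
by rewrite (le_lt_trans HC)// -(fineK Hfin) -EFinM ltry.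
Qed.
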